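(* Let $\beta>0$ be fixed and assume $\lambda_n\to\lambda\in[0,1]$. Given $G_n$, sample $T_n,T_n'$ independently from $\mu_{G_n,\beta}$. Then \[\mathsf R(T_n,T_n')\to\begin{cases}0&\text{if }\lambda\in\{0,1\}\text{ or }\beta<1,\\ f(\lambda)&\text{if }\lambda\in(0,1)\text{ and }\beta>1\end{cases}\] in probability, where $f(\lambda)=(1-\lambda)\,\mathbb E[1/X\mid X>0]$ with $X\sim\mathrm{Poisson}(\log(1/\lambda))$.
   Context: Let $(\alpha_n)$ be a sequence in $(0,\infty)$ with $0<\liminf\alpha_n\le\limsup\alpha_n<\infty$, $q_n=\alpha_n\log n/n$, $G_n\sim\mathcal G(n,q_n)$ on $\{1,\dots,n\}$. Let $d_n^*=\min\{d\in\mathbb Z:(nq_n)^d\ge n/(\log\log n)^2\}$ and $\lambda_n\in(0,1)$ with $\log(1/\lambda_n)=(nq_n)^{d_n^*}/n$. Let $\overline G_n$ be the component of $G_n$ containing $1$, vertex set $\overline V_n$; $\mu_{G_n,\beta}(T)\propto\exp\big(-\beta\log\log(n)\sum_{v\in\overline V_n}\mathsf d_T(1,v)\big)$ on spanning trees $T$ of $\overline G_n$. Trees are rooted at $1$ with edges directed toward children; $\mathsf R(T,T')=|T\cap T'|/\sqrt{|T||T'|}$ where $T\cap T'$ is the set of common directed edges and $|T|$ the number of edges. *)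

(* Defs.v *)
From HB Require Import structures.
From mathcomp Require Export all_boot all_order all_algebra.
From mathcomp Require Export all_classical all_reals all_analysis.

Set Implicit Arguments.
Unset Strict Implicit.
Unset Printing Implicit Defensive.

Import Order.TTheory GRing.Theory Num.Theory.
Export numFieldNormedType.Exports.

Local Open Scope classical_set_scope.
Local Open Scope ring_scope.

(* A simple graph on V is given by its edge set, a set of 2-element subsets
   of V. *)
Section graphs.
Variable V : finType.
Implicit Types (G T : {set {set V}}) (x y r : V).

Definition all_edges : {set {set V}} := [set e : {set V} | #|e| == 2%N].

Definition adj G : rel V := fun x y => [set x; y]%SET \in G.

Definition component G r : {set V} := [set v | connect (adj G) r v].

Definition component_edges G r : {set {set V}} :=
  [set e in G | e \subset component G r].

Definition acyclic T : Prop :=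
  forall c : seq V, (2 < size c)%N -> uniq c -> ~~ cycle (adj T) c.

(* T is a spanning tree of the connected component of r in G. *)
Definition spanning_tree G r T : Prop :=
  [/\ T \subset component_edges G r,
      {in component G r &, forall x y, connect (adj T) x y}
    & acyclic T].

(* Length of a shortest path; in a graph on V this is < #|V| whenever x and y
   are connected, and the default value is #|V| otherwise. *)
Definition gdist T x y : nat :=
  \big[minn/#|V|]_(k < #|V| |
     [exists p : k.-tuple V, path (adj T) x p && (last x p == y)]) k.

(* The edges of the tree T rooted at r, as pairs (parent, child). *)
Definition directed_edges r T : {set V * V} :=
  [set p | adj T p.1 p.2 & gdist T r p.2 == (gdist T r p.1).+1].

Definition overlap (R : realType) r T T' : R :=
  #|directed_edges r T :&: directed_edges r T'|%SET%:R
  / Num.sqrt (#|T|%:R * #|T'|%:R).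

(* Probability of the edge set G under the law G(#|V|, p). *)
Definition erdos_renyi (R : realType) (p : R) G : R :=
  if G \subset all_edges
  then \prod_(e in all_edges) (if e \in G then p else 1 - p) else 0.

Definition gibbs_weight (R : realType) (b : R) G r T : R :=
  if `[< spanning_tree G r T >]
  then expR (- b * \sum_(v in component G r) (gdist T r v)%:R) else 0.

Definition gibbs (R : realType) (b : R) G r T : R :=
  gibbs_weight b G r T / \sum_(S : {set {set V}}) gibbs_weight b G r S.

(* Probability that (G, T, T') satisfies E when G follows G(#|V|, p) and, given
   G, T and T' are independent with law gibbs b G r. *)
Definition replica_prob (R : realType) (p b : R) r
    (E : {set {set V}} -> {set {set V}} -> {set {set V}} -> bool) : R :=
  \sum_(G : {set {set V}}) erdos_renyi p G *
    \sum_(T : {set {set V}}) \sum_(T' : {set {set V}} | E G T T')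
      gibbs b G r T * gibbs b G r T'.

End graphs.

Section model.
Variable R : realType.
Implicit Types (alpha : nat -> R) (n : nat).

Definition q_ alpha n : R := alpha n * ln n%:R / n%:R.

Definition is_dstar alpha n (d : int) : Prop :=
  let reaches (k : int) := n%:R / (ln (ln n%:R)) ^+ 2 <= (n%:R * q_ alpha n) ^ k in
  reaches d /\ forall k, reaches k -> d <= k.

(* The minimum exists when log n > 1 and n q_n > 1 (dstarP below), hence for all
   large n if liminf alpha_n > 0; the default 0 covers the other n. *)
Definition dstar alpha n : int := xget 0 (is_dstar alpha n).

(* The solution of log (1 / lambda_n) = (n q_n)^(d_n^* ) / n, see
   ln_lambda_ and lambda_itv below. *)
Definition lambda_ alpha n : R :=
  expR (- ((n%:R * q_ alpha n) ^ (dstar alpha n) / n%:R)).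

(* The graph G_n with n = m.+1 lives on 'I_m.+1, and the root, vertex 1, is
   ord0.  The edge probability is truncated at 1 so that the law is always a
   probability; this only affects finitely many n since q_n --> 0. *)
Definition overlap_tail alpha (beta c eps : R) (m : nat) : R :=
  let n := m.+1 in
  @replica_prob 'I_m.+1 R (Num.min (q_ alpha n) 1) (beta * ln (ln n%:R)) ord0
    (fun _ T T' => eps < `|overlap R ord0 T T' - c|).

Definition overlap_cvg_in_prob alpha (beta c : R) : Prop :=
  forall eps : R, 0 < eps ->
    overlap_tail alpha beta c eps m @[m --> \oo] --> (0 : R).

(* E[g | A] for an event A of positive probability. *)
Definition cond_expectation d (T : measurableType d) (P : probability T R)
    (A : set T) (g : T -> R) : R :=
  (\int[P]_(x in A) g x) / fine (P A).

(* The second argument of poisson_prob is a dummy. *)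
Definition f_overlap (lambda : R) : R :=
  (1 - lambda) *
  cond_expectation (poisson_prob (ln lambda^-1) 0) [set k : nat | (0 < k)%N]
    (fun k => (k%:R : R)^-1).

Lemma dstarP alpha n : 1 < ln n%:R :> R -> 1 < n%:R * q_ alpha n ->
  is_dstar alpha n (dstar alpha n).
Proof.
move=> lnn a1; rewrite /dstar; case: xgetP => [d _ //|] noex; exfalso.
set a := n%:R * q_ alpha n in a1; set y : R := n%:R / ln (ln n%:R) ^+ 2.
have a0 : 0 < a by apply: lt_trans a1.
have lna0 : 0 < ln a by exact: ln_gt0.
have n0 : (0 : R) < n%:R.
  by rewrite ltr0n lt0n; apply: contraTneq lnn => ->; rewrite ln0// ltr10.
have y0 : 0 < y by rewrite divr_gt0// exprn_gt0// ln_gt0.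
have aE (k : int) : a ^ k = expR (k%:~R * ln a).
  case: k => m; first by rewrite -pmulrn expRM_natl lnK.
  by rewrite NegzE mulrNz mulNr expRN -pmulrn expRM_natl lnK.
have reachE (k : int) : (y <= a ^ k) = (Num.ceil (ln y / ln a) <= k).
  by rewrite aE -{1}(lnK y0) ler_expR -ler_pdivrMr// ceil_le_int.
apply: (noex (Num.ceil (ln y / ln a))); split => [|k].
  by rewrite -/a -/y reachE.
by rewrite -/a -/y reachE.
Qed.

Lemma ln_lambda_ alpha n :
  ln (lambda_ alpha n)^-1 = (n%:R * q_ alpha n) ^ (dstar alpha n) / n%:R.
Proof. by rewrite /lambda_ -expRN opprK expRK. Qed.

Lemma lambda_itv alpha n : 0 < n%:R * q_ alpha n -> 0 < lambda_ alpha n < 1.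
Proof.
move=> a0; rewrite expR_gt0 /= expR_lt1 oppr_lt0 divr_gt0 ?exprz_gt0//.
case: n a0 => [|n _]; last by rewrite ltr0n.
by rewrite mul0r ltxx.
Qed.

End model.

(* Main.v *)
Require Import Defs.
From mathcomp Require Import all_boot all_order all_algebra.
From mathcomp Require Import all_classical all_reals all_analysis.
From mathcomp Require Import fintype finset ring lra zify.

Set Implicit Arguments.
Unset Strict Implicit.
Unset Printing Implicit Defensive.

Import Order.TTheory GRing.Theory Num.Theory.
Import numFieldNormedType.Exports.

Local Open Scope ring_scope.
Local Open Scope set_scope.

(** A spanning tree is determined by its parent function, and a vertex whose
    tree distance to the root exceeds its graph distance costs a factor
    [expR (- b)].  Hence the two-replica exponential moment of the number of
    common directed edges is at most a product over the vertices, up to the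
    squared weight of the breadth-first trees.  The square of the partition
    function is bounded below by trees built from independent choices of
    parents, so that the overlap concentrates by Chernoff's bound.

    If [beta > 1], or [beta = 1] and [lambda = 0], breadth-first trees are the
    right comparison, and the overlap is close to the mean over the vertices of
    the inverse number of parents.  Almost all vertices lie in the layers
    [D.+1] and [D.+2], where [D.+1 = dstar].  In the layer [D.+2] the number of
    parents diverges; a vertex belongs to the layer [D.+1] when it has a
    neighbour in the layer [D], and the number of such neighbours is asymptotically
    Poisson with mean [log (1 / lambda)].  If [beta < 1] or [lambda = 1], the
    comparison trees attach almost all vertices to a set of small vertex density
    in the layer [D.+1], which leaves them many possible parents, and the
    overlap vanishes.

    Exploring the layers one at a time keeps the edges to the unexplored vertices
    independent, so that given the explored ball the number of neighbours of an
    outer vertex in the last layer is binomial; moments of the layer sizes then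
    give all estimates on the random graph. *)

(** * Product Bernoulli measures on finite sets *)

Section bernoulli_product.
Variables (R : realType) (T : finType) (p : T -> R).
Hypothesis p01 : forall e, 0 <= p e <= 1.
Implicit Types (G S : {set T}) (f g : {set T} -> R) (A B : {set T} -> bool).

Definition bernoulli_weight G : R :=
  \prod_e (if e \in G then p e else 1 - p e).

Definition expect f : R := \sum_G bernoulli_weight G * f G.

Definition prob A : R := expect (fun G => (A G)%:R).

Lemma bernoulli_weight_ge0 G : 0 <= bernoulli_weight G.
Proof.
apply: prodr_ge0 => e _; have /andP[p0 p1] := p01 e.
by case: ifP => // _; rewrite subr_ge0.
Qed.

Lemma sum_bernoulli_weight : \sum_G bernoulli_weight G = 1.
Proof.
transitivity (\prod_(e : T) (p e + (1 - p e))); first by rewrite bigA_distr.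
by apply: big1 => e _; rewrite addrC subrK.
Qed.

Lemma expect_cst c : expect (fun=> c) = c.
Proof. by rewrite /expect -mulr_suml sum_bernoulli_weight mul1r. Qed.

Lemma eq_expect f g : f =1 g -> expect f = expect g.
Proof. by move=> fg; apply: eq_bigr => G _; rewrite fg. Qed.

Lemma expectD f g : expect (fun G => f G + g G) = expect f + expect g.
Proof. by rewrite -big_split; apply: eq_bigr => G _; rewrite mulrDr. Qed.

Lemma expectZ c f : expect (fun G => c * f G) = c * expect f.
Proof. by rewrite mulr_sumr; apply: eq_bigr => G _; rewrite mulrCA. Qed.

Lemma expectZr c f : expect (fun G => f G * c) = expect f * c.
Proof. by rewrite mulr_suml; apply: eq_bigr => G _; rewrite mulrA. Qed.

Lemma expectB f g : expect (fun G => f G - g G) = expect f - expect g.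
Proof.
rewrite -mulN1r -expectZ -expectD.
by apply: eq_expect => G; rewrite mulN1r.
Qed.

Lemma expect_sum (I : Type) (s : seq I) (P : pred I) (f : I -> {set T} -> R) :
  expect (fun G => \sum_(i <- s | P i) f i G) =
  \sum_(i <- s | P i) expect (f i).
Proof.
rewrite /expect exchange_big /=; apply: eq_bigr => G _.
by rewrite mulr_sumr.
Qed.

Lemma le_expect f g : (forall G, f G <= g G) -> expect f <= expect g.
Proof.
move=> fg; apply: ler_sum => G _.
by apply: ler_wpM2l; rewrite ?bernoulli_weight_ge0.
Qed.

Lemma expect_ge0 f : (forall G, 0 <= f G) -> 0 <= expect f.
Proof. by move=> f0; rewrite -[leLHS](expect_cst 0); exact: le_expect. Qed.

Lemma expect_le_cst f c : (forall G, f G <= c) -> expect f <= c.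
Proof. by move=> fc; rewrite -[leRHS](expect_cst c); exact: le_expect. Qed.

Lemma le_prob A B : (forall G, A G -> B G) -> prob A <= prob B.
Proof.
move=> AB; apply: le_expect => G; rewrite ler_nat.
by case: (A G) (AB G) => // /(_ isT) ->.
Qed.

Lemma prob_or_le A B : prob (fun G => A G || B G) <= prob A + prob B.
Proof.
rewrite -expectD; apply: le_expect => G.
by case: (A G); case: (B G); rewrite /= ?addr0 ?add0r ?lerDl.
Qed.

Lemma prob_markov c f : 0 < c -> (forall G, 0 <= f G) ->
  prob (fun G => c <= f G) <= expect f / c.
Proof.
move=> c0 f0; rewrite -expectZr; apply: le_expect => G.
case: (leP c (f G)) => [cf|_]; first by rewrite ler_pdivlMr// mul1r.
by rewrite divr_ge0// ltW.
Qed.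

Lemma expect_normr_le_sqrt f :
  expect (fun G => `|f G|) <= Num.sqrt (expect (fun G => f G ^+ 2)).
Proof.
set m := expect (fun G => `|f G|).
have m0 : 0 <= m by apply: expect_ge0.
rewrite -[leLHS](ger0_norm m0) -sqrtr_sqr; apply: ler_wsqrtr.
have : 0 <= expect (fun G => (`|f G| - m) ^+ 2).
  by apply: expect_ge0 => G; exact: sqr_ge0.
rewrite (@eq_expect _ (fun G => (f G ^+ 2 - 2 * m * `|f G|) + m ^+ 2)).
  rewrite expectD expect_cst expectB expectZ -/m; nra.
by move=> G; rewrite -[f G ^+ 2]real_normK ?num_real//; ring.
Qed.

Lemma expect_sqrt_le f : (forall G, 0 <= f G) ->
  expect (fun G => Num.sqrt (f G)) <= Num.sqrt (expect f).
Proof.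
move=> f0; rewrite [in leRHS](@eq_expect f (fun G => Num.sqrt (f G) ^+ 2)).
  apply: le_trans (expect_normr_le_sqrt _).
  by apply: le_expect => G; exact: ler_norm.
by move=> G; rewrite sqr_sqrtr.
Qed.

Definition depends_on (A : Type) S (f : {set T} -> A) :=
  forall G G', G :&: S = G' :&: S -> f G = f G'.

Lemma depends_onS (A : Type) S S' (f : {set T} -> A) :
  S \subset S' -> depends_on S f -> depends_on S' f.
Proof.
by move=> SS' fS G G' GG'; apply: fS; rewrite -(setIidPr SS') !setIA GG'.
Qed.

Definition swap_inside S (GG : {set T} * {set T}) :=
  ((GG.1 :&: S) :|: (GG.2 :\: S), (GG.2 :&: S) :|: (GG.1 :\: S)).

Lemma swap_insideK S : involutive (swap_inside S).
Proof.
by move=> [G G']; congr pair; apply/setP => e; rewrite !inE /=;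
  case: (e \in S); rewrite ?andbT ?andbF ?orbF.
Qed.

Lemma bernoulli_weight_swap S GG :
  bernoulli_weight (swap_inside S GG).1 * bernoulli_weight (swap_inside S GG).2
  = bernoulli_weight GG.1 * bernoulli_weight GG.2.
Proof.
rewrite /bernoulli_weight -!big_split /=; apply: eq_bigr => e _; rewrite !inE.
by case: (e \in S); rewrite ?andbT ?andbF ?orbF // mulrC.
Qed.

Lemma expect_prod f g :
  expect f * expect g =
  \sum_GG bernoulli_weight GG.1 * bernoulli_weight GG.2 * (f GG.1 * g GG.2).
Proof.
rewrite -(pair_bigA _ (fun G G' =>
  bernoulli_weight G * bernoulli_weight G' * (f G * g G'))) mulr_suml.
by apply: eq_bigr => G _; rewrite mulr_sumr; apply: eq_bigr => G' _; rewrite mulrACA.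
Qed.

(* Exchanging the parts outside S of two independent copies preserves their
   joint weight. *)
Lemma expect_indep S f g : depends_on S f -> depends_on (~: S) g ->
  expect (fun G => f G * g G) = expect f * expect g.
Proof.
move=> fS gS; rewrite -[LHS]mulr1 -[X in _ * X](expect_cst 1) !expect_prod.
rewrite (reindex_inj (inv_inj (swap_insideK S))) /=.
apply: eq_bigr => GG _; have := bernoulli_weight_swap S GG; rewrite /= => ->; rewrite mulr1.
congr (_ * (_ * _)); [apply: fS|apply: gS]; apply/setP => e; rewrite !inE;
by case: (e \in S); rewrite ?andbT ?andbF ?orbF.
Qed.

End bernoulli_product.
Arguments depends_on {T A}.

Section binomial_expectation.
Variable R : realType.
Implicit Types (q c M : R) (g : nat -> R).

(* The recursion conditions on the first of m Bernoulli(q) trials. *)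
Fixpoint binomial_expect q m g : R :=
  if m is m'.+1 then
    (1 - q) * binomial_expect q m' g + q * binomial_expect q m' (fun j => g j.+1)
  else g 0%N.

Lemma eq_binomial_expect q m g h :
  g =1 h -> binomial_expect q m g = binomial_expect q m h.
Proof.
elim: m g h => [|m IH] g h gh //=; rewrite (IH g h)//.
by rewrite (IH (fun j => g j.+1) (fun j => h j.+1)).
Qed.

Lemma binomial_expectD q m g h :
  binomial_expect q m (fun j => g j + h j) =
  binomial_expect q m g + binomial_expect q m h.
Proof. by elim: m g h => [|m IH] g h //=; rewrite !IH; ring. Qed.

Lemma binomial_expectZ q m c g :
  binomial_expect q m (fun j => c * g j) = c * binomial_expect q m g.
Proof. by elim: m g => [|m IH] g //=; rewrite !IH; ring. Qed.

Lemma binomial_expect_cst q m c : binomial_expect q m (fun=> c) = c.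
Proof. by elim: m => [|m IH] //=; rewrite !IH; ring. Qed.

Lemma binomial_expect_sum (I : Type) (s : seq I) (P : pred I) q m (f : I -> nat -> R) :
  binomial_expect q m (fun j => \sum_(i <- s | P i) f i j) =
  \sum_(i <- s | P i) binomial_expect q m (f i).
Proof.
elim: m f => [|m IH] f //=.
by rewrite (IH f) (IH (fun i j => f i j.+1)) !mulr_sumr -big_split.
Qed.

Lemma binomial_expect_id q m : binomial_expect q m (fun j => j%:R) = m%:R * q.
Proof.
elim: m => [|m IH] /=; first by rewrite mul0r.
rewrite IH; rewrite (@eq_binomial_expect _ _ _ (fun j => 1 + j%:R)).
  by rewrite binomial_expectD binomial_expect_cst IH -[in RHS]natr1; ring.
by move=> j; rewrite -natr1 addrC.
Qed.

Lemma binomial_expect_sqr q m :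
  binomial_expect q m (fun j => j%:R ^+ 2) =
  m%:R * q * (1 - q) + (m%:R * q) ^+ 2.
Proof.
elim: m => [|m IH] /=; first by rewrite !mul0r expr0n /= addr0.
rewrite IH (@eq_binomial_expect _ _ _ (fun j => (1 + 2 * j%:R) + j%:R ^+ 2)).
  rewrite !binomial_expectD binomial_expectZ binomial_expect_cst.
  by rewrite binomial_expect_id IH -[in RHS]natr1; ring.
by move=> j; rewrite -natr1; ring.
Qed.

Lemma binomial_variance q m :
  binomial_expect q m (fun j => (j%:R - m%:R * q) ^+ 2) = m%:R * q * (1 - q).
Proof.
rewrite (@eq_binomial_expect _ _ _
  (fun j => j%:R ^+ 2 + ((- 2 * (m%:R * q)) * j%:R + (m%:R * q) ^+ 2))).
  rewrite !binomial_expectD binomial_expectZ binomial_expect_cst.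
  by rewrite binomial_expect_id binomial_expect_sqr; ring.
by move=> j; ring.
Qed.

Lemma binomial_expect_gt0 q m :
  binomial_expect q m (fun j => (0 < j)%:R) = 1 - (1 - q) ^+ m.
Proof.
elim: m => [|m IH] /=; first by rewrite expr0 subrr.
by rewrite IH binomial_expect_cst exprS; ring.
Qed.

Lemma binomial_pmfS q m j :
  binomial_pmf m.+1 q j.+1 = q * binomial_pmf m q j + (1 - q) * binomial_pmf m q j.+1.
Proof.
rewrite /binomial_pmf /unstable.onem binS mulrnDr addrC subSS -!mulrnAr mulrA -exprS.
congr (_ + _); have [jm|mj] := ltnP j m; last by rewrite bin_small// !mulr0n !mulr0.
by rewrite [RHS]mulrCA; congr (_ * _); rewrite mulrnAr -exprS subnSK.
Qed.

Lemma binomial_expect_eq q m j :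
  binomial_expect q m (fun i => (i == j)%:R) = binomial_pmf m q j.
Proof.
elim: m j => [|m IH] [|j] /=.
- by rewrite /binomial_pmf !expr0 mulr1.
- by rewrite /binomial_pmf bin0n.
- rewrite IH (@eq_binomial_expect _ _ _ (fun=> 0)) => [|i //].
  by rewrite binomial_expect_cst /binomial_pmf /unstable.onem !bin0 !subn0 exprS; ring.
by rewrite IH (@eq_binomial_expect _ _ _ (fun i => (i == j)%:R))// IH binomial_pmfS addrC.
Qed.

Section probability_parameter.
Variable q : R.
Hypothesis q01 : 0 <= q <= 1.

Lemma le_binomial_expect m g h : (forall j, g j <= h j) ->
  binomial_expect q m g <= binomial_expect q m h.
Proof.
have /andP[q0 q1] := q01; elim: m g h => [|m IH] g h gh //=.
by rewrite lerD// ler_wpM2l// ?subr_ge0 ?IH.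
Qed.

Lemma binomial_expect_ge0 m g : (forall j, 0 <= g j) -> 0 <= binomial_expect q m g.
Proof. by rewrite -[X in X <= _](binomial_expect_cst q m 0); exact: le_binomial_expect. Qed.

Lemma binomial_expect_le_cst m g c :
  (forall j, g j <= c) -> binomial_expect q m g <= c.
Proof. by rewrite -[X in _ <= X](binomial_expect_cst q m c); exact: le_binomial_expect. Qed.

Lemma normr_binomial_expect_le m g M :
  (forall j, `|g j| <= M) -> `|binomial_expect q m g| <= M.
Proof.
move=> gM; rewrite ler_norml -[X in X <= _](binomial_expect_cst q m).
rewrite le_binomial_expect ?binomial_expect_le_cst// => j;
by have := gM j; rewrite ler_norml => /andP[].
Qed.

Lemma binomial_expect_truncate m J g M :
  (forall j, (J <= j)%N -> `|g j| <= M) -> 0 <= M ->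
  `|binomial_expect q m g - \sum_(j < J) binomial_pmf m q j * g j| <= M.
Proof.
move=> gM M0; have -> : \sum_(j < J) binomial_pmf m q j * g j =
    binomial_expect q m (fun i => \sum_(j < J) g j * (i == j)%:R).
  rewrite binomial_expect_sum; apply: eq_bigr => j _.
  by rewrite binomial_expectZ binomial_expect_eq mulrC.
rewrite -mulN1r -binomial_expectZ -binomial_expectD.
apply: normr_binomial_expect_le => i; rewrite mulN1r.
have [iJ|Ji] := ltnP i J; last first.
  rewrite big1 ?subr0 ?gM// => j _.
  by rewrite gtn_eqF ?mulr0// (leq_trans _ Ji).
rewrite (bigD1 (Ordinal iJ))//= eqxx mulr1 big1 ?addr0 ?subrr ?normr0// => j.
by rewrite -val_eqE eq_sym /= => /negbTE ->; rewrite mulr0.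
Qed.

Lemma binomial_expect_lipschitz m m' g M :
  (forall j, `|g j.+1 - g j| <= M) ->
  `|binomial_expect q m g - binomial_expect q m' g| <= M * q * `|m%:R - m'%:R|.
Proof.
move=> gM; have /andP[q0 q1] := q01.
wlog m'm : m m' / (m' <= m)%N => [H|].
  case: (leqP m' m) => [|/ltnW] /H//.
  by rewrite distrC [X in _ <= _ * X]distrC.
rewrite [X in _ <= _ * X]ger0_norm ?subr_ge0 ?ler_nat// -natrB// -{1}(subnKC m'm).
elim: (m - m')%N => [|k IH]; first by rewrite addn0 subrr normr0 mulr0.
rewrite addnS /= -natr1 mulrDr mulr1.
set x := binomial_expect q (m' + k) g in IH *.
set y := binomial_expect q (m' + k) (fun j => g j.+1).
have -> : (1 - q) * x + q * y - binomial_expect q m' g =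
    (x - binomial_expect q m' g) + (y - x) * q by ring.
apply: le_trans (ler_normD _ _) _; apply: lerD => //.
rewrite normrM (ger0_norm q0) ler_wpM2r//.
have -> : y - x = binomial_expect q (m' + k) (fun j => g j.+1 - g j).
  rewrite /y /x -mulN1r -binomial_expectZ -binomial_expectD.
  by apply: eq_binomial_expect => j; rewrite mulN1r.
exact: normr_binomial_expect_le.
Qed.

(* Chebyshev's inequality. *)
Lemma binomial_lower_tail m : 0 < m%:R * q ->
  binomial_expect q m (fun j => (j%:R < m%:R * q / 2)%R%:R) <= 4 / (m%:R * q).
Proof.
move=> mq0; have /andP[q0 q1] := q01.
apply: (@le_trans _ _ (binomial_expect q m
    (fun j => 4 / (m%:R * q) ^+ 2 * (j%:R - m%:R * q) ^+ 2))).
  apply: le_binomial_expect => j; set y := m%:R * q in mq0 *.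
  rewrite [leRHS]mulrAC; case: ltP => [jy|_]; last first.
    by rewrite divr_ge0 ?sqr_ge0// mulr_ge0 ?sqr_ge0.
  rewrite ler_pdivlMr ?exprn_gt0// mul1r.
  have : 0 <= y / 2 - j%:R by rewrite subr_ge0 ltW.
  have : 0 <= j%:R :> R by [].
  nra.
rewrite binomial_expectZ binomial_variance; set y := m%:R * q in mq0 *.
have -> : 4 / y ^+ 2 * (y * (1 - q)) = 4 / y * (1 - q) by field; exact: lt0r_neq0.
by rewrite ler_piMr ?divr_ge0 ?(ltW mq0)// gerBl.
Qed.

Lemma binomial_expect_inv_le m : 0 < m%:R * q ->
  binomial_expect q m (fun j => (maxn 1 j)%:R^-1) <= 6 / (m%:R * q).
Proof.
move=> mq0; apply: (@le_trans _ _ (binomial_expect q m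
    (fun j => (j%:R < m%:R * q / 2)%R%:R + 2 / (m%:R * q)))); last first.
  rewrite binomial_expectD binomial_expect_cst.
  rewrite (_ : 6 / (m%:R * q) = 4 / (m%:R * q) + 2 / (m%:R * q)); last by rewrite -mulrDl -natrD.
  by rewrite lerD2r binomial_lower_tail.
apply: le_binomial_expect => j.
have max1 : 1 <= (maxn 1 j)%:R :> R by rewrite ler1n leq_maxl.
have max0 : 0 < (maxn 1 j)%:R :> R by exact: lt_le_trans max1.
case: ltP => [_|mj].
  by apply: ler_wpDr; rewrite ?divr_ge0 ?(ltW mq0)// invf_le1.
rewrite add0r -[leRHS]invf_div lef_pV2 ?posrE ?divr_gt0//.
by apply: le_trans mj _; rewrite ler_nat leq_maxr.
Qed.

End probability_parameter.
End binomial_expectation.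

Section bernoulli_counts.
Variables (R : realType) (T : finType) (p : T -> R).
Implicit Types (G F : {set T}) (e : T).

Lemma expect_mem e : expect p (fun G => (e \in G)%:R) = p e.
Proof.
pose p_in e' := p e'; pose p_out e' := if e' == e then 0 else 1 - p e'.
transitivity (\sum_(G : {set T}) \prod_e' (if e' \in G then p_in e' else p_out e')).
  apply: eq_bigr => G _; rewrite /bernoulli_weight; have [eG|eG] := boolP (e \in G).
    rewrite mulr1; apply: eq_bigr => e' _; case: ifPn => // e'G.
    by rewrite /p_out; case: eqP e'G => // ->; rewrite eG.
  by rewrite mulr0 [RHS](bigD1 e)//= /p_out (negbTE eG) eqxx mul0r.
rewrite -bigA_distr (bigD1 e)//= /p_out eqxx addr0 big1 ?mulr1// => e' /negbTE ->.
by rewrite addrC subrK.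
Qed.

Lemma expect_card_setI q F (g : nat -> R) : {in F, forall e, p e = q} ->
  expect p (fun G => g #|G :&: F|) = binomial_expect q #|F| g.
Proof.
elim: {F}#|F| {-2}F (erefl #|F|) g => [|m IH] F Fm g pF.
  rewrite (eq_expect _ (g := fun=> g 0%N)); first by rewrite expect_cst Fm.
  by move=> G; rewrite (cards0_eq Fm) setI0 cards0.
have /set0Pn[e eF] : F != set0 by rewrite -card_gt0 Fm.
have F'm : #|F :\ e| = m by have := cardsD1 e F; rewrite eF Fm add1n => -[].
have pF' : {in F :\ e, forall e', p e' = q} by move=> e' /setD1P[_ /pF].
have dep_mem (f : bool -> R) : depends_on [set e] (fun G => f (e \in G)).
  by move=> G G' /setP/(_ e); rewrite !inE eqxx !andbT => ->.
have dep_rest h : depends_on (~: [set e]) (fun G => h #|G :&: (F :\ e)| : R).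
  by move=> G G' GG'; congr (h #|pred_of_set _|); rewrite setDE ![_ :&: (F :&: _)]setICA GG'.
rewrite (eq_expect _ (g := fun G => (1 - (e \in G)%:R) * g #|G :&: (F :\ e)| +
   (e \in G)%:R * g #|G :&: (F :\ e)|.+1)); last first.
  move=> G; rewrite (cardsD1 e (G :&: F)) inE eF andbT -setIDA.
  by case: (e \in G); rewrite /= ?subrr ?subr0 ?mul0r ?mul1r ?add0r ?addr0 ?add0n.
rewrite expectD (expect_indep _ (dep_mem (fun b => 1 - b%:R)) (dep_rest g)).
rewrite (expect_indep _ (dep_mem (fun b => b%:R)) (dep_rest (fun j => g j.+1))).
rewrite expectB expect_cst expect_mem pF// Fm /=.
by rewrite (IH _ F'm g pF') (IH _ F'm (fun j => g j.+1) pF') F'm.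
Qed.

End bernoulli_counts.

(** * Exploration of an Erdos-Renyi graph *)

Section neighbourhoods.
Variable V : finType.
Implicit Types (G : {set {set V}}) (A : {set V}) (u v w : V).

Definition neighbors_in G A v : {set V} := [set u in A | adj G u v].

Definition degree_in G A v : nat := #|neighbors_in G A v|.

Definition degree G v : nat := degree_in G [set: V] v.

Definition star A v : {set {set V}} := [set [set u; v] | u in A].

Lemma set2_injl v u u' : [set u; v] = [set u'; v] -> u = u'.
Proof.
move=> /setP uu'; have := uu' u; have := uu' u'.
rewrite !inE !eqxx /= => /orP[/eqP ->//|/eqP u'v].
by rewrite u'v orbb => /esym/eqP ->.
Qed.

Lemma degree_in_star G A v : degree_in G A v = #|G :&: star A v|.
Proof.
rewrite /degree_in -(card_imset _ (@set2_injl v)); congr #|pred_of_set _|.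
apply/setP => e; rewrite !inE; apply/imsetP/andP.
  move=> [u]; rewrite inE => /andP[uA uG ->]; split => //.
  by apply/imsetP; exists u.
by move=> [eG /imsetP[u uA eu]]; exists u; rewrite // inE uA /adj -eu.
Qed.

Lemma card_star A v : #|star A v| = #|A|.
Proof. by rewrite card_imset//; exact: set2_injl. Qed.

Lemma star_edges A v : v \notin A -> star A v \subset all_edges V.
Proof.
move=> vA; apply/subsetP => e /imsetP[u uA ->].
have uv : u != v by apply: contraNneq vA => <-.
by rewrite inE cards2 uv.
Qed.

Lemma star_disjoint A v w : v \notin A -> v != w -> star A w \subset ~: star A v.
Proof.
move=> vA vw; apply/subsetP => e /imsetP[u uA ->]; rewrite inE.
apply/negP => /imsetP[u' u'A /setP/(_ v)]; rewrite !inE eqxx orbT.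
by rewrite (negbTE vw) orbF => /eqP vu; rewrite vu uA in vA.
Qed.

Lemma degree_in_star_depends_on A v : depends_on (star A v) (fun G => degree_in G A v).
Proof. by move=> G G' GG'; rewrite !degree_in_star GG'. Qed.

Lemma degree_in_gt0P G A v :
  reflect (exists2 u, u \in A & adj G u v) (0 < degree_in G A v)%N.
Proof.
apply: (iffP card_gt0P) => [[u]|[u uA uv]].
  by rewrite inE => /andP[uA uv]; exists u.
by exists u; rewrite inE uA.
Qed.

Lemma degree_in_le G A v : (degree_in G A v <= degree G v)%N.
Proof. by apply/subset_leq_card/subsetP => u; rewrite !inE => /andP[]. Qed.

End neighbourhoods.

Section breadth_first_search.
Variable V : finType.
Implicit Types (r v : V) (G : {set {set V}}) (A B L : {set V}).

Definition next_layer G B L : {set V} := [set v in ~: B | (0 < degree_in G L v)%N].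

Fixpoint bfs r G k : {set V} * {set V} :=
  if k is k'.+1 then
    let: (B, L) := bfs r G k' in let L' := next_layer G B L in (B :|: L', L')
  else ([set r], [set r]).

Definition bfs_ball r G k := (bfs r G k).1.
Definition bfs_layer r G k := (bfs r G k).2.

Lemma bfs_layerS r G k :
  bfs_layer r G k.+1 = next_layer G (bfs_ball r G k) (bfs_layer r G k).
Proof. by rewrite /bfs_layer /bfs_ball /=; case: bfs. Qed.

Lemma bfs_ballS r G k : bfs_ball r G k.+1 = bfs_ball r G k :|: bfs_layer r G k.+1.
Proof. by rewrite bfs_layerS /bfs_layer /bfs_ball /=; case: bfs. Qed.

Lemma bfs_layer_sub r G k : bfs_layer r G k \subset bfs_ball r G k.
Proof. by case: k => [//|k]; rewrite bfs_ballS subsetUr. Qed.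

Lemma bfs_layer_disjoint r G k : [disjoint ~: bfs_ball r G k & bfs_layer r G k].
Proof. by rewrite disjoint_sym disjoints_subset setCK bfs_layer_sub. Qed.

Lemma next_layer_disjoint G B L : [disjoint B & next_layer G B L].
Proof.
by rewrite -setI_eq0; apply/eqP/setP => v; rewrite !inE; case: (v \in B).
Qed.

Lemma bfs_ballD_layer r G k :
  bfs_ball r G k.+1 :\: bfs_layer r G k.+1 = bfs_ball r G k.
Proof.
rewrite bfs_ballS setDUl setDv setU0; apply/setDidPl.
by rewrite bfs_layerS next_layer_disjoint.
Qed.

Lemma card_bfs_ball_le r G k :
  (#|bfs_ball r G k.+1| <= #|bfs_ball r G k| + #|bfs_layer r G k.+1|)%N.
Proof. by rewrite bfs_ballS cardsU leq_subr. Qed.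

(* When the search has reached the ball B with last layer L, the edges that
   avoid B :\: L have not been examined. *)
Definition unexplored_edges B L : {set {set V}} :=
  [set e : {set V} | [disjoint e & B :\: L]].

Lemma degree_in_unexplored B L A v : A \subset L -> v \notin B :\: L ->
  depends_on (unexplored_edges B L) (fun G => degree_in G A v).
Proof.
move=> AL vBL; apply: depends_onS (@degree_in_star_depends_on V A v).
apply/subsetP => e /imsetP[u uA ->].
rewrite inE disjoints_subset subUset !sub1set !inE.
by rewrite (subsetP AL u uA) /=; move: vBL; rewrite !inE => ->.
Qed.

Lemma next_layer_unexplored B L :
  depends_on (unexplored_edges B L) (fun G => next_layer G B L).
Proof.
move=> G G' GG'; apply/setP => v; rewrite !inE.
have [vB|vB] //= := boolP (v \in B); congr (0 < _)%N.
by apply: degree_in_unexplored GG' => //; rewrite inE (negbTE vB) andbF.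
Qed.

Lemma sum_degree_in_unexplored (R : realType) B L (f : nat -> R) :
  depends_on (unexplored_edges B L) (fun G => \sum_(v in ~: B) f (degree_in G L v)).
Proof.
move=> G G' GG'; apply: eq_bigr => v; rewrite inE => vB; congr f.
by apply: degree_in_unexplored GG' => //; rewrite inE (negbTE vB) andbF.
Qed.

Lemma eq_bfs r G G' k :
  (forall e : {set V}, ~~ [disjoint e & bfs_ball r G k :\: bfs_layer r G k] ->
     (e \in G) = (e \in G')) ->
  bfs r G' k = bfs r G k.
Proof.
elim: k => [//|k IH]; rewrite bfs_ballD_layer => agree.
have /= -> : bfs r G' k = bfs r G k.
  apply: IH => e eB; apply: agree; apply: contra eB.
  by apply: disjointWr; exact: subsetDl.
suff nextE : next_layer G' (bfs_ball r G k) (bfs_layer r G k) =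
    next_layer G (bfs_ball r G k) (bfs_layer r G k).
  by move: nextE; rewrite /bfs_ball /bfs_layer; case: bfs => B L /= ->.
apply/setP => v; rewrite !inE; congr (_ && (0 < _)%N).
apply: eq_card => u; rewrite !inE /adj.
have [uL|//] /= := boolP (u \in bfs_layer r G k); rewrite agree//.
rewrite disjoints_subset subUset !sub1set !inE negb_and negbK.
by rewrite (subsetP (bfs_layer_sub r G k)).
Qed.

End breadth_first_search.

Definition hit_prob (R : realType) (q : R) (s : nat) : R := 1 - (1 - q) ^+ s.

Section hit_probability.
Variables (R : realType) (q : R).
Hypothesis q01 : 0 <= q <= 1.
Local Notation hit := (hit_prob q).

Let q0 : 0 <= q. Proof. by case/andP: q01. Qed.
Let q1 : 0 <= 1 - q. Proof. by rewrite subr_ge0; case/andP: q01. Qed.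

Lemma hit_prob01 s : 0 <= hit s <= 1.
Proof. by rewrite /hit_prob subr_ge0 exprn_ile1 ?gerBl// exprn_ge0. Qed.

Lemma hit_prob_le s : hit s <= s%:R * q.
Proof.
rewrite /hit_prob; elim: s => [|s IH]; first by rewrite expr0 subrr mul0r.
have := hit_prob01 s; rewrite /hit_prob exprS -natr1.
by move: ((1 - q) ^+ s) IH (q0) => y IH q_ge0 /andP[]; nra.
Qed.

Lemma hit_prob_ge s : s%:R * q - (s%:R * q) ^+ 2 <= hit s.
Proof.
have -> : hit s = \sum_(i < s) (1 - hit i) * q.
  rewrite /hit_prob; elim: s => [|s IH]; first by rewrite big_ord0 expr0 subrr.
  by rewrite big_ord_recr -IH /= exprS; ring.
apply: (@le_trans _ _ (\sum_(i < s) (1 - s%:R * q) * q)).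
  by rewrite sumr_const card_ord -mulr_natl; lra.
apply: ler_sum => i _; rewrite ler_wpM2r// lerD2l lerN2.
by apply: le_trans (hit_prob_le i) _; rewrite ler_wpM2r// ler_nat ltnW.
Qed.

Lemma hit_prob_ge_frac s u : 0 <= u <= s%:R * q -> u / (1 + u) <= hit s.
Proof.
move=> /andP[u0 us]; rewrite /hit_prob.
have -> : u / (1 + u) = 1 - (1 + u)^-1 by field; rewrite gt_eqF// ltr_pwDl.
rewrite lerD2l lerN2; apply: (@le_trans _ _ (expR (- q) ^+ s)).
  by rewrite lerXn2r ?nnegrE ?expR_ge0// expR_ge1Dx.
rewrite -expRM_natl mulrN expRN lef_pV2 ?posrE ?expR_gt0 ?ltr_pwDl//.
by apply: le_trans (expR_ge1Dx _); rewrite lerD2l.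
Qed.

End hit_probability.

Section erdos_renyi_law.
Variables (R : realType) (V : finType) (q : R).
Hypothesis q01 : 0 <= q <= 1.
Implicit Types (G : {set {set V}}) (A B L W : {set V}) (f : nat -> R).

Definition edge_prob (e : {set V}) : R := if e \in all_edges V then q else 0.

Local Notation EG := (expect edge_prob).

Lemma edge_prob01 e : 0 <= edge_prob e <= 1.
Proof. by rewrite /edge_prob; case: ifP; rewrite ?lexx ?ler01. Qed.

Lemma erdos_renyiE G : erdos_renyi q G = bernoulli_weight edge_prob G.
Proof.
rewrite /erdos_renyi /bernoulli_weight; case: ifPn => [GE|/subsetPn[e eG eE]].
  rewrite big_mkcond /=; apply: eq_bigr => e _; rewrite /edge_prob.
  case: ifPn => // eE; case: ifPn => [/(subsetP GE)|]; rewrite ?subr0//.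
  by rewrite (negbTE eE).
by rewrite (bigD1 e)//= eG /edge_prob (negbTE eE) mul0r.
Qed.

Lemma expect_degree_in A v f : v \notin A ->
  EG (fun G => f (degree_in G A v)) = binomial_expect q #|A| f.
Proof.
move=> vA; rewrite -(card_star A v) -(@expect_card_setI _ _ edge_prob).
  by apply: eq_expect => G; rewrite degree_in_star.
by move=> e /(subsetP (star_edges vA)) eE; rewrite /edge_prob eE.
Qed.

Lemma expect_sum_degree_in A W f : [disjoint W & A] ->
  EG (fun G => \sum_(v in W) f (degree_in G A v)) =
  #|W|%:R * binomial_expect q #|A| f.
Proof.
move=> WA; rewrite expect_sum -sum1_card natr_sum mulr_suml.
by apply: eq_bigr => v vW; rewrite mul1r expect_degree_in// (disjointFr WA vW).
Qed.

Lemma variance_sum_degree_in A W f : [disjoint W & A] ->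
  EG (fun G => (\sum_(v in W) f (degree_in G A v)
                - #|W|%:R * binomial_expect q #|A| f) ^+ 2) <=
  #|W|%:R * binomial_expect q #|A| (fun j => f j ^+ 2).
Proof.
move=> WA; set m := binomial_expect q #|A| f; pose h j := f j - m.
have h0 : binomial_expect q #|A| h = 0.
  by rewrite /h binomial_expectD binomial_expect_cst -/m subrr.
rewrite (eq_expect _ (g := fun G => \sum_(v in W) \sum_(w in W)
    h (degree_in G A v) * h (degree_in G A w))); last first.
  move=> G; have -> : \sum_(v in W) f (degree_in G A v) - #|W|%:R * m =
      \sum_(v in W) h (degree_in G A v) by rewrite sumrB sumr_const mulr_natl.
  by rewrite expr2 mulr_suml; apply: eq_bigr => v _; rewrite mulr_sumr.
rewrite expect_sum -sum1_card natr_sum mulr_suml; apply: ler_sum => v vW.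
have vA : v \notin A by rewrite (disjointFr WA vW).
rewrite mul1r expect_sum (bigD1 v)//= big1 ?addr0; last first.
  move=> w /andP[wW wv]; rewrite (@expect_indep _ _ _ (star A v)).
  - by rewrite (expect_degree_in h vA) h0 mul0r.
  - by move=> G G' /degree_in_star_depends_on ->.
  - apply: (depends_onS (@star_disjoint V A v w vA _)); first by rewrite eq_sym.
    by move=> G G' /degree_in_star_depends_on ->.
rewrite (expect_degree_in (fun j => h j * h j) vA).
rewrite (@eq_binomial_expect _ _ _ _ (fun j => f j ^+ 2 + ((- 2 * m) * f j + m ^+ 2))).
  rewrite !binomial_expectD binomial_expectZ binomial_expect_cst -/m gerDl.
  by have := sqr_ge0 m; rewrite expr2 -mulrA; lra.
by move=> j; rewrite /h; ring.
Qed.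

Lemma expect_dev_sum_degree_in A W f : [disjoint W & A] ->
  (forall j, f j ^+ 2 <= 1) ->
  EG (fun G => `|\sum_(v in W) f (degree_in G A v)
                 - #|W|%:R * binomial_expect q #|A| f|) <= Num.sqrt #|V|%:R.
Proof.
move=> WA f1; apply: le_trans (expect_normr_le_sqrt edge_prob01 _) _.
apply: ler_wsqrtr; apply: le_trans (variance_sum_degree_in f WA) _.
rewrite -[leRHS]mulr1; apply: ler_pM; rewrite ?ler_nat ?max_card//.
  by apply: (binomial_expect_ge0 q01) => j; exact: sqr_ge0.
exact: binomial_expect_le_cst.
Qed.

Lemma expect_sum_degree : EG (fun G => \sum_v (degree G v)%:R) <= #|V|%:R * (#|V|%:R * q).
Proof.
have /andP[q0 _] := q01.
rewrite expect_sum; apply: (@le_trans _ _ (\sum_(v : V) #|V|%:R * q)); last first.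
  by rewrite sumr_const -[leLHS]mulr_natl.
apply: ler_sum => v _.
rewrite (eq_expect _ (g := fun G => \sum_(u : V) ([set u; v] \in G)%:R)); last first.
  move=> G; rewrite /degree /degree_in -sum1_card natr_sum big_mkcond /=.
  by apply: eq_bigr => u _; rewrite !inE /adj; case: (_ \in G).
rewrite expect_sum (_ : _ * q = \sum_(u : V) q); last first.
  by rewrite sumr_const -[RHS]mulr_natl.
by apply: ler_sum => u _; rewrite expect_mem /edge_prob; case: ifP.
Qed.

Lemma bfs_exposure r k (Psi : {set V} -> {set V} -> {set {set V}} -> R) :
  (forall B L, depends_on (unexplored_edges B L) (Psi B L)) ->
  EG (fun G => Psi (bfs_ball r G k) (bfs_layer r G k) G) =
  EG (fun G => EG (fun G' => Psi (bfs_ball r G k) (bfs_layer r G k) G')).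
Proof.
move=> dep.
pose explored (BL : {set V} * {set V}) G : R := (bfs r G k == BL)%:R.
have total_expect (F : {set V} * {set V} -> {set {set V}} -> R) :
    EG (fun G => F (bfs r G k) G) = \sum_BL EG (fun G => explored BL G * F BL G).
  rewrite -expect_sum; apply: eq_expect => G.
  rewrite (bigD1 (bfs r G k))//= /explored eqxx mul1r big1 ?addr0// => BL.
  by rewrite eq_sym => /negbTE ->; rewrite mul0r.
rewrite (total_expect (fun BL => Psi BL.1 BL.2)).
rewrite (total_expect (fun BL _ => EG (Psi BL.1 BL.2))).
apply: eq_bigr => BL _; rewrite expectZr.
apply: (@expect_indep _ _ _ (~: unexplored_edges BL.1 BL.2)); last by rewrite setCK.
have exploredW G G' :
    G :&: ~: unexplored_edges BL.1 BL.2 = G' :&: ~: unexplored_edges BL.1 BL.2 ->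
    bfs r G k == BL -> bfs r G' k == BL.
  move=> GG' /eqP GBL; rewrite (@eq_bfs V r G G' k) ?GBL// => e eB.
  have /setP/(_ e) := GG'; rewrite !inE.
  by move: eB; rewrite /bfs_ball /bfs_layer GBL => ->; rewrite !andbT.
move=> G G' GG'; rewrite /explored; congr (_%:R : R); congr nat_of_bool.
by apply/idP/idP; exact: exploredW.
Qed.

Local Notation n := (#|V|%:R : R).
Local Notation a := (n * q).

Lemma card_next_layer G B L :
  #|next_layer G B L|%:R = \sum_(v in ~: B) (0 < degree_in G L v)%:R :> R.
Proof.
rewrite -sum1_card natr_sum big_mkcond [RHS]big_mkcond /=.
by apply: eq_bigr => v _; rewrite !inE; case: (v \in B) => //=; case: (0 < _)%N.
Qed.

Section fixed_layer.
Variables B L : {set V}.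
Hypothesis LB : L \subset B.
Local Notation mean_next := (#|~: B|%:R * hit_prob q #|L| : R).

Let outside_disjoint : [disjoint ~: B & L].
Proof. by rewrite disjoint_sym disjoints_subset setCK. Qed.

Let mean_next_ge0 : 0 <= mean_next.
Proof. by rewrite mulr_ge0//; have /andP[] := hit_prob01 q01 #|L|. Qed.

Lemma expect_card_next_layer : EG (fun G => #|next_layer G B L|%:R) = mean_next.
Proof.
rewrite (eq_expect _ (fun G => card_next_layer G B L)).
by rewrite (expect_sum_degree_in (fun j => (0 < j)%:R))// binomial_expect_gt0.
Qed.

Lemma variance_card_next_layer :
  EG (fun G => (#|next_layer G B L|%:R - mean_next) ^+ 2) <= mean_next.
Proof.
have := variance_sum_degree_in (fun j => (0 < j)%:R) outside_disjoint.
rewrite (@eq_binomial_expect _ _ _ (fun j => (0 < j)%:R ^+ 2) (fun j => (0 < j)%:R)).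
  by rewrite binomial_expect_gt0; under eq_expect do rewrite -card_next_layer.
by move=> j; case: (0 < j)%N; rewrite ?expr1n// expr0n.
Qed.

Lemma mean_next_layer_le : mean_next <= a * #|L|%:R.
Proof.
rewrite -mulrA (mulrC q); apply: ler_pM => //.
- by have /andP[] := hit_prob01 q01 #|L|.
- by rewrite ler_nat max_card.
- exact: hit_prob_le.
Qed.

Lemma mean_next_layer_ge :
  a * #|L|%:R - (q * (#|B|%:R * #|L|%:R) + n * (q * #|L|%:R) ^+ 2) <= mean_next.
Proof.
have nE : n = #|B|%:R + #|~: B|%:R by rewrite -natrD cardsC.
rewrite nE; have := hit_prob_ge q01 #|L|.
have B0 : 0 <= #|B|%:R :> R by [].
have C0 : 0 <= #|~: B|%:R :> R by [].
move: (#|B|%:R : R) (#|~: B|%:R : R) (hit_prob _ _) (#|L|%:R : R) B0 C0.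
move=> x y z l x0 y0 lz.
have : y * (l * q - (l * q) ^+ 2) <= y * z by rewrite ler_wpM2l.
have : 0 <= x * (q * l) ^+ 2 by rewrite mulr_ge0 ?sqr_ge0.
rewrite !expr2; nra.
Qed.

Lemma expect_card_next_layer_le : EG (fun G => #|next_layer G B L|%:R) <= a * #|L|%:R.
Proof. by rewrite expect_card_next_layer mean_next_layer_le. Qed.

Lemma expect_card_next_layer_sqr_le :
  EG (fun G => #|next_layer G B L|%:R ^+ 2) <= a * #|L|%:R + (a * #|L|%:R) ^+ 2.
Proof.
set m := mean_next; have m0 : 0 <= m by exact: mean_next_ge0.
have ma := mean_next_layer_le; rewrite -/m in ma.
rewrite (eq_expect _ (g := fun G => (#|next_layer G B L|%:R - m) ^+ 2 +
   (2 * m * #|next_layer G B L|%:R - m ^+ 2))); last by move=> G; ring.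
rewrite expectD expectB expectZ expect_cst expect_card_next_layer -/m.
have := variance_card_next_layer; rewrite -/m; nra.
Qed.

Lemma expect_card_next_layer_dev :
  EG (fun G => `|#|next_layer G B L|%:R - a * #|L|%:R|) <=
  Num.sqrt (a * #|L|%:R) + (q * (#|B|%:R * #|L|%:R) + n * (q * #|L|%:R) ^+ 2).
Proof.
apply: (@le_trans _ _ (EG (fun G => `|#|next_layer G B L|%:R - mean_next| +
    (q * (#|B|%:R * #|L|%:R) + n * (q * #|L|%:R) ^+ 2)))).
  apply: (le_expect edge_prob01) => G.
  rewrite -[X in `|X|](subrKA mean_next); apply: le_trans (ler_normD _ _) _.
  rewrite lerD2l distrC ger0_norm ?subr_ge0 ?mean_next_layer_le//.
  by have := mean_next_layer_ge; lra.
rewrite expectD expect_cst lerD2r.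
apply: le_trans (expect_normr_le_sqrt edge_prob01 _) _; apply: ler_wsqrtr.
exact: le_trans variance_card_next_layer mean_next_layer_le.
Qed.

End fixed_layer.

Section layer_moments.
Variable r : V.
Hypothesis a4 : 4 <= a.
Local Notation S k G := (#|bfs_layer r G k|%:R : R).
Local Notation B k G := (#|bfs_ball r G k|%:R : R).

Let n0 : 0 < n. Proof. by rewrite ltr0n; apply/card_gt0P; exists r. Qed.
Let a0 : 0 < a. Proof. by apply: lt_le_trans a4; rewrite ltr0n. Qed.
Let q0 : 0 < q. Proof. by rewrite -(pmulr_rgt0 _ n0). Qed.
Let aX0 k : 0 < a ^+ k. Proof. by rewrite exprn_gt0. Qed.

Let card_layer0 G : S 0 G = 1. Proof. by rewrite cards1. Qed.
Let card_ball0 G : B 0 G = 1. Proof. by rewrite cards1. Qed.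

(* One step of the exploration, with the explored ball and its last layer
   frozen. *)
Lemma expect_layer_step k (Psi : {set V} -> {set V} -> nat -> R) :
  EG (fun G => Psi (bfs_ball r G k) (bfs_layer r G k) #|bfs_layer r G k.+1|) =
  EG (fun G => EG (fun G' => Psi (bfs_ball r G k) (bfs_layer r G k)
    #|next_layer G' (bfs_ball r G k) (bfs_layer r G k)|)).
Proof.
rewrite -(bfs_exposure r k (Psi := fun B L G => Psi B L #|next_layer G B L|)).
  by apply: eq_expect => G; rewrite bfs_layerS.
by move=> C L G G' /next_layer_unexplored ->.
Qed.

Lemma expect_layer_le k : EG (fun G => S k G) <= a ^+ k.
Proof.
elim: k => [|k IH]; first by rewrite (eq_expect _ card_layer0) expect_cst.
rewrite (expect_layer_step k (fun _ _ j => j%:R)).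
apply: (@le_trans _ _ (EG (fun G => a * S k G))).
  apply: (le_expect edge_prob01) => G.
  exact/expect_card_next_layer_le/bfs_layer_sub.
by rewrite expectZ exprS ler_pM2l.
Qed.

Lemma expect_ball_le k : EG (fun G => B k G) <= 2 * a ^+ k.
Proof.
elim: k => [|k IH].
  by rewrite (eq_expect _ card_ball0) expect_cst expr0 mulr1 ler1n.
apply: (@le_trans _ _ (EG (fun G => B k G + S k.+1 G))).
  by apply: (le_expect edge_prob01) => G; rewrite -natrD ler_nat card_bfs_ball_le.
rewrite expectD; apply: le_trans (lerD IH (expect_layer_le k.+1)) _.
rewrite exprS; move: (a ^+ k) (aX0 k) (a4); move: a => b y y0 b4; nra.
Qed.

Lemma expect_layer_sqr_le k : EG (fun G => S k G ^+ 2) <= 2 * (a ^+ k) ^+ 2 - a ^+ k.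
Proof.
elim: k => [|k IH].
  under eq_expect do rewrite card_layer0 expr1n.
  by rewrite expect_cst expr0 expr1n; lra.
rewrite (expect_layer_step k (fun _ _ j => j%:R ^+ 2)).
apply: (@le_trans _ _ (EG (fun G => a * S k G + a ^+ 2 * S k G ^+ 2))).
  apply: (le_expect edge_prob01) => G; rewrite -exprMn.
  exact/expect_card_next_layer_sqr_le/bfs_layer_sub.
rewrite expectD !expectZ (exprS _ k); have := expect_layer_le k; move: IH.
move: (EG _) (EG _) (a ^+ k) (aX0 k) (a4) (a0).
move: a => b y x z z0 b4 b0 xk yk.
have : b * y <= b * z by rewrite ler_pM2l.
have : b ^+ 2 * x <= b ^+ 2 * (2 * z ^+ 2 - z) by rewrite ler_pM2l ?exprn_gt0.
have : 0 <= (b - 4) * (b * z) by rewrite mulr_ge0 ?subr_ge0// mulr_ge0 ?ltW.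
have : 0 <= b * z by rewrite mulr_ge0 ?ltW.
nra.
Qed.

Lemma expect_ball_layer_le k : EG (fun G => B k G * S k G) <= 4 * (a ^+ k) ^+ 2.
Proof.
elim: k => [|k IH].
  under eq_expect do rewrite !(card_ball0, card_layer0) mulr1.
  by rewrite expect_cst expr0 expr1n; lra.
apply: (@le_trans _ _ (EG (fun G => B k G * S k.+1 G + S k.+1 G ^+ 2))).
  apply: (le_expect edge_prob01) => G.
  by rewrite expr2 -mulrDl ler_wpM2r// -natrD ler_nat card_bfs_ball_le.
have cross : EG (fun G => B k G * S k.+1 G) <= a * (4 * (a ^+ k) ^+ 2).
  rewrite (expect_layer_step k (fun C _ j => #|C|%:R * j%:R)).
  apply: (@le_trans _ _ (EG (fun G => a * (B k G * S k G)))).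
    apply: (le_expect edge_prob01) => G; rewrite expectZ mulrCA ler_wpM2l//.
    exact/expect_card_next_layer_le/bfs_layer_sub.
  by rewrite expectZ ler_pM2l.
rewrite expectD; move: (expect_layer_sqr_le k.+1) cross; rewrite (exprS _ k).
move: (EG _) (EG _) (a ^+ k) (aX0 k) (a4) (a0).
move: a => b x y z z0 b4 b0 yz xz.
have : 0 <= (b - 4) * (b * z ^+ 2).
  by rewrite mulr_ge0 ?subr_ge0// mulr_ge0 ?sqr_ge0 ?ltW.
have : 0 <= b * z by rewrite mulr_ge0 ?ltW.
nra.
Qed.

Lemma expect_layer_step_dev k :
  EG (fun G => `|S k.+1 G - a * S k G|) <=
  Num.sqrt (a ^+ k.+1) + (4 * q + 2 * n * q ^+ 2) * (a ^+ k) ^+ 2.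
Proof.
rewrite (expect_layer_step k (fun _ L j => `|j%:R - a * #|L|%:R|)).
apply: (@le_trans _ _ (EG (fun G => Num.sqrt (a * S k G) +
    (q * (B k G * S k G) + n * (q ^+ 2 * S k G ^+ 2))))).
  apply: (le_expect edge_prob01) => G; rewrite -exprMn.
  exact/expect_card_next_layer_dev/bfs_layer_sub.
rewrite !expectD !expectZ; apply: lerD.
  apply: le_trans (expect_sqrt_le edge_prob01 _) _.
    by move=> G; rewrite mulr_ge0// ltW.
  by apply: ler_wsqrtr; rewrite expectZ exprS ler_pM2l// expect_layer_le.
rewrite mulrDl; apply: lerD.
  by rewrite -[leRHS]mulrA [leRHS]mulrCA ler_pM2l// expect_ball_layer_le.
have -> : 2 * n * q ^+ 2 * (a ^+ k) ^+ 2 = n * (q ^+ 2 * (2 * (a ^+ k) ^+ 2)) by ring.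
rewrite ler_pM2l// ler_pM2l ?exprn_gt0//.
by apply: le_trans (expect_layer_sqr_le k) _; rewrite gerBl ltW.
Qed.

End layer_moments.
End erdos_renyi_law.

(* The relative error made when the size of the layer k is approximated by the
   k-th power of the mean degree a, on n vertices. *)
Definition layer_dev (R : realType) (n a : R) (k : nat) : R :=
  2 / Num.sqrt a + 12 * a ^+ k / n.

Section layer_concentration.
Variables (R : realType) (V : finType) (q : R) (r : V).
Hypothesis q01 : 0 <= q <= 1.
Local Notation EG := (expect (@edge_prob R V q)).
Local Notation n := (#|V|%:R : R).
Local Notation a := (n * q).
Hypothesis a4 : 4 <= a.
Local Notation S k G := (#|bfs_layer r G k|%:R : R).
Local Notation s := (Num.sqrt a).

Let n0 : 0 < n. Proof. by rewrite ltr0n; apply/card_gt0P; exists r. Qed.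
Let a0 : 0 < a. Proof. by apply: lt_le_trans a4; rewrite ltr0n. Qed.
Let q0 : 0 < q. Proof. by rewrite -(pmulr_rgt0 _ n0). Qed.
Let aX0 k : 0 < a ^+ k. Proof. by rewrite exprn_gt0. Qed.

Let s2 : 2 <= s.
Proof.
rewrite -(@ger0_norm R 2)// -sqrtr_sqr; apply: ler_wsqrtr.
by apply: le_trans a4; rewrite expr2; lra.
Qed.

Let s0 : 0 < s. Proof. by exact: lt_le_trans s2. Qed.
Let sX0 k : 0 < s ^+ k. Proof. by rewrite exprn_gt0. Qed.
Let aXE k : a ^+ k = (s ^+ k) ^+ 2. Proof. by rewrite -exprM mulnC exprM sqr_sqrtr// ltW. Qed.

Lemma expect_rel_dev_step k :
  EG (fun G => `|S k.+1 G / a ^+ k.+1 - 1|) <=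
  EG (fun G => `|S k G / a ^+ k - 1|) + s ^- k.+1 +
  (4 * a ^+ k + 2 * a ^+ k.+1) / n.
Proof.
apply: (@le_trans _ _ (EG (fun G => `|S k G / a ^+ k - 1| +
    `|S k.+1 G - a * S k G| / a ^+ k.+1))).
  apply: (le_expect (edge_prob01 q01)) => G.
  rewrite -[X in _ + _ / X]gtr0_norm// -normf_div.
  apply: le_trans (ler_normD _ _); rewrite exprS le_eqVlt; apply/orP; left.
  by apply/eqP; congr `|_|; field; rewrite !gt_eqF.
rewrite expectD expectZr -addrA lerD2l.
apply: le_trans (ler_wpM2r _ (expect_layer_step_dev q01 r a4 k)) _.
  by rewrite invr_ge0 ltW.
have -> : Num.sqrt (a ^+ k.+1) = s ^+ k.+1 by rewrite aXE sqrtr_sqr gtr0_norm.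
rewrite le_eqVlt; apply/orP; left; apply/eqP; rewrite mulrDl; congr (_ + _).
  by rewrite aXE; field; rewrite gt_eqF.
by rewrite (exprS _ k); move: (a ^+ k) (aX0 k) => z z0; field; rewrite !gt_eqF.
Qed.

Lemma expect_layer_rel_dev k :
  EG (fun G => `|S k G / a ^+ k - 1|) <= layer_dev n a k.
Proof.
suff : EG (fun G => `|S k G / a ^+ k - 1|) <=
    2 / s * (1 - s ^- k) + 12 * (a ^+ k - 1) / n.
  move/le_trans; apply; apply: lerD.
    by rewrite ler_piMr ?divr_ge0 ?(ltW s0)// gerBl invr_ge0 ltW.
  by rewrite ler_pM2r ?invr_gt0// ler_pM2l// gerBl.
elim: k => [|k IH].
  rewrite (eq_expect _ (g := fun=> 0)) => [|G].
    by rewrite expect_cst expr0 invr1 subrr !mulr0 mul0r addr0.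
  by rewrite cards1 divr1 subrr normr0.
apply: le_trans (expect_rel_dev_step k) _; rewrite -addrA.
have -> : 2 / s * (1 - s ^- k.+1) + 12 * (a ^+ k.+1 - 1) / n =
    (2 / s * (1 - s ^- k) + 12 * (a ^+ k - 1) / n) +
    (2 / s * (s ^- k - s ^- k.+1) + 12 * (a ^+ k.+1 - a ^+ k) / n) by ring.
apply: lerD => //; apply: lerD.
  have -> : 2 / s * (s ^- k - s ^- k.+1) = s ^- k.+1 * (2 - 2 / s).
    by rewrite exprS; field; rewrite !gt_eqF.
  rewrite ler_peMr ?invr_ge0 ?(ltW (sX0 _))//.
  by rewrite lerBrDr -lerBrDl ler_pdivrMr//; have := s2; lra.
rewrite ler_pM2r ?invr_gt0// exprS; move: (a ^+ k) (aX0 k) => z z0.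
have : 0 <= (a - 4) * z by rewrite mulr_ge0 ?subr_ge0// ltW.
by move: a => b; lra.
Qed.

Lemma expect_layer_dev k :
  EG (fun G => `|S k G - a ^+ k|) <= a ^+ k * layer_dev n a k.
Proof.
rewrite (eq_expect _ (g := fun G => a ^+ k * `|S k G / a ^+ k - 1|)) => [|G].
  by rewrite expectZ ler_pM2l// expect_layer_rel_dev.
rewrite -[X in _ = X * _]gtr0_norm// -normrM; congr `|_|.
by field; rewrite gt_eqF.
Qed.

End layer_concentration.

(** * Rooted spanning trees *)

Section graph_distance.
Variable V : finType.
Implicit Types (T : {set {set V}}) (x y u v r : V).
Local Open Scope nat_scope.

Lemma adj_sym T : symmetric (adj T).
Proof. by move=> x y; rewrite /adj setUC. Qed.

Lemma connect_adj_sym T : connect_sym (adj T).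
Proof. exact: sym_connect_sym (adj_sym T). Qed.

Lemma gdistE T x y : gdist T x y =
  \big[Order.min/#|V|]_(k < #|V| |
    [exists p : k.-tuple V, path (adj T) x p && (last x p == y)]) (k : nat).
Proof. by []. Qed.

Lemma gdist_path T x p : path (adj T) x p -> gdist T x (last x p) <= size p.
Proof.
move=> xp; rewrite gdistE; have [pV|Vp] := ltnP (size p) #|V|.
  apply: (bigmin_le_cond #|V| (fun k : 'I_#|V| => k : nat) (j := Ordinal pV)).
  by apply/existsP; exists (in_tuple p); rewrite xp eqxx.
by apply: leq_trans Vp; exact: (bigmin_le_id _ #|V|).
Qed.

Lemma gdistP T x y : connect (adj T) x y ->
  exists p, [/\ path (adj T) x p, last x p = y & size p = gdist T x y].
Proof.
move=> /connectP[p0 xp0]; case/shortenP: xp0 => p xp up _ yE.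
have pV : size p < #|V| by have /card_uniqP := up => /= <-; exact: max_card.
rewrite gdistE (@bigmin_eq_arg _ _ _ _ (Ordinal pV)) => [||k _]; last exact: ltnW.
  case: arg_minP => [|k /existsP[t /andP[xt /eqP ty]] _].
    by apply/existsP; exists (in_tuple p); rewrite xp yE eqxx.
  by exists t; split; rewrite // size_tuple.
by apply/existsP; exists (in_tuple p); rewrite xp yE eqxx.
Qed.

Lemma gdistxx T x : gdist T x x = 0.
Proof. by apply/eqP; rewrite -leqn0; exact: (@gdist_path T x [::]). Qed.

Lemma gdist_adj_le T r u v : connect (adj T) r u -> adj T u v ->
  gdist T r v <= (gdist T r u).+1.
Proof.
move=> /gdistP[p [rp <- <-]] uv.
have := @gdist_path T r (rcons p v); rewrite last_rcons size_rcons.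
by apply; rewrite rcons_path rp.
Qed.

Lemma gdist_predecessor T r v : connect (adj T) r v -> v != r ->
  exists u, [/\ connect (adj T) r u, adj T u v & gdist T r v = (gdist T r u).+1].
Proof.
move=> /gdistP[p]; case: (lastP p) => [|p' w] []; first by move=> _ <-; rewrite eqxx.
rewrite rcons_path last_rcons size_rcons => /andP[rp' uw] wv; rewrite wv in uw *.
move=> sE _; exists (last r p').
have cu : connect (adj T) r (last r p') by apply/connectP; exists p'.
split => //; apply/eqP; rewrite eqn_leq gdist_adj_le//= -sE ltnS.
exact: gdist_path.
Qed.

Lemma gdist_subset T T' r v : T \subset T' -> connect (adj T) r v ->
  gdist T' r v <= gdist T r v.
Proof.
move=> TT' /gdistP[p [rp <- <-]]; apply: gdist_path.
by apply: sub_path rp => x y; exact: (subsetP TT').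
Qed.

End graph_distance.

Lemma uniq_cycle_neighbors (T : eqType) (e : rel T) (c : seq T) (v : T) :
  symmetric e -> (2 < size c)%N -> uniq c -> cycle e c -> v \in c ->
  exists x y, [/\ x \in c, y \in c, x != y, e x v & e y v].
Proof.
move=> e_sym c2 c_uniq c_cycle vc; have [i s sE] := rot_to vc.
have : cycle e (v :: s) by rewrite -sE rot_cycle.
have : uniq (v :: s) by rewrite -sE rot_uniq.
have : (1 < size s)%N by have := size_rot i c; rewrite sE /= => sc; rewrite -ltnS sc.
have s_sub u : u \in s -> u \in c by move=> us; rewrite -(mem_rot i) sE inE us orbT.
case: s {sE} s_sub => [//|x s]; case/lastP: s => [//|s y] /= s_sub _.
rewrite rcons_path last_rcons => /and3P[_ xs _] /and3P[vx _ yv].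
exists x, y; split; rewrite 1?[e x v]e_sym//.
- by apply: s_sub; rewrite inE eqxx.
- by apply: s_sub; rewrite inE mem_rcons inE eqxx orbT.
- by apply: contraNneq xs => ->; rewrite mem_rcons inE eqxx.
Qed.

Section spanning_trees.
Variables (V : finType) (r : V) (G : {set {set V}}).
Hypothesis GE : G \subset all_edges V.
Implicit Types (T : {set {set V}}) (u v w : V) (f : {ffun V -> V}).

Local Notation C := (component G r).
Local Notation C' := (component G r :\ r).
Local Notation dG := (gdist G r).

Lemma root_component : r \in C.
Proof. by rewrite inE connect0. Qed.

Lemma component_adj u v : v \in C -> adj G u v -> u \in C.
Proof.
rewrite !inE => rv uv; apply: connect_trans rv _.
by rewrite connect1// adj_sym.
Qed.

Section parents.
Variable T : {set {set V}}.
Hypothesis sT : spanning_tree G r T.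

Lemma spanning_tree_sub : T \subset G.
Proof.
by case: sT => TC _ _; apply/subsetP => e /(subsetP TC); rewrite inE => /andP[].
Qed.

Lemma spanning_tree_connect v : v \in C -> connect (adj T) r v.
Proof. by case: sT => _ cT _ vC; apply: cT => //; exact: root_component. Qed.

Lemma spanning_tree_adj u v : adj T u v -> (u \in C) /\ (v \in C).
Proof.
case: sT => TC _ _ /(subsetP TC); rewrite inE => /andP[_].
by rewrite subUset !sub1set => /andP[].
Qed.

Definition tree_parent v : V :=
  if v \in C' then odflt v [pick u | (u, v) \in directed_edges r T] else v.

Lemma tree_parentP v : v \in C' ->
  adj T (tree_parent v) v /\ gdist T r v = (gdist T r (tree_parent v)).+1.
Proof.
move=> vC; rewrite /tree_parent vC; case: pickP => [u|no_parent] /=.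
  by rewrite inE /= => /andP[uv /eqP].
move: vC; rewrite 2!inE => /andP[vr vC].
have [u [_ uv duv]] := gdist_predecessor (spanning_tree_connect vC) vr.
by have := no_parent u; rewrite inE /= uv duv eqxx.
Qed.

Definition parent_edges : {set {set V}} := [set [set tree_parent v; v] | v in C'].

Lemma parent_edges_sub : parent_edges \subset T.
Proof. by apply/subsetP => e /imsetP[v /tree_parentP[] pv _ ->]. Qed.

Lemma parent_edges_connect v : v \in C -> connect (adj parent_edges) r v.
Proof.
elim: {v}(gdist T r v) {-2}v (erefl (gdist T r v)) => [|k IH] v vk vC;
  have [->|vr] := eqVneq v r; rewrite ?connect0//.
  have [|_] := @tree_parentP v; first by rewrite 2!inE vr.
  by rewrite vk.
have vC' : v \in C' by rewrite 2!inE vr.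
have [pv dv] := tree_parentP vC'.
have edge_v : adj parent_edges (tree_parent v) v by apply/imsetP; exists v.
apply: connect_trans (connect1 edge_v).
apply: IH; first by move: dv; rewrite vk => -[].
by have [] := spanning_tree_adj pv.
Qed.

(* An edge outside the parent edges would close a cycle. *)
Lemma spanning_treeE : T = parent_edges.
Proof.
apply/eqP; rewrite eqEsubset parent_edges_sub andbT; apply/subsetP => e eT.
have /cards2P[x [y [xy eE]]] : #|e| == 2%N.
  by have := subsetP GE e (subsetP spanning_tree_sub e eT); rewrite inE.
rewrite {}eE in eT *; apply: contraT => xy_out.
have [xC yC] := spanning_tree_adj eT.
have : connect (adj parent_edges) x y.
  apply: connect_trans (parent_edges_connect yC).
  by rewrite connect_adj_sym parent_edges_connect.
case/connectP => p0 xp0; case/shortenP: xp0 => p xp up _ yE.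
case: sT => _ _ /(_ (x :: p)); case: p xp up yE => [|z p] xp up yE.
  by rewrite yE eqxx in xy.
case: p xp up yE => [|w p] xp up yE.
  by move: xp; rewrite /= andbT /adj -[z]yE (negbTE xy_out).
move=> /(_ isT up); rewrite /= rcons_path; move: xp => /= /and3P[xz zw wp].
have sub u v : adj parent_edges u v -> adj T u v by exact: (subsetP parent_edges_sub).
rewrite (sub _ _ xz) (sub _ _ zw) (sub_path sub wp) /=.
by rewrite -[last w p]yE adj_sym /adj eT.
Qed.

Lemma parent_edge_inj v w : v \in C' -> w \in C' ->
  [set tree_parent v; v] = [set tree_parent w; w] -> v = w.
Proof.
move=> vC wC vw; apply: contraTeq isT => v_neq_w.
have : v \in [set tree_parent w; w] by rewrite -vw !inE eqxx orbT.
rewrite !inE (negbTE v_neq_w) orbF => /eqP v_parent.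
have : w \in [set tree_parent v; v] by rewrite vw !inE eqxx orbT.
rewrite !inE [w == v]eq_sym (negbTE v_neq_w) orbF => /eqP w_parent.
have [_ dv] := tree_parentP vC; have [_ dw] := tree_parentP wC.
by exfalso; move: dv dw; rewrite -v_parent -w_parent; lia.
Qed.

Lemma mem_directed_edges u v :
  ((u, v) \in directed_edges r T) = (v \in C') && (u == tree_parent v).
Proof.
apply/idP/andP => [|[vC /eqP ->]]; last first.
  by have [pv dv] := tree_parentP vC; rewrite inE /= pv dv eqxx.
rewrite inE /= => /andP[uv /eqP duv]; have [uC vC] := spanning_tree_adj uv.
have vC' : v \in C'.
  by rewrite 2!inE vC andbT; apply: contra_eqN duv => /eqP ->; rewrite gdistxx.
split => //; have : [set u; v] \in parent_edges by rewrite -spanning_treeE.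
case/imsetP => w wC' uvw; have [_ dw] := tree_parentP wC'.
have [vw|vw] := eqVneq v w; first by rewrite vw in uvw *; apply/eqP/(set2_injl uvw).
have : v \in [set tree_parent w; w] by rewrite -uvw !inE eqxx orbT.
rewrite !inE (negbTE vw) orbF => /eqP v_parent.
have : w \in [set u; v] by rewrite uvw !inE eqxx orbT.
rewrite !inE [w == v]eq_sym (negbTE vw) orbF => /eqP wu.
by exfalso; move: dw; rewrite -v_parent wu duv; lia.
Qed.

Lemma card_spanning_tree : #|T| = #|C'|.
Proof. by rewrite spanning_treeE card_in_imset//; exact: parent_edge_inj. Qed.

Lemma tree_parent_geodesic v : v \in C' -> gdist T r v = dG v ->
  adj G (tree_parent v) v /\ (dG (tree_parent v)).+1 = dG v.
Proof.
move=> vC dE; have [pv dv] := tree_parentP vC.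
have pvG : adj G (tree_parent v) v by exact: (subsetP spanning_tree_sub).
have [pC _] := spanning_tree_adj pv; split => //.
apply/eqP; rewrite eqn_leq; apply/andP; split.
  rewrite -dE dv ltnS; apply: gdist_subset spanning_tree_sub _.
  exact: spanning_tree_connect.
by apply: gdist_adj_le pvG; move: pC; rewrite inE.
Qed.

End parents.

Lemma tree_parent_inj T T' : spanning_tree G r T -> spanning_tree G r T' ->
  (forall v, tree_parent T v = tree_parent T' v) -> T = T'.
Proof.
move=> sT sT' pp; rewrite (spanning_treeE sT) (spanning_treeE sT').
by apply: eq_in_imset => v _; rewrite pp.
Qed.

Definition common_edges T T' : nat :=
  #|directed_edges r T :&: directed_edges r T'|.

Lemma common_edgesE T T' : spanning_tree G r T -> spanning_tree G r T' ->
  common_edges T T' = #|[set v in C' | tree_parent T v == tree_parent T' v]|.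
Proof.
move=> sT sT'; have edge_inj : injective (fun v => (tree_parent T v, v)).
  by move=> v w [].
rewrite -(card_imset _ edge_inj); apply: eq_card => -[u v]; rewrite inE.
rewrite !mem_directed_edges//; apply/andP/imsetP.
  by move=> [/andP[vC /eqP ->] /andP[_ pp]]; exists v; rewrite // inE vC.
by move=> [w]; rewrite inE => /andP[wC pp] [-> ->]; rewrite wC eqxx.
Qed.

Lemma overlapE (R : realType) T T' :
  spanning_tree G r T -> spanning_tree G r T' ->
  overlap R r T T' = (common_edges T T')%:R / #|C'|%:R.
Proof.
move=> sT sT'; rewrite /overlap (card_spanning_tree sT) (card_spanning_tree sT').
by rewrite -expr2 sqrtr_sqr ger0_norm.
Qed.

(* A choice of a parent in P v for every v gives a spanning tree in which h is
   the distance to the root. *)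
Definition level_structure (h : V -> nat) (P : V -> {set V}) : Prop :=
  h r = 0%N /\
  forall v u, v \in C' -> u \in P v -> adj G u v /\ (h u).+1 = h v.

Definition choice_tree f : {set {set V}} := [set [set f v; v] | v in C'].

Section choice_trees.
Variables (h : V -> nat) (P : V -> {set V}).
Hypothesis hP : level_structure h P.

Let h_root : h r = 0%N. Proof. by case: hP. Qed.

Let h_parent v u : v \in C' -> u \in P v -> adj G u v /\ (h u).+1 = h v.
Proof. by case: hP => _; exact. Qed.

Lemma choice_tree_adj f u v : adj (choice_tree f) u v ->
  (v \in C' /\ u = f v) \/ (u \in C' /\ v = f u).
Proof.
case/imsetP => w wC uvw.
have : w \in [set u; v] by rewrite uvw !inE eqxx orbT.
rewrite in_set2 => /orP[] /eqP wE; rewrite {}wE in wC uvw.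
  by right; split => //; apply: (@set2_injl _ u); rewrite setUC.
by left; split => //; exact: set2_injl uvw.
Qed.

Section one_choice.
Variable f : {ffun V -> V}.
Hypothesis fP : {in C', forall v, f v \in P v}.
Local Notation Tf := (choice_tree f).

Lemma choice_tree_level u v : adj Tf u v -> (h v <= (h u).+1)%N.
Proof.
case/choice_tree_adj => -[wC ->]; have [_ <-] := h_parent wC (fP wC) => //.
by rewrite -addn2 leq_addr.
Qed.

Lemma choice_tree_connect v : v \in C ->
  connect (adj Tf) r v /\ (gdist Tf r v <= h v)%N.
Proof.
elim: {v}(h v) {-2}v (erefl (h v)) => [|k IH] v vk vC;
  have [->|vr] := eqVneq v r; rewrite ?connect0 ?gdistxx//.
  have vC' : v \in C' by rewrite 2!inE vr.
  by have [_] := h_parent vC' (fP vC'); rewrite vk.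
have vC' : v \in C' by rewrite 2!inE vr.
have [fv hv] := h_parent vC' (fP vC').
have fk : h (f v) = k by move: hv; rewrite vk => -[].
have [cf df] := IH _ fk (component_adj vC fv).
have av : adj Tf (f v) v by apply/imsetP; exists v.
split; first exact: connect_trans cf (connect1 av).
by apply: leq_trans (gdist_adj_le cf av) _; rewrite -hv ltnS.
Qed.

Lemma choice_tree_gdist v : v \in C -> gdist Tf r v = h v.
Proof.
move=> vC; have [cv dv] := choice_tree_connect vC.
apply/eqP; rewrite eqn_leq dv /=.
have [p [rp <- <-]] := gdistP cv.
suff level_path x q : path (adj Tf) x q -> (h (last x q) <= h x + size q)%N.
  by have := level_path r p rp; rewrite h_root add0n.
elim: q x => [|y q IH] x /=; first by rewrite addn0.
move=> /andP[xy yq]; apply: leq_trans (IH _ yq) _.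
by rewrite addnS -addSn leq_add2r choice_tree_level.
Qed.

(* A vertex of maximal level on a cycle would have two parents. *)
Lemma choice_tree_acyclic : acyclic Tf.
Proof.
move=> c c2 c_uniq; apply/negP => c_cycle.
have [w wc] : exists w, w \in c.
  by case: c c2 {c_uniq c_cycle} => // w c; exists w; rewrite inE eqxx.
have [v vc v_max] : exists2 v, v \in c & forall u, u \in c -> (h u <= h v)%N.
  by have := @arg_maxnP _ w (mem c) h wc => -[v]; exists v.
have parentE u : u \in c -> adj Tf u v -> u = f v.
  move=> uc /choice_tree_adj[[]//|[uC vE]]; have [_] := h_parent uC (fP uC).
  by rewrite -vE => hu; have := v_max u uc; rewrite -hu ltnn.
have [x [y [xc yc xy xv yv]]] :=
  uniq_cycle_neighbors (adj_sym Tf) c2 c_uniq c_cycle vc.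
by move: xy; rewrite (parentE x)// (parentE y)// eqxx.
Qed.

Lemma choice_tree_spanning : spanning_tree G r Tf.
Proof.
split; last exact: choice_tree_acyclic.
- apply/subsetP => e /imsetP[v vC ->]; have [fv _] := h_parent vC (fP vC).
  move: vC; rewrite 2!inE => /andP[_ vC]; rewrite inE.
  by rewrite [_ \in G]fv subUset !sub1set vC (component_adj vC fv).
- move=> x y xC yC; apply: (@connect_trans _ _ r).
    by rewrite connect_adj_sym; have [] := choice_tree_connect xC.
  by have [] := choice_tree_connect yC.
Qed.

End one_choice.

Lemma choice_tree_inj f f' :
  {in C', forall v, f v \in P v} -> {in C', forall v, f' v \in P v} ->
  choice_tree f = choice_tree f' -> {in C', f =1 f'}.
Proof.
move=> fP f'P ff' v vC.
have : [set f v; v] \in choice_tree f by apply/imsetP; exists v.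
rewrite ff' => /choice_tree_adj[[_ ->]//|[wC vE]].
have [_] := h_parent wC (f'P _ wC); rewrite -vE.
have [_ <-] := h_parent vC (fP _ vC).
by move=> /eqP; rewrite eqn_leq ltnNge ltnW.
Qed.

End choice_trees.

Definition geo_parents v : {set V} := [set u | adj G u v & (dG u).+1 == dG v].

Definition parent_count v : nat := #|geo_parents v|.

Lemma parent_count_le_degree v : (parent_count v <= degree G v)%N.
Proof. by apply/subset_leq_card/subsetP => u; rewrite !inE => /andP[]. Qed.

Lemma parent_count_gt0 v : v \in C' -> (0 < parent_count v)%N.
Proof.
rewrite 2!inE => /andP[vr vC]; rewrite inE in vC.
have [u [_ uv du]] := gdist_predecessor vC vr.
by apply/card_gt0P; exists u; rewrite inE uv du eqxx.
Qed.

Lemma degree_gt0 v : v \in C' -> (0 < degree G v)%N.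
Proof. by move=> /parent_count_gt0/leq_trans; apply; exact: parent_count_le_degree. Qed.

Lemma level_structure_geo : level_structure dG geo_parents.
Proof. by split=> [|v u _]; rewrite ?gdistxx// inE => /andP[uv /eqP]. Qed.

End spanning_trees.

(** * Pairs of Gibbs trees *)

Lemma sum_inj_le (R : realDomainType) (I J : finType) (A : pred I) (f : I -> J)
    (F : J -> R) :
  {in A &, injective f} -> (forall j, 0 <= F j) ->
  \sum_(i in A) F (f i) <= \sum_j F j.
Proof.
move=> f_inj F0; rewrite -(big_imset (h := f) (A := A) F)//=.
by rewrite [leRHS](bigID (mem (f @: A)))/= lerDl sumr_ge0.
Qed.

Lemma sum_mem (R : pzSemiRingType) (T : finType) (A : {set T}) :
  \sum_x (x \in A)%:R = #|A|%:R :> R.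
Proof. by rewrite -natr_sum -sum1_card [in RHS]big_mkcond. Qed.

Section gibbs_pairs.
Variables (R : realType) (V : finType) (b : R) (G : {set {set V}}) (r : V).
Implicit Types (T : {set {set V}}) (E : {set {set V}} -> {set {set V}} -> bool).
Local Notation spanning := (spanning_tree G r).

Definition partition_function : R := \sum_T gibbs_weight b G r T.

Definition gibbs_pair_prob E : R :=
  \sum_T \sum_(T' | E T T') gibbs b G r T * gibbs b G r T'.

Lemma gibbs_weight_ge0 T : 0 <= gibbs_weight b G r T.
Proof. by rewrite /gibbs_weight; case: asboolP; rewrite ?expR_ge0. Qed.

Lemma gibbs_weight_nspanning T : ~ spanning T -> gibbs_weight b G r T = 0.
Proof. by move=> nT; rewrite /gibbs_weight asboolF. Qed.

Lemma gibbs_nspanning T : ~ spanning T -> gibbs b G r T = 0.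
Proof. by move=> nT; rewrite /gibbs gibbs_weight_nspanning// mul0r. Qed.

Lemma gibbs_ge0 T : 0 <= gibbs b G r T.
Proof.
by rewrite divr_ge0 ?gibbs_weight_ge0// sumr_ge0// => S _; exact: gibbs_weight_ge0.
Qed.

Let gibbs_pair_ge0 T T' : 0 <= gibbs b G r T * gibbs b G r T'.
Proof. by apply: mulr_ge0; exact: gibbs_ge0. Qed.

Lemma sum_gibbs_le1 : \sum_T gibbs b G r T <= 1.
Proof.
rewrite -mulr_suml -/partition_function.
by have [->|n0] := eqVneq partition_function 0; rewrite ?mul0r ?ler01 ?divff.
Qed.

Lemma gibbs_pair_prob_ge0 E : 0 <= gibbs_pair_prob E.
Proof.
by rewrite sumr_ge0// => T _; exact: sumr_ge0.
Qed.

Lemma gibbs_pair_prob_le1 E : gibbs_pair_prob E <= 1.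
Proof.
apply: le_trans sum_gibbs_le1; apply: ler_sum => T _.
rewrite -mulr_sumr ler_piMr ?gibbs_ge0//.
apply: le_trans sum_gibbs_le1; rewrite [leRHS](bigID (E T)) /= lerDl.
by apply: sumr_ge0 => S _; exact: gibbs_ge0.
Qed.

Lemma gibbs_pair_probE E : gibbs_pair_prob E =
  \sum_T \sum_T' (E T T')%:R * (gibbs b G r T * gibbs b G r T').
Proof.
apply: eq_bigr => T _; rewrite big_mkcond; apply: eq_bigr => T' _.
by case: (E T T'); rewrite ?mul1r ?mul0r.
Qed.

Lemma le_gibbs_pair_prob E E' :
  (forall T T', spanning T -> spanning T' -> E T T' -> E' T T') ->
  gibbs_pair_prob E <= gibbs_pair_prob E'.
Proof.
move=> EE'; rewrite !gibbs_pair_probE; apply: ler_sum => T _; apply: ler_sum => T' _.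
have [sT|nT] := pselect (spanning T); last by rewrite (gibbs_nspanning nT) mul0r !mulr0.
have [sT'|nT'] := pselect (spanning T'); last by rewrite (gibbs_nspanning nT') !mulr0.
rewrite ler_wpM2r// ler_nat.
by case: (E T T') (EE' T T' sT sT') => // /(_ isT) ->.
Qed.

Lemma gibbs_pair_prob_or_le E E' :
  gibbs_pair_prob (fun T T' => E T T' || E' T T') <=
  gibbs_pair_prob E + gibbs_pair_prob E'.
Proof.
rewrite !gibbs_pair_probE -big_split; apply: ler_sum => T _.
rewrite -big_split; apply: ler_sum => T' _ /=.
rewrite -mulrDl ler_wpM2r//.
by case: (E T T'); case: (E' T T'); rewrite /= ?addr0 ?add0r ?lerDl.
Qed.

Lemma gibbs_pair_prob_markov s t E :
  (forall T T', spanning T -> spanning T' -> E T T' ->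
     s <= t * (common_edges r T T')%:R) ->
  gibbs_pair_prob E <= expR (- s) *
    (\sum_T \sum_T' gibbs_weight b G r T * gibbs_weight b G r T' *
       expR t ^+ common_edges r T T') / partition_function ^+ 2.
Proof.
move=> Es; rewrite gibbs_pair_probE !mulr_sumr mulr_suml; apply: ler_sum => T _.
rewrite !mulr_sumr mulr_suml; apply: ler_sum => T' _.
have [sT|nT] := pselect (spanning T); last first.
  by rewrite gibbs_nspanning// gibbs_weight_nspanning// !(mul0r, mulr0).
have [sT'|nT'] := pselect (spanning T'); last first.
  by rewrite (gibbs_nspanning nT') (gibbs_weight_nspanning nT') !(mul0r, mulr0).
rewrite /gibbs -/partition_function [_ / _ * _]mulrACA -invfM -expr2 [leLHS]mulrA.
rewrite ler_wpM2r ?invr_ge0 ?sqr_ge0// [leLHS]mulrC [leRHS]mulrCA.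
rewrite ler_wpM2l ?mulr_ge0 ?gibbs_weight_ge0// -expRM_natl -expRD.
have [ETT'|_] := boolP (E T T'); last exact: expR_ge0.
by rewrite -[leLHS]expR0 ler_expR addrC subr_ge0 mulrC; exact: Es.
Qed.

End gibbs_pairs.

Section gibbs_pair_bounds.
Variables (R : realType) (V : finType) (r : V) (G : {set {set V}}) (b : R).
Hypothesis GE : G \subset all_edges V.
Hypothesis b0 : 0 <= b.
Implicit Types (T : {set {set V}}) (u v w : V) (z : R).
Local Notation C := (component G r).
Local Notation C' := (component G r :\ r).
Local Notation dG := (gdist G r).
Local Notation eb := (expR (- b)).
Local Notation bfs_weight := (expR (- b * \sum_(v in C) (dG v)%:R)).

Lemma expR_sum_gdist (h : V -> nat) : h r = 0%N ->
  expR (- b * \sum_(v in C) (h v)%:R) = \prod_(v in C') expR (- b * (h v)%:R).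
Proof.
move=> hr; rewrite mulr_sumr expR_sum (big_setD1 r) ?root_component//=.
by rewrite hr mulr0 expR0 mul1r.
Qed.

Definition parent_weight v u : R :=
  (u \in geo_parents r G v)%:R + (adj G u v)%:R * eb.

Definition parent_or_self_weight v u : R :=
  if v \in C' then parent_weight v u else (u == v)%:R.

Lemma parent_weight_ge0 v u : 0 <= parent_weight v u.
Proof. by rewrite addr_ge0// mulr_ge0// expR_ge0. Qed.

Lemma parent_or_self_weight_ge0 v u : 0 <= parent_or_self_weight v u.
Proof. by rewrite /parent_or_self_weight; case: ifP => // _; exact: parent_weight_ge0. Qed.

(* A vertex whose tree distance exceeds its graph distance costs a factor
   [expR (- b)]; the others have a geodesic parent. *)
Lemma gibbs_weight_le T : spanning_tree G r T ->
  gibbs_weight b G r T <=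
  bfs_weight * \prod_v parent_or_self_weight v (tree_parent r G T v).
Proof.
move=> sT; rewrite /gibbs_weight asboolT// !expR_sum_gdist ?gdistxx//.
have -> : \prod_v parent_or_self_weight v (tree_parent r G T v) =
    \prod_(v in C') parent_weight v (tree_parent r G T v).
  rewrite [RHS]big_mkcond; apply: eq_bigr => v _; rewrite /parent_or_self_weight.
  by case: ifPn => // vC; rewrite /tree_parent (negbTE vC) eqxx.
rewrite -big_split; apply: ler_prod => v vC; rewrite expR_ge0 /=.
have [pv _] := tree_parentP sT vC.
have pvG : adj G (tree_parent r G T v) v by exact: (subsetP (spanning_tree_sub sT)).
have vT : connect (adj T) r v.
  by apply: (spanning_tree_connect sT); move: vC; rewrite 2!inE => /andP[].
have dd := gdist_subset (spanning_tree_sub sT) vT.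
rewrite /parent_weight pvG mul1r; have [dE|dN] := eqVneq (gdist T r v) (dG v).
  have [_ pd] := tree_parent_geodesic sT vC dE.
  by rewrite dE inE pvG pd eqxx ler_peMr ?expR_ge0// lerDl expR_ge0.
apply: (@le_trans _ _ (expR (- b * (dG v)%:R) * eb)); last first.
  by rewrite ler_wpM2l ?expR_ge0// lerDr.
rewrite -expRD ler_expR -[X in _ <= _ - X]mulr1 !mulNr -opprD lerN2 -mulrDr.
by rewrite ler_wpM2l// natr1 ler_nat ltn_neqAle eq_sym dN.
Qed.

Definition replica_weight z v : R :=
  \sum_u \sum_u' parent_weight v u * parent_weight v u' * (if u == u' then z else 1).

Lemma replica_weight_ge0 z v : 0 <= z -> 0 <= replica_weight z v.
Proof.
move=> z0; apply: sumr_ge0 => u _; apply: sumr_ge0 => u' _.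
by rewrite !mulr_ge0 ?parent_weight_ge0//; case: ifP.
Qed.

Lemma replica_weightE z v : replica_weight z v =
  ((parent_count r G v)%:R + (degree G v)%:R * eb) ^+ 2 +
  (z - 1) * ((parent_count r G v)%:R + 2 * (parent_count r G v)%:R * eb +
             (degree G v)%:R * eb ^+ 2).
Proof.
have deg_sum : \sum_u (adj G u v)%:R = (degree G v)%:R :> R.
  by rewrite -sum_mem; apply: eq_bigr => u _; rewrite !inE.
transitivity ((\sum_u parent_weight v u) ^+ 2 +
    (z - 1) * \sum_u parent_weight v u ^+ 2).
  rewrite expr2 mulr_suml mulr_sumr -big_split /=; apply: eq_bigr => u _.
  rewrite (bigD1 u)//= eqxx [\sum_u0 parent_weight v u0](bigD1 u)//=.
  under eq_bigr => u' /negbTE uu' do rewrite eq_sym uu' mulr1.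
  by rewrite -mulr_sumr; ring.
congr (_ ^+ 2 + _ * _).
  by rewrite big_split /= sum_mem -mulr_suml deg_sum.
rewrite -deg_sum /parent_count -sum_mem mulr_sumr !mulr_suml -!big_split /=.
apply: eq_bigr => u _; rewrite /parent_weight !inE.
by case: (adj G u v); case: (_ == dG v) => /=; ring.
Qed.

Let pair_weight z v (uu : V * V) : R :=
  parent_or_self_weight v uu.1 * parent_or_self_weight v uu.2 *
  (if (v \in C') && (uu.1 == uu.2) then z else 1).

Let sum_pair_weight z :
  \sum_(s : {ffun V -> V * V}) \prod_v pair_weight z v (s v) =
  \prod_(v in C') replica_weight z v.
Proof.
rewrite -(bigA_distr_bigA (pair_weight z)) [RHS]big_mkcond /=.
apply: eq_bigr => v _; rewrite /pair_weight /parent_or_self_weight.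
case: ifPn => vC; first by rewrite /replica_weight pair_bigA.
rewrite (bigD1 (v, v))//= big1 ?eqxx ?mulr1 ?addr0// => -[u u'].
rewrite xpair_eqE negb_and => /orP[] /negbTE ->; by rewrite ?mul0r ?mulr0 ?mul0r.
Qed.

(* Distinct spanning trees have distinct parent functions, so a sum over pairs of
   trees is bounded by the sum over all pairs of parent functions. *)
Lemma sum_gibbs_weight_pair_le z : 0 <= z ->
  \sum_T \sum_T' gibbs_weight b G r T * gibbs_weight b G r T' *
    z ^+ common_edges r T T' <=
  bfs_weight ^+ 2 * \prod_(v in C') replica_weight z v.
Proof.
move=> z0; rewrite -sum_pair_weight mulr_sumr pair_bigA /=.
pose spanning_pair (TT : {set {set V}} * {set {set V}}) :=
  `[< spanning_tree G r TT.1 >] && `[< spanning_tree G r TT.2 >].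
pose parents (TT : {set {set V}} * {set {set V}}) : {ffun V -> V * V} :=
  [ffun v => (tree_parent r G TT.1 v, tree_parent r G TT.2 v)].
pose F (s : {ffun V -> V * V}) := bfs_weight ^+ 2 * \prod_v pair_weight z v (s v).
have parents_inj : {in spanning_pair &, injective parents}.
  move=> [T1 T2] [T1' T2'] /andP[/asboolP/= s1 /asboolP/= s2].
  move=> /andP[/asboolP/= s1' /asboolP/= s2'] /ffunP pp.
  have /all_and2[pp1 pp2] v : tree_parent r G T1 v = tree_parent r G T1' v /\
      tree_parent r G T2 v = tree_parent r G T2' v.
    by have := pp v; rewrite !ffunE => -[].
  by rewrite (tree_parent_inj GE s1 s1' pp1) (tree_parent_inj GE s2 s2' pp2).
have F0 s : 0 <= F s.
  rewrite mulr_ge0 ?sqr_ge0// prodr_ge0// => v _.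
  by rewrite !mulr_ge0 ?parent_or_self_weight_ge0//; case: ifP.
apply: le_trans (sum_inj_le parents_inj F0); rewrite [leRHS]big_mkcond /=.
apply: ler_sum => -[T T'] _ /=; rewrite unfold_in /spanning_pair /=.
case: asboolP => sT /=; last by rewrite gibbs_weight_nspanning// !mul0r.
case: asboolP => sT' /=; last by rewrite (gibbs_weight_nspanning _ sT') mulr0 mul0r.
have -> : z ^+ common_edges r T T' =
    \prod_v (if (v \in C') && (tree_parent r G T v == tree_parent r G T' v) then z else 1).
  rewrite (common_edgesE GE)// -prodr_const big_mkcond /=.
  by apply: eq_bigr => v _; rewrite inE.
rewrite /F; under [X in _ <= _ * X]eq_bigr do rewrite ffunE /pair_weight /=.
rewrite !big_split /= mulrA ler_wpM2r ?prodr_ge0// => [v _|]; first by case: ifP.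
by rewrite expr2 mulrACA; apply: ler_pM; rewrite ?gibbs_weight_ge0// gibbs_weight_le.
Qed.

Lemma partition_function_ge (h : V -> nat) (P : V -> {set V}) :
  level_structure r G h P ->
  expR (- b * \sum_(v in C) (h v)%:R) * \prod_(v in C') #|P v|%:R <=
  partition_function b G r.
Proof.
move=> hP; pose P' v := if v \in C' then P v else [set v].
have -> : \prod_(v in C') #|P v|%:R =
    \sum_(f : {ffun V -> V}) \prod_v (f v \in P' v)%:R :> R.
  rewrite -(bigA_distr_bigA (fun v u => (u \in P' v)%:R)) big_mkcond /=.
  by apply: eq_bigr => v _; rewrite sum_mem /P'; case: ifP => _ //; rewrite cards1.
pose choices := [pred f : {ffun V -> V} | [forall v, f v \in P' v]].
have choicesP f : f \in choices -> {in C', forall v, f v \in P v}.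
  by move=> /forallP fP v vC; have := fP v; rewrite /P' vC.
have tree_inj : {in choices &, injective (choice_tree r G)}.
  move=> f f' fA f'A ff'; apply/ffunP => v; have [vC|vC] := boolP (v \in C').
    exact: (choice_tree_inj hP (choicesP _ fA) (choicesP _ f'A) ff').
  move: fA f'A; rewrite !inE => /forallP/(_ v) + /forallP/(_ v).
  by rewrite /P' (negbTE vC) !inE => /eqP -> /eqP ->.
apply: le_trans (sum_inj_le tree_inj (gibbs_weight_ge0 b G r)).
rewrite mulr_sumr [leRHS]big_mkcond /=; apply: ler_sum => f _.
case: ifPn => [fA|]; last first.
  rewrite inE negb_forall => /existsP[v fv].
  by rewrite [X in _ * X](bigD1 v)//= (negbTE fv) mul0r mulr0.
have fP := choicesP _ fA; rewrite /gibbs_weight asboolT.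
  under [X in _ <= expR (_ * X)]eq_bigr => v vC do rewrite (choice_tree_gdist hP fP vC).
  by rewrite [X in _ * X]big1 ?mulr1// => v _; move: fA; rewrite inE => /forallP ->.
exact: (choice_tree_spanning hP fP).
Qed.

Lemma gibbs_pair_prob_chernoff (t s : R) (h : V -> nat) (P : V -> {set V})
    (E : {set {set V}} -> {set {set V}} -> bool) :
  level_structure r G h P -> (forall v, v \in C' -> (0 < #|P v|)%N) ->
  (forall T T', spanning_tree G r T -> spanning_tree G r T' -> E T T' ->
     s <= t * (common_edges r T T')%:R) ->
  gibbs_pair_prob b G r E <=
  expR (- s) * \prod_(v in C') (replica_weight (expR t) v *
    (expR (b * ((h v)%:R - (dG v)%:R)) / #|P v|%:R) ^+ 2).
Proof.
move=> hP P0 Es; have [hr _] := hP.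
pose ell : R := expR (- b * \sum_(v in C) (h v)%:R) * \prod_(v in C') #|P v|%:R.
have ell0 : 0 < ell.
  by rewrite mulr_gt0 ?expR_gt0// prodr_gt0// => v vC; rewrite ltr0n P0.
apply: le_trans (gibbs_pair_prob_markov b Es) _.
rewrite -mulrA ler_pM2l ?expR_gt0//.
apply: (@le_trans _ _ (bfs_weight ^+ 2 * \prod_(v in C') replica_weight (expR t) v / ell ^+ 2)).
  apply: ler_pM.
  - by do 2!apply: sumr_ge0 => ? _; rewrite !mulr_ge0 ?gibbs_weight_ge0 ?exprn_ge0 ?expR_ge0.
  - by rewrite invr_ge0 sqr_ge0.
  - exact: sum_gibbs_weight_pair_le (expR_ge0 t).
  have ellZ := partition_function_ge hP.
  rewrite lef_pV2 ?posrE ?exprn_gt0 ?(lt_le_trans ell0)//.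
  by rewrite lerXn2r ?nnegrE ?(ltW ell0)// (le_trans (ltW ell0)).
rewrite big_split /= prodrXl mulrAC -expr_div_n mulrC le_eqVlt; apply/orP; left.
apply/eqP; congr (_ * _ ^+ 2); rewrite /ell !expR_sum_gdist ?gdistxx//.
rewrite -big_split -prodf_div; apply: eq_bigr => v vC.
rewrite invfM mulrA -expRN -expRD; congr (expR _ / _).
by rewrite !mulNr opprK mulrBr addrC.
Qed.

End gibbs_pair_bounds.

(** * Tail bounds for the overlap on a fixed graph *)

Section bfs_distance.
Variables (V : finType) (r : V) (G : {set {set V}}).
Local Notation C := (component G r).
Local Notation dG := (gdist G r).

Lemma bfs_gdist k :
  (forall v, (v \in bfs_ball r G k) = (v \in C) && (dG v <= k)%N) /\
  (forall v, (v \in bfs_layer r G k) = (v \in C) && (dG v == k)).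
Proof.
elim: k => [|k [mem_ball mem_layer]].
  suff rootE v : (v == r) = (v \in C) && (dG v == 0%N).
    by split=> v; rewrite /bfs_ball /bfs_layer /= inE rootE// leqn0.
  apply/eqP/andP => [->|[vC /eqP d0]]; first by rewrite gdistxx root_component.
  rewrite inE in vC; have [p [_ lp sp]] := gdistP vC.
  by rewrite d0 in sp; rewrite -lp (size0nil sp).
have mem_next v : (v \in bfs_layer r G k.+1) = (v \in C) && (dG v == k.+1).
  rewrite bfs_layerS 2!inE; apply/andP/andP.
    move=> [vB /degree_in_gt0P[u]]; rewrite mem_layer => /andP[uC /eqP du] uv.
    have vC : v \in C by apply: (component_adj uC); rewrite adj_sym.
    split => //; move: vB; rewrite mem_ball vC /= -ltnNge => kd.
    rewrite eqn_leq kd andbT -du; apply: gdist_adj_le uv.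
    by rewrite inE in uC.
  move=> [vC /eqP dv]; rewrite mem_ball vC dv /= ltnn; split => //.
  have vr : v != r by apply: contra_eqN dv => /eqP ->; rewrite gdistxx.
  have := vC; rewrite inE => cv; have [u [cu uv du]] := gdist_predecessor cv vr.
  apply/degree_in_gt0P; exists u => //; rewrite mem_layer inE cu /=.
  by move: du; rewrite dv => -[->].
split => // v; rewrite bfs_ballS inE mem_next mem_ball -andb_orr; congr (_ && _).
by rewrite [RHS]leq_eqVlt orbC.
Qed.

Lemma mem_bfs_ball k v : (v \in bfs_ball r G k) = (v \in C) && (dG v <= k)%N.
Proof. by have [] := bfs_gdist k. Qed.

Lemma mem_bfs_layer k v : (v \in bfs_layer r G k) = (v \in C) && (dG v == k).
Proof. by have [] := bfs_gdist k. Qed.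

Lemma root_bfs_ball k : r \in bfs_ball r G k.
Proof. by rewrite mem_bfs_ball gdistxx root_component. Qed.

Lemma parent_count_layer k v : v \in bfs_layer r G k.+1 ->
  parent_count r G v = degree_in G (bfs_layer r G k) v.
Proof.
rewrite mem_bfs_layer => /andP[vC /eqP dv]; apply: eq_card => u.
rewrite !inE mem_bfs_layer dv eqSS [in RHS]andbC.
by have [uv|] //= := boolP (adj G u v); rewrite (component_adj vC uv).
Qed.

End bfs_distance.

Section expR_bounds.
Variable R : realType.
Implicit Types t x : R.

Lemma ge_id_expR x : x <= expR x.
Proof. by apply: le_trans (expR_ge1Dx x); rewrite lerDr. Qed.

Lemma expR_le_1DxDsqr t : -2^-1 <= t <= 2^-1 -> expR t <= 1 + (t + 2 * t ^+ 2).
Proof.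
move=> /andP[t1 t2]; have t0 : 0 < 1 - t by lra.
apply: (@le_trans _ _ (1 - t)^-1).
  rewrite -[expR t]invrK lef_pV2 ?posrE ?invr_gt0 ?expR_gt0//.
  by rewrite -expRN; exact: expR_ge1Dx.
rewrite -[leLHS]mul1r ler_pdivrMr//.
have : 0 <= t ^+ 2 * (1 - 2 * t) by rewrite mulr_ge0 ?sqr_ge0//; lra.
rewrite (_ : t ^+ 2 * (1 - 2 * t) = (1 + (t + 2 * t ^+ 2)) * (1 - t) - 1); last by ring.
lra.
Qed.

Lemma expR_half_itv t : -2^-1 <= t <= 2^-1 -> 3^-1 <= expR t <= 3.
Proof.
move=> t2; have := expR_le_1DxDsqr t2; move: t2 => /andP[t1 t2] quad.
apply/andP; split; first by have := expR_ge1Dx t; lra.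
have : t ^+ 2 <= 2^-1 * 2^-1.
  rewrite -[t ^+ 2]real_normK ?num_real// -expr2 lerXn2r ?nnegrE//.
  by rewrite ler_norml t1.
lra.
Qed.

End expR_bounds.

Section replica_weight_bounds.
Variables (R : realType) (V : finType) (r : V) (G : {set {set V}}) (b : R).
Hypothesis b0 : 0 <= b.
Local Notation C' := (component G r :\ r).
Local Notation eb := (expR (- b)).
Local Notation n_ v := ((parent_count r G v)%:R : R).
Local Notation d_ v := ((degree G v)%:R : R).

Definition detour_ratio v : R := d_ v * eb / n_ v.

Lemma detour_ratio_ge0 v : 0 <= detour_ratio v.
Proof. by rewrite !mulr_ge0 ?invr_ge0 ?expR_ge0. Qed.

Let eb0 : 0 < eb. Proof. exact: expR_gt0. Qed.
Let eb1 : eb <= 1. Proof. by rewrite -expR0 ler_expR oppr_le0. Qed.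

Lemma replica_weight_le_max z v m : 1 <= z -> n_ v <= m -> d_ v * eb <= m ->
  replica_weight r G b z v <= 4 * m * (m + z).
Proof.
move=> z1 nm dm; rewrite replica_weightE.
have n0 : 0 <= n_ v by [].
have d0 : 0 <= d_ v * eb by rewrite mulr_ge0 ?expR_ge0.
have : (n_ v + d_ v * eb) ^+ 2 <= (2 * m) ^+ 2.
  by rewrite lerXn2r ?nnegrE ?addr_ge0//; lra.
have : (z - 1) * (n_ v + 2 * n_ v * eb + d_ v * eb ^+ 2) <= z * (4 * m).
  apply: ler_pM; [lra| |lra|].
    by rewrite !addr_ge0// !mulr_ge0 ?sqr_ge0// ltW.
  have : n_ v * eb <= n_ v by rewrite ler_piMr.
  have : d_ v * eb ^+ 2 <= d_ v * eb by rewrite expr2 mulrA ler_piMr.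
  lra.
rewrite exprMn; lra.
Qed.

Lemma replica_weight_bfs_le z v : v \in C' -> 3^-1 <= z <= 3 ->
  replica_weight r G b z v / n_ v ^+ 2 <=
  expR ((z - 1) / n_ v) * (1 + 9 * detour_ratio v) ^+ 2.
Proof.
move=> vC /andP[z3 z3']; rewrite replica_weightE.
have n1 : 1 <= n_ v by rewrite ler1n parent_count_gt0.
have d1 : 1 <= d_ v by rewrite ler1n (degree_gt0 (r := r)).
have dl0 := detour_ratio_ge0 v; rewrite /detour_ratio in dl0 *.
move: (parent_count r G v)%:R (degree G v)%:R eb n1 d1 eb0 eb1 dl0.
move=> n d e n1 d1 e0 e1; have n0 : 0 < n by apply: lt_le_trans n1.
set dl := d * e / n; pose x := (z - 1) / n => dl0.
have en : e / n <= dl by rewrite ler_pM2r ?invr_gt0// ler_peMl// ltW.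
have en0 : 0 <= e / n by rewrite divr_ge0 ?ltW.
have x1 : 3^-1 <= 1 + x.
  have : - (2 / 3) <= x by rewrite ler_pdivlMr// mulNr; nra.
  lra.
have -> : ((n + d * e) ^+ 2 + (z - 1) * (n + 2 * n * e + d * e ^+ 2)) / n ^+ 2 =
    (1 + dl) ^+ 2 + x + (z - 1) * (2 * (e / n) + dl * (e / n)).
  by rewrite /dl /x; field; exact: lt0r_neq0.
apply: (@le_trans _ _ ((1 + x) * (1 + 9 * dl) ^+ 2)); last first.
  by rewrite ler_wpM2r ?sqr_ge0// expR_ge1Dx.
have : (z - 1) * (2 * (e / n) + dl * (e / n)) <= 2 * (2 * dl + dl ^+ 2).
  apply: (@le_trans _ _ (2 * (2 * (e / n) + dl * (e / n)))).
    apply: ler_wpM2r; first by apply: addr_ge0; apply: mulr_ge0.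
    by rewrite lerBlDr (le_trans z3')// -natr1.
  rewrite ler_pM2l//; apply: lerD; first by rewrite ler_pM2l.
  by rewrite expr2 ler_wpM2l.
have : 0 <= (1 + x - 3^-1) * (18 * dl + 81 * dl ^+ 2).
  by rewrite mulr_ge0 ?subr_ge0// addr_ge0// mulr_ge0 ?sqr_ge0.
have := sqr_ge0 dl; nra.
Qed.

End replica_weight_bounds.

Section bfs_comparison.
Variables (R : realType) (V : finType) (r : V) (G : {set {set V}}) (b : R).
Hypothesis GE : G \subset all_edges V.
Hypothesis b0 : 0 <= b.
Implicit Types (T : {set {set V}}) (E : {set {set V}} -> {set {set V}} -> bool).
Local Notation C' := (component G r :\ r).
Local Notation N := (#|C'|%:R : R).

Definition inv_parent_sum : R := \sum_(v in C') (parent_count r G v)%:R^-1.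

Definition detour_cost : R := 2 * \sum_(v in C') ln (1 + 9 * detour_ratio r G b v).

Lemma inv_parent_sum_ge0 : 0 <= inv_parent_sum.
Proof. by apply: sumr_ge0 => v _; rewrite invr_ge0. Qed.

Lemma inv_parent_sum_le : inv_parent_sum <= N.
Proof.
rewrite -sum1_card natr_sum; apply: ler_sum => v vC.
by rewrite invf_le1 ?ler1n ?ltr0n parent_count_gt0.
Qed.

Lemma gibbs_pair_prob_bfs_le (t s : R) E : -2^-1 <= t <= 2^-1 ->
  (forall T T', spanning_tree G r T -> spanning_tree G r T' -> E T T' ->
     s <= t * (common_edges r T T')%:R) ->
  gibbs_pair_prob b G r E <=
  expR (- s + (t + 2 * t ^+ 2) * inv_parent_sum + detour_cost).
Proof.
move=> t2 Es; have z3 := expR_half_itv t2.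
apply: le_trans (gibbs_pair_prob_chernoff GE b0 (level_structure_geo r G) _ Es) _.
  by move=> v; exact: parent_count_gt0.
have x0 v : 0 < 1 + 9 * detour_ratio r G b v.
  by rewrite ltr_wpDr// mulr_ge0 ?detour_ratio_ge0.
apply: (@le_trans _ _ (expR (- s) * \prod_(v in C')
    (expR ((expR t - 1) / (parent_count r G v)%:R) *
     (1 + 9 * detour_ratio r G b v) ^+ 2))).
  rewrite ler_pM2l ?expR_gt0//; apply: ler_prod => v vC.
  rewrite subrr mulr0 expR0 mul1r exprVn -/(parent_count r G v).
  by rewrite replica_weight_bfs_le// andbT divr_ge0 ?exprn_ge0 ?replica_weight_ge0 ?expR_ge0.
rewrite -addrA expRD ler_pM2l ?expR_gt0// big_split /= -expR_sum expRD.
apply: ler_pM; rewrite ?expR_ge0 ?prodr_ge0 ?ler_expR//.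
- by move=> v _; rewrite sqr_ge0.
- rewrite -mulr_sumr -/inv_parent_sum ler_wpM2r ?inv_parent_sum_ge0//.
  by rewrite lerBlDl expR_le_1DxDsqr.
rewrite prodrXl expRM_natl expR_sum.
by under [X in _ <= X ^+ 2]eq_bigr do rewrite lnK ?posrE//.
Qed.

Lemma overlap_deviation_cases (c eps : R) T T' :
  spanning_tree G r T -> spanning_tree G r T' ->
  eps < `|overlap R r T T' - c| ->
  ((c + eps) * N <= (common_edges r T T')%:R) ||
  ((common_edges r T T')%:R <= (c - eps) * N).
Proof.
move=> sT sT'; rewrite (overlapE GE R sT sT').
have [->|N0] := eqVneq N 0; first by rewrite !mulr0 ler0n.
have {}N0 : 0 < N by rewrite lt0r N0 ler0n.
rewrite ltr_normr => /orP[] overlap_far; apply/orP; [left|right].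
  by rewrite -ler_pdivlMr//; lra.
by rewrite -ler_pdivrMr//; lra.
Qed.

Lemma gibbs_pair_prob_shift_le (c eps t : R) E : `|t| <= 2^-1 ->
  (forall T T', spanning_tree G r T -> spanning_tree G r T' -> E T T' ->
     (t * c + `|t| * eps) * N <= t * (common_edges r T T')%:R) ->
  gibbs_pair_prob b G r E <=
  expR (- (`|t| * eps * N) + `|t| * `|inv_parent_sum - c * N| +
        2 * t ^+ 2 * N + detour_cost).
Proof.
rewrite ler_norml => t2 Es; apply: le_trans (gibbs_pair_prob_bfs_le t2 Es) _.
rewrite ler_expR lerD2r.
have : t * (inv_parent_sum - c * N) <= `|t| * `|inv_parent_sum - c * N|.
  by rewrite -normrM ler_norm.
have : 2 * t ^+ 2 * inv_parent_sum <= 2 * t ^+ 2 * N.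
  by rewrite ler_wpM2l ?inv_parent_sum_le// mulr_ge0// sqr_ge0.
lra.
Qed.

Lemma overlap_tail_bfs_le (c eps t : R) : 0 < t <= 2^-1 ->
  gibbs_pair_prob b G r (fun T T' => eps < `|overlap R r T T' - c|) <=
  2 * expR (- (t * eps * N) + t * `|inv_parent_sum - c * N| +
            2 * t ^+ 2 * N + detour_cost).
Proof.
move=> /andP[t0 t2]; have tn : `|t| = t by rewrite gtr0_norm.
apply: le_trans (le_gibbs_pair_prob b (overlap_deviation_cases (c := c) (eps := eps))) _.
apply: le_trans (gibbs_pair_prob_or_le _ _ _ _ _) _.
rewrite mulr_natl mulr2n; apply: lerD.
  rewrite -{1 2}tn; apply: gibbs_pair_prob_shift_le; rewrite tn// => T T' _ _ E.
  by rewrite -mulrDr -mulrA ler_pM2l.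
rewrite -{1 2}tn -normrN -(sqrrN t); apply: gibbs_pair_prob_shift_le.
  by rewrite normrN tn.
move=> T T' _ _ E; rewrite normrN tn mulNr [in leRHS]mulNr addrC -mulrBr -mulrA.
by rewrite lerNr -mulrN ler_pM2l// -mulNr opprB.
Qed.

End bfs_comparison.

Section displaced_comparison.
Variables (R : realType) (V : finType) (r : V) (G : {set {set V}}) (b : R).
Hypothesis GE : G \subset all_edges V.
Hypothesis b0 : 0 <= b.
Local Notation C := (component G r).
Local Notation C' := (component G r :\ r).
Local Notation dG := (gdist G r).
Local Notation eb := (expR (- b)).
Local Notation n_ v := ((parent_count r G v)%:R : R).
Local Notation d_ v := ((degree G v)%:R : R).
Variables (k : nat) (X : {set V}) (y : R).
Hypothesis XL : X \subset bfs_layer r G k.+1.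
Hypothesis y0 : 0 < y.

Definition regular_vertices : {set V} :=
  [set v | [&& v \notin bfs_ball r G k, v \notin X & y <= (degree_in G X v)%:R]].

Definition irregular_vertices : {set V} := C' :&: ~: regular_vertices.

Definition default_parent v : V := odflt v [pick u in geo_parents r G v].

(* The comparison trees attach most vertices to X: a regular vertex of the layer
   k.+1 moves down by one level when it has few parents there, unless it must
   stay to serve as the parent of an irregular vertex. *)
Definition displaced_vertices : {set V} :=
  [set v in regular_vertices | [&& dG v == k.+1, n_ v < d_ v * eb &
     v \notin default_parent @: irregular_vertices]].

Definition attached_vertices : {set V} :=
  displaced_vertices :|: [set v in regular_vertices | dG v != k.+1].

Definition displaced_level v : nat := (dG v + (v \in displaced_vertices))%N.

Definition displaced_choice v : {set V} :=
  if v \in attached_vertices then neighbors_in G X v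
  else if (v \in regular_vertices) && (d_ v * eb <= n_ v) then geo_parents r G v
  else [set default_parent v].

Definition exceptional_vertices : {set V} :=
  irregular_vertices :|: default_parent @: irregular_vertices.

Lemma default_parent_geo v : v \in C' -> default_parent v \in geo_parents r G v.
Proof.
move=> vC; rewrite /default_parent; case: pickP => [u|no_parent] //=.
by have /card_gt0P[u] := parent_count_gt0 vC; rewrite no_parent.
Qed.

Lemma regular_verticesP v : v \in regular_vertices ->
  [/\ v \in C', v \notin X, dG v = k.+1 \/ dG v = k.+2 &
      y <= (degree_in G X v)%:R].
Proof.
rewrite inE => /and3P[vB vX yv].
have /degree_in_gt0P[u uX uv] : (0 < degree_in G X v)%N.
  by rewrite -(ltr_nat R) (lt_le_trans y0).
have := subsetP XL u uX; rewrite mem_bfs_layer => /andP[uC /eqP du].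
have vC : v \in C by apply: (component_adj uC); rewrite adj_sym.
have vr : v != r by apply: contraNneq vB => ->; exact: root_bfs_ball.
split => //; first by rewrite 2!inE vr.
move: vB; rewrite mem_bfs_ball vC /= -ltnNge => kd.
have : (dG v <= k.+2)%N by rewrite -du; apply: gdist_adj_le uv; rewrite inE in uC.
rewrite leq_eqVlt ltnS => /orP[/eqP|dk]; first by right.
by left; apply/eqP; rewrite eqn_leq dk.
Qed.

Lemma regular_component : regular_vertices \subset C'.
Proof. by apply/subsetP => v /regular_verticesP[]. Qed.

Lemma mem_irregular v :
  (v \in irregular_vertices) = (v \in C') && (v \notin regular_vertices).
Proof. by rewrite in_setI in_setC. Qed.

Lemma mem_displaced v : (v \in displaced_vertices) =
  [&& v \in regular_vertices, dG v == k.+1, n_ v < d_ v * eb &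
      v \notin default_parent @: irregular_vertices].
Proof. by rewrite [LHS]inE. Qed.

Lemma mem_attached v : (v \in attached_vertices) =
  (v \in displaced_vertices) || (v \in regular_vertices) && (dG v != k.+1).
Proof. by rewrite in_setU [X in _ || X]inE. Qed.

Lemma displaced_gdist v : v \in displaced_vertices -> dG v = k.+1.
Proof. by rewrite mem_displaced => /and3P[_ /eqP]. Qed.

Lemma displaced_regular v : v \in displaced_vertices -> v \in regular_vertices.
Proof. by rewrite mem_displaced => /andP[]. Qed.

Lemma attached_regular v : v \in attached_vertices -> v \in regular_vertices.
Proof. by rewrite mem_attached => /orP[/displaced_regular|/andP[]]. Qed.

Lemma attached_level v : v \in attached_vertices -> displaced_level v = k.+2.
Proof.
rewrite /displaced_level mem_attached.
have [vd _|vd] /= := boolP (v \in displaced_vertices).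
  by rewrite (displaced_gdist vd) addn1.
rewrite addn0 => /andP[/regular_verticesP[_ _ + _] vk].
by case=> // vk1; rewrite vk1 eqxx in vk.
Qed.

Lemma target_level u : u \in X -> displaced_level u = k.+1.
Proof.
move=> uX; rewrite /displaced_level; have := subsetP XL u uX.
rewrite mem_bfs_layer => /andP[_ /eqP ->].
have [/displaced_regular/regular_verticesP[_]|_] := boolP (u \in displaced_vertices).
  by rewrite uX.
by rewrite addn0.
Qed.

Lemma unattached_parent_not_displaced v u :
  v \in C' -> v \notin attached_vertices -> u \in displaced_choice v ->
  u \in geo_parents r G v /\ u \notin displaced_vertices.
Proof.
move=> vC vA; rewrite /displaced_choice (negbTE vA).
have regular_case : v \in regular_vertices -> u \in geo_parents r G v ->
    u \notin displaced_vertices.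
  move=> vR; rewrite inE => /andP[_ /eqP du]; apply/negP => /displaced_gdist uk.
  by move: vA; rewrite mem_attached vR -du uk eqSS eqn_leq ltnn orbT.
case: ifPn => [/andP[vR _] uv|_]; first by split; last exact: regular_case.
rewrite inE => /eqP uE; have := default_parent_geo vC; rewrite -uE => pv; split => //.
have [vR|vR] := boolP (v \in regular_vertices); first exact: regular_case.
have u_default : u \in default_parent @: irregular_vertices.
  by apply/imsetP; exists v; rewrite // mem_irregular vC.
by rewrite mem_displaced u_default !andbF.
Qed.

Lemma level_structure_displaced :
  level_structure r G displaced_level displaced_choice.
Proof.
split=> [|v u vC].
  rewrite /displaced_level gdistxx; case: (boolP (r \in _)) => // /displaced_gdist.
  by rewrite gdistxx.
have [vA|vA] := boolP (v \in attached_vertices).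
  rewrite /displaced_choice vA inE => /andP[uX uv].
  by rewrite target_level// attached_level.
move=> /(unattached_parent_not_displaced vC vA)[]; rewrite inE => /andP[uv /eqP du] ud.
split => //; rewrite /displaced_level (negbTE ud) addn0 du.
by move: vA; rewrite mem_attached negb_or => /andP[/negbTE -> _]; rewrite addn0.
Qed.

Lemma displaced_choice_gt0 v : v \in C' -> (0 < #|displaced_choice v|)%N.
Proof.
move=> vC; rewrite /displaced_choice; case: ifPn => [/attached_regular|_].
  move=> /regular_verticesP[_ _ _ yv].
  by rewrite -/(degree_in G X v) -(ltr_nat R) (lt_le_trans y0).
by case: ifP => _; rewrite ?cards1// -/(parent_count r G v) parent_count_gt0.
Qed.

Lemma card_exceptional_le :
  (#|exceptional_vertices| <= 2 * #|~: regular_vertices|)%N.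
Proof.
have irr_le : (#|irregular_vertices| <= #|~: regular_vertices|)%N.
  exact/subset_leq_card/subsetIr.
apply: leq_trans (leq_card_setU _ _) _; rewrite mul2n -addnn leq_add//.
exact: leq_trans (leq_imset_card _ _) irr_le.
Qed.

Variables (a Q t : R).
Hypothesis a1 : 1 <= a.
Hypothesis aQ : a <= Q * y.
Hypothesis Q1 : 1 <= Q.
Hypothesis t0 : 0 <= t.
Hypothesis ta : expR t <= a.
(* Either a detour costs little, or no vertex of the layer k.+1 is displaced. *)
Hypothesis cheap_or_whole_layer : expR t * expR b <= a \/ X = bfs_layer r G k.+1.

Local Notation z := (expR t).
Local Notation W v := (replica_weight r G b z v).
Local Notation ratio v := (W v *
  (expR (b * ((displaced_level v)%:R - (dG v)%:R)) / #|displaced_choice v|%:R) ^+ 2).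
Local Notation K := (8 * z * a ^+ 2).

Let a0 : 0 < a. Proof. exact: lt_le_trans a1. Qed.
Let z0 : 0 < z. Proof. exact: expR_gt0. Qed.
Let z1 : 1 <= z. Proof. by rewrite -expR0 ler_expR. Qed.
Let eb0 : 0 < eb. Proof. exact: expR_gt0. Qed.
Let eb1 : eb <= 1. Proof. by rewrite -expR0 ler_expR oppr_le0. Qed.
Let ebK : eb * expR b = 1. Proof. by rewrite -expRD addNr expR0. Qed.

Let K1 : 1 <= K.
Proof. by have : 1 <= a ^+ 2 by [rewrite exprn_ege1]; have := z1; nra. Qed.

(* The bound [deg <= a * expR (deg / a)] avoids any control of the maximal
   degree. *)
Lemma degree_le_expR v : d_ v <= a * expR (d_ v / a).
Proof. by rewrite -ler_pdivrMl// mulrC ge_id_expR. Qed.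

Let rho1 v : 1 <= expR (d_ v / a).
Proof. by rewrite -expR0 ler_expR divr_ge0// ltW. Qed.

Lemma attached_quadratic_le v w : 0 <= w <= a -> y <= (degree_in G X v)%:R ->
  4 * d_ v * (d_ v + w) / (degree_in G X v)%:R ^+ 2 <=
  8 * Q ^+ 2 * expR (d_ v / a) ^+ 2.
Proof.
move=> /andP[w0 wa] yx; have x0 := lt_le_trans y0 yx.
have dr := degree_le_expR v; have r1 := rho1 v.
have wr : w <= a * expR (d_ v / a) by apply: le_trans wa _; rewrite ler_peMr// ltW.
rewrite ler_pdivrMr ?exprn_gt0//.
set d := d_ v in dr r1 wr *; set x := (degree_in G X v)%:R in yx x0 *.
set rho := expR _ in dr r1 wr *; have d0 : 0 <= d by [].
apply: (@le_trans _ _ (4 * (a * rho) * (a * rho + a * rho))).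
  by apply: ler_pM; [rewrite mulr_ge0|rewrite addr_ge0|rewrite ler_pM2l|exact: lerD].
have -> : 4 * (a * rho) * (a * rho + a * rho) = 8 * rho ^+ 2 * a ^+ 2 by ring.
have -> : 8 * Q ^+ 2 * rho ^+ 2 * x ^+ 2 = 8 * rho ^+ 2 * (Q * x) ^+ 2 by ring.
rewrite ler_wpM2l ?(mulr_ge0 _ (sqr_ge0 _))//.
have aQx : a <= Q * x by apply: le_trans aQ _; rewrite ler_wpM2l// (le_trans ler01).
by rewrite lerXn2r ?nnegrE ?(ltW a0)// (le_trans (ltW a0)).
Qed.

Lemma layer_detour_cheap v : v \in regular_vertices -> dG v = k.+1 -> z * expR b <= a.
Proof.
move=> /regular_verticesP[vC vX _ _] vk; case: cheap_or_whole_layer => // XE.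
by move: vX; rewrite XE mem_bfs_layer vk eqxx andbT; move: vC; rewrite 2!inE => /andP[_ ->].
Qed.

Lemma displaced_ratio_le v : v \in displaced_vertices ->
  ratio v <= 8 * Q ^+ 2 * expR (d_ v / a) ^+ 2.
Proof.
move=> vd; have vR := displaced_regular vd; have [vC _ _ yv] := regular_verticesP vR.
have zb := layer_detour_cheap vR (displaced_gdist vd).
have nd : n_ v <= d_ v * eb by move: vd; rewrite mem_displaced => /and4P[_ _ /ltW].
rewrite /displaced_choice mem_attached /displaced_level vd /= natrD addrC addKr mulr1.
apply: le_trans (attached_quadratic_le (w := z * expR b) _ yv); last first.
  by rewrite zb mulr_ge0 ?expR_ge0.
rewrite expr_div_n mulrA ler_wpM2r ?invr_ge0 ?sqr_ge0//.
apply: (@le_trans _ _ (4 * (d_ v * eb) * (d_ v * eb + z) * expR b ^+ 2)).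
  by rewrite ler_wpM2r ?sqr_ge0// replica_weight_le_max.
have -> : 4 * (d_ v * eb) * (d_ v * eb + z) * expR b ^+ 2 =
  4 * d_ v * (eb * expR b) * (d_ v * (eb * expR b) + z * expR b) by ring.
by rewrite ebK !mulr1.
Qed.

Lemma unshifted_ratioE v : v \notin displaced_vertices ->
  ratio v = W v / #|displaced_choice v|%:R ^+ 2.
Proof.
move=> vd; rewrite /displaced_level (negbTE vd) addn0 subrr mulr0 expR0 mul1r.
by rewrite exprVn.
Qed.

Let replica_weight_le_degree v : W v <= 4 * d_ v * (d_ v + z).
Proof.
by rewrite replica_weight_le_max ?ler_nat ?parent_count_le_degree// ler_piMr.
Qed.

Lemma far_ratio_le v : v \in regular_vertices -> dG v != k.+1 ->
  ratio v <= 8 * Q ^+ 2 * expR (d_ v / a) ^+ 2.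
Proof.
move=> vR vk; have [_ _ _ yv] := regular_verticesP vR.
have vd : v \notin displaced_vertices by apply: contraNN vk => /displaced_gdist ->.
have vA : v \in attached_vertices by rewrite mem_attached vR vk orbT.
rewrite unshifted_ratioE// /displaced_choice vA.
apply: le_trans (attached_quadratic_le (w := z) _ yv); last by rewrite ta ltW.
by rewrite ler_wpM2r ?invr_ge0 ?sqr_ge0.
Qed.

Lemma many_parents_ratio_le v : v \in regular_vertices -> dG v = k.+1 ->
  d_ v * eb <= n_ v -> ratio v <= 8 * Q ^+ 2 * expR (d_ v / a) ^+ 2.
Proof.
move=> vR vk dn; have [vC _ _ yv] := regular_verticesP vR.
have vd : v \notin displaced_vertices.
  by rewrite mem_displaced !negb_and -leNgt dn !orbT.
have vA : v \notin attached_vertices by rewrite mem_attached negb_or vd vR vk eqxx.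
rewrite unshifted_ratioE// /displaced_choice (negbTE vA) vR dn /= -/(parent_count r G v).
have n0 : 0 < n_ v by rewrite ltr0n parent_count_gt0.
have zn : z <= Q * n_ v.
  apply: (@le_trans _ _ (Q * (d_ v * eb))); last first.
    by rewrite ler_wpM2l// (le_trans ler01).
  rewrite -(ler_pM2r (expR_gt0 b)) -!mulrA ebK mulr1.
  apply: le_trans (layer_detour_cheap vR vk) _; apply: le_trans aQ _.
  rewrite ler_wpM2l ?(le_trans ler01)//; apply: le_trans yv _.
  by rewrite ler_nat degree_in_le.
apply: (@le_trans _ _ (4 * (1 + Q))).
  rewrite ler_pdivrMr ?exprn_gt0//; apply: le_trans (replica_weight_le_max b0 z1 (lexx _) dn) _.
  have : 4 * n_ v * z <= 4 * n_ v * (Q * n_ v) by rewrite ler_pM2l// mulr_gt0.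
  lra.
rewrite -mulrA -exprMn.
have : Q <= Q * expR (d_ v / a) by rewrite ler_peMr ?rho1// (le_trans ler01).
by move: (Q * expR _) => x Qx; have := Q1; nra.
Qed.

Lemma exceptional_ratio_le v : v \in C' -> v \notin attached_vertices ->
  ratio v <= K * expR (d_ v / a) ^+ 2.
Proof.
move=> vC vA; have vd : v \notin displaced_vertices.
  by move: vA; rewrite mem_attached negb_or => /andP[].
have d1 : 1 <= d_ v by rewrite ler1n (degree_gt0 (r := r)).
have c1 : 1 <= #|displaced_choice v|%:R :> R by rewrite ler1n displaced_choice_gt0.
rewrite unshifted_ratioE//; apply: (@le_trans _ _ (W v)).
  rewrite ler_piMr ?replica_weight_ge0 ?(ltW z0)//.
  by rewrite invf_le1 ?exprn_ege1// exprn_gt0// (lt_le_trans ltr01).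
apply: le_trans (replica_weight_le_degree v) _.
apply: (@le_trans _ _ (8 * z * d_ v ^+ 2)).
  move: d1 z1; move: (d_ v) z => d s d1 s1.
  have : 0 <= (s - 1) * d ^+ 2 by rewrite mulr_ge0 ?sqr_ge0 ?subr_ge0.
  have : 0 <= s * (d * (d - 1)) by rewrite !mulr_ge0 ?subr_ge0//; lra.
  rewrite expr2; lra.
have -> : K * expR (d_ v / a) ^+ 2 = 8 * z * (a * expR (d_ v / a)) ^+ 2 by ring.
rewrite ler_wpM2l ?mulr_ge0 ?(ltW z0)//.
by rewrite lerXn2r ?nnegrE ?degree_le_expR// mulr_ge0 ?expR_ge0// ltW.
Qed.

Lemma displaced_comparison_ratio_le v : v \in C' ->
  ratio v <= 8 * Q ^+ 2 * (if v \in exceptional_vertices then K else 1) *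
             expR (2 * (d_ v / a)).
Proof.
move=> vC; rewrite expRM_natl; set rho := expR _ ^+ 2.
have rho0 : 0 <= rho by exact: sqr_ge0.
have Q2 : 1 <= 8 * Q ^+ 2 by rewrite -[leLHS]mulr1 ler_pM// ?exprn_ege1// ler1n.
have ifK : 1 <= (if v \in exceptional_vertices then K else 1) by case: ifP.
have ordinary : 8 * Q ^+ 2 * rho <=
    8 * Q ^+ 2 * (if v \in exceptional_vertices then K else 1) * rho.
  by rewrite ler_wpM2r// ler_peMr// (le_trans ler01).
have [vd|vd] := boolP (v \in displaced_vertices).
  exact: le_trans (displaced_ratio_le vd) ordinary.
have [/andP[vR vk]|far] := boolP ((v \in regular_vertices) && (dG v != k.+1)).
  exact: le_trans (far_ratio_le vR vk) ordinary.
have vA : v \notin attached_vertices.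
  by rewrite mem_attached negb_or vd.
have [vE|vE] := boolP (v \in exceptional_vertices); last first.
  have vR : v \in regular_vertices.
    by move: vE; rewrite in_setU mem_irregular vC /= negb_or negbK => /andP[].
  have vk : dG v = k.+1 by move: far; rewrite vR negbK => /eqP.
  rewrite mulr1; apply: many_parents_ratio_le => //; rewrite leNgt; apply/negP => nd.
  by move: vd vE; rewrite mem_displaced vR vk eqxx nd /= negbK in_setU => ->; rewrite orbT.
apply: le_trans (exceptional_ratio_le vC vA) _.
by rewrite ler_wpM2r// ler_peMl// (le_trans ler01).
Qed.

Lemma overlap_tail_displaced_le (eps : R) :
  gibbs_pair_prob b G r (fun T T' => eps < `|overlap R r T T' - 0|) <=
  expR (- (t * eps * #|C'|%:R) + #|V|%:R * ln (8 * Q ^+ 2) +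
       2 * #|~: regular_vertices|%:R * ln K + 2 * ((\sum_v d_ v) / a)).
Proof.
pose N : R := #|C'|%:R.
have Q2 : 1 <= 8 * Q ^+ 2 by rewrite -[leLHS]mulr1 ler_pM// ?exprn_ege1// ler1n.
have K0 : 0 < K by rewrite (lt_le_trans ltr01).
apply: le_trans (gibbs_pair_prob_chernoff (t := t) (s := t * (eps * N)) GE b0
  level_structure_displaced displaced_choice_gt0 _) _.
  move=> T T' sT sT'; rewrite (overlapE GE R sT sT') subr0 ger0_norm ?divr_ge0//.
  move=> eo; rewrite ler_wpM2l//; have [->|N0] := eqVneq N 0; first by rewrite mulr0.
  by rewrite -ler_pdivlMr ?lt0r ?N0 ?ler0n// ltW.
rewrite -!addrA expRD mulrA ler_pM2l ?expR_gt0//.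
apply: le_trans (_ : _ <= \prod_(v in C') (8 * Q ^+ 2 *
   (if v \in exceptional_vertices then K else 1) * expR (2 * (d_ v / a)))) _.
  apply: ler_prod => v vC; rewrite displaced_comparison_ratio_le// andbT.
  by rewrite mulr_ge0 ?sqr_ge0// replica_weight_ge0 ?expR_ge0.
rewrite 2!big_split /= -expR_sum addrA !expRD.
have if0 v : 0 <= (if v \in exceptional_vertices then K else 1).
  by case: ifP => _ //; exact: ltW.
apply: ler_pM; rewrite ?expR_ge0 ?ler_expR ?mulr_ge0 ?prodr_ge0//.
- by move=> v _; exact: le_trans Q2.
- apply: ler_pM; rewrite ?prodr_ge0//; first by move=> v _; exact: le_trans Q2.
    rewrite prodr_const expRM_natl lnK ?posrE ?(lt_le_trans ltr01 Q2)//.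
    by rewrite ler_weXn2l// max_card.
  rewrite -big_mkcondr /= prodr_const -natrM expRM_natl lnK ?posrE//.
  apply: (ler_weXn2l K1); apply: leq_trans card_exceptional_le.
  by apply: subset_leq_card; apply/subsetP => v; rewrite unfold_in => /andP[].
rewrite -mulr_sumr ler_pM2l// -mulr_suml ler_pM2r ?invr_gt0//.
by rewrite [leRHS](bigID (mem C'))/= lerDl sumr_ge0.
Qed.

End displaced_comparison.

(** * Typical graphs *)

Lemma invr_nat_le1 (R : numFieldType) j : j%:R^-1 <= 1 :> R.
Proof. by case: j => [|j]; rewrite ?invr0 ?ler01// invf_le1 ?ler1n ?ltr0n. Qed.

Section parent_sums.
Variables (R : realType) (V : finType) (r : V) (G : {set {set V}}) (D : nat).
Local Notation C' := (component G r :\ r).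

(* The inverse of zero is zero, so that only the layer D.+1 contributes. *)
Definition near_parent_sum : R :=
  \sum_(v in ~: bfs_ball r G D) (degree_in G (bfs_layer r G D) v)%:R^-1.

Definition far_parent_sum : R :=
  \sum_(v in ~: bfs_ball r G D.+1) (maxn 1 (degree_in G (bfs_layer r G D.+1) v))%:R^-1.

Lemma far_parent_sum_ge0 : 0 <= far_parent_sum.
Proof. by apply: sumr_ge0 => v _; rewrite invr_ge0. Qed.

Lemma inv_parent_sum_ge : near_parent_sum <= inv_parent_sum R r G.
Proof.
rewrite [leLHS]big_mkcond [leRHS]big_mkcond /=.
apply: ler_sum => v _; rewrite inE.
have rhs0 : 0 <= (if v \in C' then (parent_count r G v)%:R^-1 else 0) :> R.
  by case: ifP; rewrite ?invr_ge0.
have [vB|vB] := boolP (v \in bfs_ball r G D) => //=.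
have [->|deg0] := posnP (degree_in G (bfs_layer r G D) v); first by rewrite invr0.
have vL : v \in bfs_layer r G D.+1 by rewrite bfs_layerS 2!inE vB deg0.
have vr : v != r by apply: contraNneq vB => ->; exact: root_bfs_ball.
have := vL; rewrite mem_bfs_layer => /andP[vC _].
by rewrite 2!inE vr vC /= (parent_count_layer vL).
Qed.

Lemma inv_parent_sum_le_near_far :
  inv_parent_sum R r G <= near_parent_sum + #|bfs_ball r G D|%:R + far_parent_sum.
Proof.
rewrite -sum1_card natr_sum /near_parent_sum /far_parent_sum /inv_parent_sum.
rewrite [leLHS]big_mkcond [X in X + _ + _]big_mkcond [X in _ + X + _]big_mkcond.
rewrite [X in _ + _ + X]big_mkcond -!big_split /=; apply: ler_sum => v _.
have inv0 j : 0 <= j%:R^-1 :> R by rewrite invr_ge0.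
case: ifPn => [vC|_]; last by rewrite !addr_ge0//; case: ifP.
have inv1 := invr_nat_le1 R (parent_count r G v).
rewrite !in_setC bfs_ballS in_setU.
have [vB|vB] /= := boolP (v \in bfs_ball r G D); first by rewrite add0r addr0.
have [vL|vL] /= := boolP (v \in bfs_layer r G D.+1).
  by rewrite !addr0 (parent_count_layer vL).
rewrite addr0; apply: ler_wpDl => //.
have [deg0|deg0] := posnP (degree_in G (bfs_layer r G D.+1) v).
  by rewrite deg0 maxn0 invr1.
have vL2 : v \in bfs_layer r G D.+2.
  by rewrite bfs_layerS 2!inE bfs_ballS inE negb_or vB vL deg0.
by rewrite (parent_count_layer vL2) (maxn_idPr deg0).
Qed.

Lemma card_component_ge : #|V|%:R - #|C'|%:R <= 1 + far_parent_sum.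
Proof.
have -> : #|V|%:R = #|C'|%:R + #|~: C'|%:R :> R by rewrite -natrD cardsC.
rewrite addrC addKr -sum1_card natr_sum (bigD1 r) /=; last by rewrite !inE eqxx.
rewrite lerD2l [leLHS]big_mkcond [leRHS]big_mkcond /=.
apply: ler_sum => v _.
have inv0 j : 0 <= j%:R^-1 :> R by rewrite invr_ge0.
case: ifPn => [/andP[vC vr]|_]; last by case: ifP.
have vC' : v \notin component G r by move: vC; rewrite !inE vr.
rewrite inE mem_bfs_ball (negbTE vC') /=.
have [->|/degree_in_gt0P[u]] := posnP (degree_in G (bfs_layer r G D.+1) v).
  by rewrite maxn0 invr1.
rewrite mem_bfs_layer => /andP[uC _] uv; case/negP: vC'.
by apply: (component_adj uC); rewrite adj_sym.
Qed.

End parent_sums.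

Definition first_vertices (V : finType) (x : nat) (L : {set V}) : {set V} :=
  [set v in take x (enum L)].

Lemma first_vertices_sub (V : finType) x (L : {set V}) : first_vertices x L \subset L.
Proof. by apply/subsetP => v; rewrite inE => /mem_take; rewrite mem_enum. Qed.

Lemma card_first_vertices (V : finType) x (L : {set V}) :
  #|first_vertices x L| = minn x #|L|.
Proof.
rewrite cardsE (card_uniqP _) ?take_uniq ?enum_uniq//.
by rewrite size_take_min -cardE.
Qed.

(* In the application, D.+1 is the paper's d_n^* and w is (log log n)^2. *)
Record sparse_regime (R : realType) (n q w : R) (D : nat) : Prop := SparseRegime {
  regime_q01 : 0 <= q <= 1;
  regime_degree : 4 <= n * q;
  regime_w : 1 <= w;
  regime_depth : n / w <= (n * q) ^+ D.+1 }.

(* Bounds the probability that the layer D.+1 has less than n / (16 w) vertices,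
   when n is the number of vertices and a the mean degree. *)
Definition small_layer_err (R : realType) (n a w : R) (D : nat) : R :=
  2 * layer_dev n a D + 4 * a ^+ D / n + 16 * w / Num.sqrt n.

Definition far_err (R : realType) (n a w : R) (D : nat) : R :=
  96 * w / a + small_layer_err n a w D.

Section typical_graph.
Variables (R : realType) (V : finType) (r : V) (q w : R) (D : nat).
Local Notation EG := (expect (@edge_prob R V q)).
Local Notation PG := (prob (@edge_prob R V q)).
Local Notation n := (#|V|%:R : R).
Local Notation a := (n * q).
Hypothesis reg : sparse_regime n q w D.
Local Notation S k G := (#|bfs_layer r G k|%:R : R).
Local Notation B k G := (#|bfs_ball r G k|%:R : R).

Let q01 : 0 <= q <= 1 := regime_q01 reg.
Let a4 : 4 <= a := regime_degree reg.
Let e01 := @edge_prob01 R V q q01.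
Let n0 : 0 < n. Proof. by rewrite ltr0n; apply/card_gt0P; exists r. Qed.
Let a0 : 0 < a. Proof. exact: lt_le_trans a4. Qed.
Let q0 : 0 < q. Proof. by rewrite -(pmulr_rgt0 _ n0). Qed.
Let aX0 k : 0 < a ^+ k. Proof. by rewrite exprn_gt0. Qed.
Let w0 : 0 < w. Proof. exact: lt_le_trans (regime_w reg). Qed.

Lemma expect_sum_outside k (f : nat -> R) :
  EG (fun G => \sum_(v in ~: bfs_ball r G k) f (degree_in G (bfs_layer r G k) v)) =
  EG (fun G => #|~: bfs_ball r G k|%:R * binomial_expect q #|bfs_layer r G k| f).
Proof.
rewrite (bfs_exposure q r k
  (Psi := fun B L G => \sum_(v in ~: B) f (degree_in G L v))); last first.
  by move=> C L; exact: sum_degree_in_unexplored.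
apply: eq_expect => G; rewrite expect_sum_degree_in//; exact: bfs_layer_disjoint.
Qed.

Lemma expect_dev_sum_outside k (f : nat -> R) : (forall j, f j ^+ 2 <= 1) ->
  EG (fun G =>
    `|\sum_(v in ~: bfs_ball r G k) f (degree_in G (bfs_layer r G k) v) -
      #|~: bfs_ball r G k|%:R * binomial_expect q #|bfs_layer r G k| f|) <=
  Num.sqrt n.
Proof.
move=> f1; rewrite (bfs_exposure q r k (Psi := fun B L G =>
  `|\sum_(v in ~: B) f (degree_in G L v) - #|~: B|%:R * binomial_expect q #|L| f|)).
  apply: (expect_le_cst e01) => G; apply: expect_dev_sum_degree_in => //.
  exact: bfs_layer_disjoint.
by move=> C L G G' /(sum_degree_in_unexplored f) ->.
Qed.

Lemma half_layer_le G : `|S D G / a ^+ D - 1| < 2^-1 -> a ^+ D / 2 <= S D G.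
Proof.
rewrite ltr_norml => /andP[+ _]; rewrite -(ltr_pM2r (aX0 D)).
rewrite [X in _ < X]mulrBl divfK ?gt_eqF// mul1r mulNr [2^-1 * _]mulrC; lra.
Qed.

Lemma mean_next_layer_large (C L : {set V}) :
  a ^+ D / 2 <= #|L|%:R -> #|C|%:R <= n / 2 ->
  n / (8 * w) <= #|~: C|%:R * hit_prob q #|L|.
Proof.
move=> L2 C2; have w1 := regime_w reg.
have hit : (4 * w)^-1 <= hit_prob q #|L|.
  apply: le_trans (hit_prob_ge_frac q01 (u := (2 * w)^-1) _); last first.
    rewrite invr_ge0 mulr_ge0 ?(ltW w0)//=.
    apply: (@le_trans _ _ (a ^+ D / 2 * q)); last by rewrite ler_pM2r.
    rewrite (_ : a ^+ D / 2 * q = a ^+ D.+1 / (2 * n)); last first.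
      by rewrite exprS; field; exact: lt0r_neq0.
    rewrite ler_pdivlMr ?mulr_gt0//; apply: le_trans (regime_depth reg).
    by rewrite le_eqVlt; apply/orP; left; apply/eqP; field; exact: lt0r_neq0.
  have -> : (2 * w)^-1 / (1 + (2 * w)^-1) = (2 * w + 1)^-1.
    by field; rewrite !gt_eqF// ltr_wpDl// mulr_ge0 ?ltW.
  rewrite lef_pV2 ?posrE ?mulr_gt0//; first by have := w1; lra.
  by rewrite ltr_wpDl// mulr_ge0// ltW.
have outside : n / 2 <= #|~: C|%:R.
  by have : n = #|C|%:R + #|~: C|%:R by [rewrite -natrD cardsC]; lra.
rewrite (_ : n / (8 * w) = n / 2 * (4 * w)^-1); last by field; exact: lt0r_neq0.
by apply: ler_pM; rewrite // ?invr_ge0 ?mulr_ge0 ?invr_ge0// ltW.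
Qed.

(* If the layer D has about the expected size and the ball is not too large, then
   the layer D.+1 can only be small if it deviates from its conditional mean. *)
Lemma prob_small_layer_le :
  PG (fun G => S D.+1 G < n / (16 * w)) <= small_layer_err n a w D.
Proof.
pose dev G := `|\sum_(v in ~: bfs_ball r G D) (0 < degree_in G (bfs_layer r G D) v)%:R -
  #|~: bfs_ball r G D|%:R * hit_prob q #|bfs_layer r G D| : R|.
have dev_le : EG dev <= Num.sqrt n.
  under eq_expect do rewrite /dev /hit_prob -binomial_expect_gt0.
  apply: expect_dev_sum_outside (fun j => (0 < j)%:R) _ => j.
  by case: (0 < j)%N; rewrite ?expr1n ?expr0n.
have nw0 : 0 < n / (16 * w) by rewrite divr_gt0// mulr_gt0.
have cover G : S D.+1 G < n / (16 * w) -> (2^-1 <= `|S D G / a ^+ D - 1|) ||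
    ((n / 2 <= B D G) || (n / (16 * w) <= dev G)).
  move=> small; have [//|/half_layer_le S2] /= := leP 2^-1 _.
  have [//|/ltW B2] /= := leP (n / 2) _.
  have := mean_next_layer_large S2 B2.
  rewrite /dev -card_next_layer -bfs_layerS distrC => mean_large.
  apply: le_trans (ler_norm _); have : n / (8 * w) = n / (16 * w) + n / (16 * w).
    by field; exact: lt0r_neq0.
  lra.
apply: le_trans (le_prob e01 cover) _.
apply: le_trans (prob_or_le e01 _ _) _; rewrite /small_layer_err -addrA; apply: lerD.
  apply: le_trans (prob_markov e01 _ _) _ => //.
  by rewrite invrK [leRHS]mulrC ler_pM2r// expect_layer_rel_dev.
apply: le_trans (prob_or_le e01 _ _) _; apply: lerD.
  apply: le_trans (prob_markov e01 _ _) _ => //; first by rewrite divr_gt0.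
  rewrite ler_pdivrMr ?divr_gt0// (_ : _ * (n / 2) = 2 * a ^+ D) ?expect_ball_le//.
  by field; exact: lt0r_neq0.
apply: le_trans (prob_markov e01 nw0 _) _ => [G|]; first exact: normr_ge0.
rewrite ler_pdivrMr//; apply: le_trans dev_le _.
have s0 : 0 < Num.sqrt n by rewrite sqrtr_gt0.
rewrite (_ : _ * (n / _) = n / Num.sqrt n); last by field; rewrite !gt_eqF.
by rewrite -[X in _ <= X / _](sqr_sqrtr (ltW n0)) expr2 mulfK ?gt_eqF.
Qed.

Lemma expect_far_parent_sum_le :
  EG (fun G => far_parent_sum R r G D) <= n * far_err n a w D.
Proof.
rewrite (expect_sum_outside D.+1 (fun j => (maxn 1 j)%:R^-1)).
apply: (@le_trans _ _ (EG (fun G => n * (96 * w / a +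
    (S D.+1 G < n / (16 * w))%R%:R)))); last first.
  by rewrite expectZ expectD expect_cst ler_pM2l// lerD2l prob_small_layer_le.
apply: (le_expect e01) => G.
apply: ler_pM; rewrite ?ler_nat ?max_card ?(binomial_expect_ge0 q01)//.
have t0 : 0 <= 96 * w / a by rewrite !mulr_ge0 ?invr_ge0 ?(ltW w0)// ltW.
case: ltP => small.
  by rewrite ler_wpDl// (binomial_expect_le_cst q01)// => j; exact: invr_nat_le1.
rewrite addr0; have S0 : 0 < S D.+1 G.
  by apply: lt_le_trans small; rewrite divr_gt0// mulr_gt0.
apply: le_trans (binomial_expect_inv_le q01 _) _; first by rewrite mulr_gt0.
rewrite ler_pdivrMr ?mulr_gt0//.
rewrite [leLHS](_ : 6 = 96 * w / a * (n / (16 * w) * q)); last first.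
  by field; rewrite !gt_eqF.
by rewrite ler_pM2l ?ler_pM2r// divr_gt0// mulr_gt0.
Qed.

Let inv_expect s : R := binomial_expect q s (fun j => j%:R^-1).

Let inv_expect01 s : 0 <= inv_expect s <= 1.
Proof.
rewrite (binomial_expect_ge0 q01) ?(binomial_expect_le_cst q01)// => j.
exact: invr_nat_le1.
Qed.

Lemma expect_near_parent_sum_dev :
  EG (fun G => `|near_parent_sum R r G D -
    n * binomial_expect q #|bfs_layer r G D| (fun j => j%:R^-1)|) <=
  Num.sqrt n + 2 * a ^+ D.
Proof.
pose dev G := `|near_parent_sum R r G D -
  #|~: bfs_ball r G D|%:R * inv_expect #|bfs_layer r G D| |.
apply: (@le_trans _ _ (EG (fun G => dev G + B D G))).
  apply: (le_expect e01) => G; rewrite /dev -/(inv_expect _).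
  have -> : n = B D G + #|~: bfs_ball r G D|%:R by rewrite -natrD cardsC.
  have /andP[p0 p1] := inv_expect01 #|bfs_layer r G D|.
  set p := inv_expect _ in p0 p1 *; set x := near_parent_sum _ _ _ _.
  have -> : x - (B D G + #|~: bfs_ball r G D|%:R) * p =
    (x - #|~: bfs_ball r G D|%:R * p) - B D G * p by ring.
  apply: le_trans (ler_normB _ _) _; rewrite lerD2l ger0_norm ?mulr_ge0//.
  by rewrite ler_piMr.
rewrite expectD; apply: lerD; last exact: expect_ball_le.
apply: expect_dev_sum_outside (fun j => j%:R^-1) _ => j.
by rewrite exprn_ile1 ?invr_ge0 ?invr_nat_le1.
Qed.

Lemma expect_inv_layer_dev (m : nat) :
  EG (fun G => `|binomial_expect q #|bfs_layer r G D| (fun j => j%:R^-1) -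
                 binomial_expect q m (fun j => j%:R^-1)|) <=
  q * (a ^+ D * layer_dev n a D + `|a ^+ D - m%:R|).
Proof.
have step_le1 j : `|j.+1%:R^-1 - j%:R^-1| <= 1 :> R.
  have := invr_nat_le1 R j; have := invr_nat_le1 R j.+1.
  have : 0 <= j%:R^-1 :> R by rewrite invr_ge0.
  have : 0 <= j.+1%:R^-1 :> R by rewrite invr_ge0.
  by rewrite ler_norml; move: (_^-1) (_^-1) => x y *; apply/andP; split; lra.
apply: (@le_trans _ _ (EG (fun G => q * (`|S D G - a ^+ D| + `|a ^+ D - m%:R|)))).
  apply: (le_expect e01) => G.
  apply: le_trans (binomial_expect_lipschitz q01 _ _ step_le1) _; rewrite mul1r.
  by rewrite ler_pM2l// -[X in `|X|](subrKA (a ^+ D)); exact: ler_normD.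
rewrite expectZ expectD expect_cst ler_pM2l// lerD2r.
exact: expect_layer_dev.
Qed.

Lemma expect_near_parent_sum_le :
  EG (fun G => near_parent_sum R r G D) <=
  n * (12 * n / a ^+ D.+1 + 2 * layer_dev n a D).
Proof.
rewrite (expect_sum_outside D (fun j => j%:R^-1)).
apply: (@le_trans _ _ (EG (fun G => n * (12 * n / a ^+ D.+1 +
    2 * `|S D G / a ^+ D - 1|)))); last first.
  by rewrite expectZ expectD expect_cst expectZ ler_pM2l// lerD2l ler_pM2l// expect_layer_rel_dev.
apply: (le_expect e01) => G; rewrite -/(inv_expect _).
have /andP[p0 p1] := inv_expect01 #|bfs_layer r G D|.
apply: ler_pM; rewrite ?ler_nat ?max_card//.
have t0 : 0 <= 12 * n / a ^+ D.+1 by rewrite !mulr_ge0 ?invr_ge0// ltW.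
have d0 : 0 <= `|S D G / a ^+ D - 1| by [].
have [d2|/half_layer_le S2] := leP 2^-1 `|S D G / a ^+ D - 1|; first by lra.
have S0 : 0 < S D G by apply: lt_le_trans S2; rewrite divr_gt0.
apply: ler_wpDr; first by rewrite mulr_ge0.
apply: (@le_trans _ _ (6 / (S D G * q))).
  apply: le_trans (binomial_expect_inv_le q01 _); last by rewrite mulr_gt0.
  apply: (le_binomial_expect q01) => -[|j]; first by rewrite invr0.
  by rewrite (maxn_idPr _).
rewrite ler_pdivrMr ?mulr_gt0//.
rewrite [leLHS](_ : 6 = 12 * n / a ^+ D.+1 * (a ^+ D / 2 * q)); last first.
  by rewrite exprS; move: (a ^+ D) (aX0 D) => z z0; field; rewrite !gt_eqF.
by rewrite ler_pM2l ?ler_pM2r// !mulr_gt0 ?invr_gt0.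
Qed.

Definition poorly_attached G (X : {set V}) : {set V} :=
  [set v in ~: (bfs_ball r G D :|: X) | (degree_in G X v)%:R < #|X|%:R * q / 2].

Lemma expect_card_poorly_attached (x : nat) :
  EG (fun G => #|poorly_attached G (first_vertices x (bfs_layer r G D.+1))|%:R) =
  EG (fun G => let X := first_vertices x (bfs_layer r G D.+1) in
    #|~: (bfs_ball r G D :|: X)|%:R *
    binomial_expect q #|X| (fun j => (j%:R < #|X|%:R * q / 2)%R%:R)).
Proof.
pose sel (L : {set V}) := first_vertices x L.
pose Psi (C L : {set V}) G : R := \sum_(v in ~: ((C :\: L) :|: sel L))
  ((degree_in G (sel L) v)%:R < #|sel L|%:R * q / 2)%R%:R.
rewrite (eq_expect _ (g := fun G => Psi (bfs_ball r G D.+1) (bfs_layer r G D.+1) G)).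
  rewrite (bfs_exposure q r D.+1 (Psi := Psi)) => [|C L G G' GG'].
    apply: eq_expect => G; rewrite /Psi bfs_ballD_layer.
    rewrite (@expect_sum_degree_in _ _ q _ _ (fun j => (j%:R < _)%R%:R))//.
    by rewrite disjoint_sym disjoints_subset setCK subsetUr.
  apply: eq_bigr => v; rewrite in_setC in_setU negb_or => /andP[vC _].
  by rewrite (degree_in_unexplored _ vC GG') ?first_vertices_sub.
move=> G; rewrite /Psi bfs_ballD_layer -sum1_card natr_sum.
rewrite big_mkcond [RHS]big_mkcond /=; apply: eq_bigr => v _.
by rewrite !inE; case: (_ || _) => //=; case: (_ < _).
Qed.

Lemma expect_card_poorly_attached_le (x : nat) (xi : R) :
  0 < xi -> xi <= x%:R -> xi <= n / (16 * w) ->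
  EG (fun G => #|poorly_attached G (first_vertices x (bfs_layer r G D.+1))|%:R) <=
  n * (4 / (xi * q) + small_layer_err n a w D).
Proof.
move=> xi0 xix xin; rewrite expect_card_poorly_attached.
apply: (@le_trans _ _ (EG (fun G => n * (4 / (xi * q) +
    (S D.+1 G < n / (16 * w))%R%:R)))); last first.
  by rewrite expectZ expectD expect_cst ler_pM2l// lerD2l prob_small_layer_le.
apply: (le_expect e01) => G /=; set X := first_vertices _ _.
apply: ler_pM; rewrite ?ler_nat ?max_card ?(binomial_expect_ge0 q01)//.
have t0 : 0 <= 4 / (xi * q) by rewrite divr_ge0 ?mulr_ge0// ltW.
case: (ltP (S D.+1 G)) => small.
  by rewrite ler_wpDl// (binomial_expect_le_cst q01)// => j; case: (_ < _).
have X0 : xi <= #|X|%:R.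
  by rewrite card_first_vertices /minn; case: ifP => // _; exact: le_trans small.
have Xp : 0 < #|X|%:R :> R by apply: lt_le_trans X0.
rewrite addr0; apply: le_trans (binomial_lower_tail q01 _) _; first by rewrite mulr_gt0.
by rewrite ler_pM2l// lef_pV2 ?posrE ?mulr_gt0// ler_pM2r.
Qed.

End typical_graph.

(** * Tail bounds for the overlap on a random graph *)

(* [1 + 9 x y <= (1 + 3 (x + y) / 2) ^ 2]. *)
Lemma ln_1D9M_le (R : realType) (x y : R) : 0 <= x -> 0 <= y ->
  ln (1 + 9 * (x * y)) <= 3 * (x + y).
Proof.
move=> x0 y0; have xy0 : 0 <= x * y by rewrite mulr_ge0.
rewrite -ler_expR lnK ?posrE ?ltr_pwDl ?mulr_ge0//.
have -> : 3 * (x + y) = 2 * (3 / 2 * (x + y)) by field.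
rewrite expRM_natl; apply: (@le_trans _ _ ((1 + 3 / 2 * (x + y)) ^+ 2)).
  have := sqr_ge0 (x - y).
  rewrite (_ : (1 + 3 / 2 * (x + y)) ^+ 2 = 1 + 3 * (x + y) + 9 * (x * y) +
    9 / 4 * (x - y) ^+ 2); last by field.
  lra.
have half0 : 0 <= 3 / 2 * (x + y) by rewrite mulr_ge0 ?addr_ge0// divr_ge0.
by rewrite lerXn2r ?nnegrE ?expR_ge0 ?expR_ge1Dx// addr_ge0.
Qed.

Lemma expRN_le_inv (R : realType) (x : R) : 0 < x -> expR (- x) <= x^-1.
Proof. by move=> x0; rewrite expRN lef_pV2 ?posrE ?expR_gt0// ge_id_expR. Qed.

Section detour_cost_bounds.
Variables (R : realType) (V : finType) (r : V) (G : {set {set V}}) (b : R).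
Local Notation C' := (component G r :\ r).
Local Notation eb := (expR (- b)).

Lemma detour_cost_ge0 : 0 <= detour_cost r G b.
Proof.
rewrite mulr_ge0// sumr_ge0// => v _; apply: ln_ge0.
by rewrite lerDl mulr_ge0 ?detour_ratio_ge0.
Qed.

Lemma sum_component_degree_le :
  \sum_(v in C') (degree G v)%:R <= \sum_v (degree G v)%:R :> R.
Proof. by rewrite [leRHS](bigID (mem C'))/= lerDl sumr_ge0. Qed.

Lemma detour_cost_le_degree : detour_cost r G b <= 18 * eb * \sum_v (degree G v)%:R.
Proof.
apply: (@le_trans _ _ (18 * eb * \sum_(v in C') (degree G v)%:R)); last first.
  by rewrite ler_wpM2l ?sum_component_degree_le// mulr_ge0 ?expR_ge0.
rewrite (_ : 18 * eb * _ = 2 * \sum_(v in C') (9 * eb * (degree G v)%:R)); last first.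
  by rewrite -mulr_sumr; ring.
rewrite ler_pM2l//; apply: ler_sum => v vC.
apply: (@le_trans _ _ (9 * detour_ratio r G b v)).
  by apply: le_ln1Dx; apply: (@lt_le_trans _ _ 0) => //; rewrite mulr_ge0 ?detour_ratio_ge0.
rewrite -mulrA ler_pM2l// mulrC ler_pdivrMr ?ltr0n ?parent_count_gt0//.
by rewrite ler_peMr ?mulr_ge0 ?expR_ge0// ler1n parent_count_gt0.
Qed.

Lemma detour_cost_le_amgm (K : R) : 0 < K ->
  detour_cost r G b <=
  6 * (eb / K * \sum_v (degree G v)%:R + K * inv_parent_sum R r G).
Proof.
move=> K0; have ebK0 : 0 <= eb / K by rewrite divr_ge0 ?expR_ge0// ltW.
apply: (@le_trans _ _
    (6 * (eb / K * \sum_(v in C') (degree G v)%:R + K * inv_parent_sum R r G))).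
  rewrite /detour_cost /inv_parent_sum !mulr_sumr -big_split /= mulr_sumr; apply: ler_sum => v vC.
  have n0 : 0 < (parent_count r G v)%:R :> R by rewrite ltr0n parent_count_gt0.
  have := @ln_1D9M_le R (eb / K * (degree G v)%:R) (K * (parent_count r G v)%:R^-1).
  rewrite (_ : eb / K * _ * (K * _) = detour_ratio r G b v); last first.
    by rewrite /detour_ratio; field; rewrite !gt_eqF.
  move=> /(_ (mulr_ge0 ebK0 _) (mulr_ge0 (ltW K0) _)) bound.
  rewrite (_ : 6 * _ = 2 * (3 * (eb / K * (degree G v)%:R +
    K * (parent_count r G v)%:R^-1))); last by ring.
  by rewrite ler_pM2l// bound// invr_ge0.
by rewrite ler_pM2l// lerD2r ler_wpM2l// sum_component_degree_le.
Qed.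

End detour_cost_bounds.

(* The exponential rate, per vertex, of the tail bound given by the displaced
   comparison trees. *)
Definition displaced_rate (R : realType) (n a eps t xi eta K : R) : R :=
  - (t * eps / 2) + ln (8 * (2 * n / xi) ^+ 2) +
  4 * eta * ln (8 * expR t * a ^+ 2) + 2 * K.

Section random_graph.
Variables (R : realType) (V : finType) (r : V) (q b : R).
Implicit Types (G T : {set {set V}}).
Local Notation EG := (expect (@edge_prob R V q)).
Local Notation PG := (prob (@edge_prob R V q)).
Local Notation n := (#|V|%:R : R).
Local Notation a := (n * q).

Lemma replica_probE (E : {set {set V}} -> {set {set V}} -> {set {set V}} -> bool) :
  replica_prob q b r E = EG (fun G => gibbs_pair_prob b G r (E G)).
Proof. by apply: eq_bigr => G _; rewrite erdos_renyiE. Qed.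

Section replica_probability.
Hypothesis q01 : 0 <= q <= 1.
Variable E : {set {set V}} -> {set {set V}} -> {set {set V}} -> bool.
Let e01 := @edge_prob01 R V q q01.

Lemma replica_prob_ge0 : 0 <= replica_prob q b r E.
Proof.
rewrite replica_probE; apply: (expect_ge0 e01) => G.
exact: gibbs_pair_prob_ge0.
Qed.

Lemma le_replica_prob (E' : {set {set V}} -> {set {set V}} -> {set {set V}} -> bool) :
  (forall G T T', E G T T' -> E' G T T') ->
  replica_prob q b r E <= replica_prob q b r E'.
Proof.
move=> EE'; rewrite !replica_probE; apply: (le_expect e01) => G.
by apply: le_gibbs_pair_prob => T T' _ _; exact: EE'.
Qed.

Lemma replica_prob_le (good : {set {set V}} -> bool) (p : R) : 0 <= p ->
  (forall G, G \subset all_edges V -> good G -> gibbs_pair_prob b G r (E G) <= p) ->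
  replica_prob q b r E <= PG (fun G => ~~ good G) + p.
Proof.
move=> p0 good_le; rewrite -[X in _ <= _ + X](expect_cst (@edge_prob R V q)) -expectD.
apply: ler_sum => G _; rewrite erdos_renyiE.
have [GE|GE] := boolP (G \subset all_edges V); last first.
  by rewrite -erdos_renyiE /erdos_renyi (negbTE GE) !mul0r.
apply: ler_wpM2l; first exact: (bernoulli_weight_ge0 e01).
rewrite -/(gibbs_pair_prob _ _ _ _).
have [gG|gG] /= := boolP (good G); first by rewrite add0r good_le.
by apply: le_trans (gibbs_pair_prob_le1 _ _ _ _) _; rewrite lerDl.
Qed.

End replica_probability.

Section bfs_regime.
Variables (w c eps : R) (D : nat).
Hypothesis b0 : 0 <= b.
Hypothesis reg : sparse_regime n q w D.
Hypothesis c01 : 0 <= c <= 1.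
Hypothesis eps01 : 0 < eps <= 1.

Let q01 : 0 <= q <= 1 := regime_q01 reg.
Let e01 := @edge_prob01 R V q q01.
Let n0 : 0 < n. Proof. by rewrite ltr0n; apply/card_gt0P; exists r. Qed.

Definition bfs_error G : R :=
  `|inv_parent_sum R r G - c * n| + (1 + far_parent_sum R r G D) + detour_cost r G b.

Lemma bfs_error_ge0 G : 0 <= bfs_error G.
Proof. by rewrite !addr_ge0 ?far_parent_sum_ge0 ?detour_cost_ge0. Qed.

Lemma overlap_tail_bfs_error G : G \subset all_edges V ->
  bfs_error G < eps ^+ 2 / 64 * n ->
  gibbs_pair_prob b G r (fun T T' => eps < `|overlap R r T T' - c|) <=
  2 * expR (- (eps ^+ 2 / 32 * n)).
Proof.
move=> GE; rewrite /bfs_error => err; have /andP[e0 e1] := eps01; have /andP[c0 c1] := c01.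
set N : R := #|component G r :\ r|%:R; set M := inv_parent_sum R r G in err *.
have far0 := far_parent_sum_ge0 R r G D; have cost0 := detour_cost_ge0 r G b.
have missing : n - N <= 1 + far_parent_sum R r G D by exact: card_component_ge.
have Nn : N <= n by rewrite ler_nat max_card.
have ee : eps ^+ 2 <= 1 by rewrite exprn_ile1// ltW.
have een : eps ^+ 2 * n <= n by rewrite ler_piMl// ltW.
have dev0 := normr_ge0 (M - c * n).
have N2 : eps ^+ 2 * (n / 2) <= eps ^+ 2 * N by rewrite ler_wpM2l ?sqr_ge0//; lra.
have devN : `|M - c * N| <= `|M - c * n| + (1 + far_parent_sum R r G D).
  rewrite -[X in `|X|](subrKA (c * n)); apply: le_trans (ler_normD _ _) _.
  rewrite lerD2l -mulrBr ger0_norm; last by rewrite mulr_ge0// subr_ge0.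
  by apply: le_trans missing; rewrite ler_piMl// subr_ge0.
have dev4 : eps / 4 * `|M - c * N| <= `|M - c * N| by rewrite ler_piMl//; lra.
apply: le_trans (overlap_tail_bfs_le r GE b0 c eps (t := eps / 4) _) _.
  by apply/andP; split; lra.
rewrite ler_pM2l// ler_expR -/N -/M.
have -> : eps / 4 * eps * N = eps ^+ 2 * N / 4 by field.
have -> : 2 * (eps / 4) ^+ 2 * N = eps ^+ 2 * N / 8 by field.
move: err N2; have -> : eps ^+ 2 / 64 * n = eps ^+ 2 * n / 64 by field.
have -> : eps ^+ 2 / 32 * n = eps ^+ 2 * n / 32 by field.
by rewrite mulrA; move: devN dev4 far0; lra.
Qed.

Lemma replica_prob_bfs_le (dev_err cost_err : R) :
  EG (fun G => `|inv_parent_sum R r G - c * n|) <= n * dev_err ->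
  EG (fun G => detour_cost r G b) <= n * cost_err ->
  replica_prob q b r (fun _ T T' => eps < `|overlap R r T T' - c|) <=
  64 / eps ^+ 2 * (dev_err + 2 * n^-1 + far_err n a w D + cost_err).
Proof.
move=> dev_le cost_le; have /andP[e0 _] := eps01; have e2 : 0 < eps ^+ 2 by rewrite exprn_gt0.
have k0 : 0 < eps ^+ 2 / 64 * n by rewrite mulr_gt0// divr_gt0.
have tail0 : 0 <= 2 * expR (- (eps ^+ 2 / 32 * n)) by rewrite mulr_ge0 ?expR_ge0.
apply: le_trans (replica_prob_le q01 tail0 (fun G => @overlap_tail_bfs_error G)) _.
rewrite (_ : 64 / eps ^+ 2 * _ = (n * dev_err + (1 + n * far_err n a w D) + n * cost_err) /
    (eps ^+ 2 / 64 * n) + 2 * (eps ^+ 2 / 32 * n)^-1); last first.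
  by field; rewrite !gt_eqF.
apply: lerD; last by rewrite ler_pM2l// expRN_le_inv// mulr_gt0// divr_gt0.
apply: (@le_trans _ _ (PG (fun G => eps ^+ 2 / 64 * n <= bfs_error G))).
  by apply: (le_prob e01) => G; rewrite -leNgt.
apply: le_trans (prob_markov e01 k0 bfs_error_ge0) _.
rewrite ler_pM2r ?invr_gt0// !expectD expect_cst.
by apply: lerD => //; apply: lerD => //; rewrite lerD2l expect_far_parent_sum_le.
Qed.

End bfs_regime.

Section parent_expectation.
Variables (w : R) (D : nat).
Hypothesis reg : sparse_regime n q w D.
Let q01 : 0 <= q <= 1 := regime_q01 reg.
Let a4 : 4 <= a := regime_degree reg.
Let e01 := @edge_prob01 R V q q01.
Let n0 : 0 < n. Proof. by rewrite ltr0n; apply/card_gt0P; exists r. Qed.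

Lemma inv_parent_sum_dev_le G (c x y : R) :
  `|inv_parent_sum R r G - c * n| <=
  `|near_parent_sum R r G D - n * x| + (n * `|x - y| + (n * `|y - c| +
     (#|bfs_ball r G D|%:R + far_parent_sum R r G D))).
Proof.
have lower := inv_parent_sum_ge R r G D.
have upper := inv_parent_sum_le_near_far R r G D.
set M := inv_parent_sum R r G in lower upper *; set A := near_parent_sum R r G D in lower upper *.
have -> : M - c * n = (A - n * x) + (n * (x - y) + (n * (y - c) + (M - A))) by ring.
apply: le_trans (ler_normD _ _) _; rewrite lerD2l.
apply: le_trans (ler_normD _ _) _; rewrite normrM (ger0_norm (ltW n0)) lerD2l.
apply: le_trans (ler_normD _ _) _; rewrite normrM (ger0_norm (ltW n0)) lerD2l.
by rewrite ger0_norm ?subr_ge0// lerBlDl addrA.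
Qed.

Lemma expect_inv_parent_sum_dev (c : R) (m : nat) :
  EG (fun G => `|inv_parent_sum R r G - c * n|) <=
  n * ((Num.sqrt n)^-1 + 4 * a ^+ D / n +
    q * (a ^+ D * layer_dev n a D + `|a ^+ D - m%:R|) +
    `|binomial_expect q m (fun j => j%:R^-1) - c| + far_err n a w D).
Proof.
pose phi s : R := binomial_expect q s (fun j => j%:R^-1).
apply: le_trans (le_expect e01 (fun G =>
  inv_parent_sum_dev_le G c (phi #|bfs_layer r G D|) (phi m))) _.
rewrite !expectD !expectZ expect_cst.
have near_le : EG (fun G => `|near_parent_sum R r G D - n * phi #|bfs_layer r G D| |) <=
    Num.sqrt n + 2 * a ^+ D by exact: (expect_near_parent_sum_dev r reg).
have layer_le : n * EG (fun G => `|phi #|bfs_layer r G D| - phi m|) <=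
    n * (q * (a ^+ D * layer_dev n a D + `|a ^+ D - m%:R|)).
  by rewrite ler_pM2l//; exact: (expect_inv_layer_dev r reg).
have ball_le := expect_ball_le q01 r a4 D; have far_le := expect_far_parent_sum_le r reg.
have sn : n * (Num.sqrt n)^-1 = Num.sqrt n.
  by rewrite -{1}(sqr_sqrtr (ltW n0)) expr2 mulfK// gt_eqF// sqrtr_gt0.
have an : n * (4 * a ^+ D / n) = 4 * a ^+ D by field; exact: lt0r_neq0.
rewrite -/(phi m); move: (far_err _ _ _ _) far_le => far far_le.
rewrite !(mulrDr n) sn an; move: near_le layer_le ball_le far_le.
move: (EG _) (EG _) (EG _) (EG _) => x1 x2 x3 x4; lra.
Qed.

Lemma expect_inv_parent_sum_le :
  EG (fun G => inv_parent_sum R r G) <=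
  n * (12 * n / a ^+ D.+1 + 2 * layer_dev n a D + 2 * a ^+ D / n + far_err n a w D).
Proof.
apply: le_trans (le_expect e01 (fun G => inv_parent_sum_le_near_far R r G D)) _.
rewrite !expectD.
have near_le := expect_near_parent_sum_le r reg; have ball_le := expect_ball_le q01 r a4 D.
have far_le := expect_far_parent_sum_le r reg.
have an : n * (2 * a ^+ D / n) = 2 * a ^+ D by field; exact: lt0r_neq0.
rewrite mulrDr [n * (_ + 2 * _ / n)]mulrDr an; move: near_le ball_le far_le.
move: (EG _) (EG _) (EG _) => x1 x2 x3; lra.
Qed.

End parent_expectation.

Section displaced_regime.
Variables (D x : nat) (w eps t xi eta K : R).
Hypothesis b0 : 0 <= b.
Hypothesis reg : sparse_regime n q w D.
Hypothesis eps0 : 0 < eps.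
Hypothesis t0 : 0 <= t.
Hypothesis ta : expR t <= a.
Hypothesis xi0 : 0 < xi.
Hypothesis xi_x : xi <= x%:R.
Hypothesis xi_n : xi <= n / (16 * w).
Hypothesis eta0 : 0 < eta.
Hypothesis eta4 : eta <= 4^-1.
Hypothesis x_eta : x%:R <= eta * n.
Hypothesis K0 : 0 < K.

Let q01 : 0 <= q <= 1 := regime_q01 reg.
Let a4 : 4 <= a := regime_degree reg.
Let e01 := @edge_prob01 R V q q01.
Let n0 : 0 < n. Proof. by rewrite ltr0n; apply/card_gt0P; exists r. Qed.
Let a0 : 0 < a. Proof. exact: lt_le_trans a4. Qed.
Let q0 : 0 < q. Proof. by rewrite -(pmulr_rgt0 _ n0). Qed.
Let w0 : 0 < w. Proof. exact: lt_le_trans (regime_w reg). Qed.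

Definition target_vertices G : {set V} := first_vertices x (bfs_layer r G D.+1).

Definition bad_vertices G : R :=
  #|bfs_ball r G D|%:R + #|poorly_attached r q D G (target_vertices G)|%:R.

Definition large_layer G : bool := n / (16 * w) <= #|bfs_layer r G D.+1|%:R.

Definition cheap_or_small_layer G : bool :=
  (expR t * expR b <= a) || (#|bfs_layer r G D.+1| <= x)%N.

Definition few_edges G : bool := \sum_v (degree G v)%:R < K * (n * a).

Lemma card_target_ge G : large_layer G -> xi <= #|target_vertices G|%:R.
Proof.
move=> large; rewrite card_first_vertices /minn; case: ifP => // _.
exact: le_trans large.
Qed.

Lemma card_irregular_le G : bad_vertices G < eta * n ->
  #|~: regular_vertices r G D (target_vertices G)
        (#|target_vertices G|%:R * q / 2)|%:R <= 2 * eta * n.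
Proof.
rewrite /bad_vertices; set X := target_vertices G => bad.
have X_le : #|X|%:R <= eta * n.
  by apply: le_trans x_eta; rewrite ler_nat card_first_vertices geq_minl.
have cover : (#|~: regular_vertices r G D X (#|X|%:R * q / 2)| <=
    #|bfs_ball r G D| + #|X| + #|poorly_attached r q D G X|)%N.
  apply: (@leq_trans #|bfs_ball r G D :|: X :|: poorly_attached r q D G X|%N).
    apply: subset_leq_card; apply/subsetP => v; rewrite !in_setU !inE.
    by case: (v \in bfs_ball r G D) => //=; case: (v \in take _ _) => //=; rewrite -ltNge.
  by apply: leq_trans (leq_card_setU _ _) _; rewrite leq_add// leq_card_setU.
by move: cover; rewrite -(ler_nat R) !natrD; lra.
Qed.

Lemma overlap_tail_displaced_good G : G \subset all_edges V ->
  [&& bad_vertices G < eta * n, large_layer G, cheap_or_small_layer G & few_edges G] ->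
  gibbs_pair_prob b G r (fun T T' => eps < `|overlap R r T T' - 0|) <=
  expR (n * displaced_rate n a eps t xi eta K).
Proof.
move=> GE /and4P[/card_irregular_le irregular_le large cheap few].
set X := target_vertices G in irregular_le *.
have XL : X \subset bfs_layer r G D.+1 by exact: first_vertices_sub.
have X_ge : xi <= #|X|%:R by exact: card_target_ge.
have X0 : 0 < #|X|%:R :> R by exact: lt_le_trans X_ge.
pose y : R := #|X|%:R * q / 2; have y0 : 0 < y by rewrite !mulr_gt0 ?invr_gt0.
have aQ : a <= 2 * n / xi * y.
  rewrite (_ : _ * y = a * (#|X|%:R / xi)); last by rewrite /y; field; rewrite gt_eqF.
  by rewrite ler_peMr ?(ltW a0)// ler_pdivlMr// mul1r.
have Q1 : 1 <= 2 * n / xi.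
  rewrite ler_pdivlMr// mul1r; apply: le_trans xi_n _.
  rewrite ler_pdivrMr ?mulr_gt0//; have := regime_w reg; have := n0; nra.
have a1 : 1 <= a by apply: le_trans a4; rewrite ler1n.
have cheap_or_whole_layer : expR t * expR b <= a \/ X = bfs_layer r G D.+1.
  case/orP: cheap => [?|small]; [by left|right; apply/eqP].
  by rewrite eqEcard XL card_first_vertices leq_min leqnn andbT.
apply: le_trans (overlap_tail_displaced_le GE b0 XL y0 a1 aQ Q1 t0 ta cheap_or_whole_layer eps) _.
rewrite ler_expR; set Y := regular_vertices r G D X y in irregular_le *.
set N : R := #|component G r :\ r|%:R.
have YN : #|Y|%:R <= N.
  by rewrite ler_nat; apply: subset_leq_card; exact: regular_component XL y0.
have N2 : n / 2 <= N.
  have nY : n = #|Y|%:R + #|~: Y|%:R by rewrite -natrD cardsC.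
  have : eta * n <= 4^-1 * n by rewrite ler_pM2r.
  lra.
have L0 : 0 <= ln (8 * expR t * a ^+ 2).
  apply: ln_ge0; have : 1 <= expR t by rewrite -expR0 ler_expR.
  have : 1 <= a ^+ 2 by rewrite exprn_ege1.
  by move: (expR t) (a ^+ 2) => u v *; nra.
have gain : t * eps * (n / 2) <= t * eps * N by rewrite ler_wpM2l// mulr_ge0// ltW.
have irregular_loss : #|~: Y|%:R * ln (8 * expR t * a ^+ 2) <=
    2 * eta * n * ln (8 * expR t * a ^+ 2) by rewrite ler_wpM2r.
have degree_loss : (\sum_v (degree G v)%:R) / a <= K * n.
  by rewrite ler_pdivrMr// -mulrA ltW.
by rewrite /displaced_rate; lra.
Qed.

Lemma prob_bad_vertices_le :
  PG (fun G => ~~ (bad_vertices G < eta * n)) <=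
  (2 * a ^+ D / n + 4 / (xi * q) + small_layer_err n a w D) / eta.
Proof.
have en0 : 0 < eta * n by rewrite mulr_gt0.
apply: (@le_trans _ _ (PG (fun G => eta * n <= bad_vertices G))).
  by apply: (le_prob e01) => G; rewrite -leNgt.
apply: le_trans (prob_markov e01 en0 _) _; first by move=> G; rewrite addr_ge0.
rewrite expectD ler_pdivrMr//.
rewrite (_ : _ / eta * (eta * n) = 2 * a ^+ D +
    n * (4 / (xi * q) + small_layer_err n a w D)); last first.
  by field; rewrite !gt_eqF// ?mulr_gt0.
apply: lerD; first exact: expect_ball_le.
exact: expect_card_poorly_attached_le.
Qed.

Lemma prob_many_edges_le : PG (fun G => ~~ few_edges G) <= K^-1.
Proof.
have Kna : 0 < K * (n * a) by rewrite !mulr_gt0.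
apply: (@le_trans _ _ (PG (fun G => K * (n * a) <= \sum_v (degree G v)%:R))).
  by apply: (le_prob e01) => G; rewrite -leNgt.
apply: le_trans (prob_markov e01 Kna _) _; first by move=> G; rewrite sumr_ge0.
rewrite ler_pdivrMr// [leRHS]mulrA mulVf ?mul1r ?gt_eqF//.
exact: expect_sum_degree.
Qed.

Lemma prob_cheap_displacement : expR t * expR b <= a ->
  PG (fun G => ~~ cheap_or_small_layer G) = 0.
Proof.
move=> cheap; rewrite -[RHS](@expect_cst R _ (@edge_prob R V q) 0); apply: eq_expect => G.
by rewrite /cheap_or_small_layer cheap.
Qed.

Lemma prob_large_layer_le : (0 < x)%N ->
  PG (fun G => ~~ cheap_or_small_layer G) <= a ^+ D.+1 / x%:R.
Proof.
move=> x0; have x0' : 0 < x%:R :> R by rewrite ltr0n.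
apply: (@le_trans _ _ (PG (fun G => x%:R <= #|bfs_layer r G D.+1|%:R :> R))).
  apply: (le_prob e01) => G; rewrite negb_or -ltnNge => /andP[_ /ltnW].
  by rewrite ler_nat.
apply: le_trans (prob_markov e01 x0' _) _ => //.
by rewrite ler_pM2r ?invr_gt0// expect_layer_le.
Qed.

Lemma replica_prob_displaced_le (overflow : R) :
  PG (fun G => ~~ cheap_or_small_layer G) <= overflow ->
  replica_prob q b r (fun _ T T' => eps < `|overlap R r T T' - 0|) <=
  (2 * a ^+ D / n + 4 / (xi * q) + small_layer_err n a w D) / eta +
  small_layer_err n a w D + overflow + K^-1 +
  expR (n * displaced_rate n a eps t xi eta K).
Proof.
move=> overflow_le.
apply: le_trans (replica_prob_le q01 (expR_ge0 _) (fun G => @overlap_tail_displaced_good G)) _.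
rewrite lerD2r.
have bad_le := prob_bad_vertices_le; have edges_le := prob_many_edges_le.
have small_le : PG (fun G => ~~ large_layer G) <= small_layer_err n a w D.
  apply: le_trans (prob_small_layer_le r reg).
  by apply: (le_prob e01) => G; rewrite -ltNge.
apply: (@le_trans _ _ (PG (fun G => ~~ (bad_vertices G < eta * n) ||
    (~~ large_layer G || (~~ cheap_or_small_layer G || ~~ few_edges G))))).
  by apply: (le_prob e01) => G; rewrite !negb_and.
apply: le_trans (prob_or_le e01 _ _) _; rewrite -[leRHS]addrA -[leRHS]addrA.
apply: lerD => //; apply: le_trans (prob_or_le e01 _ _) _; apply: lerD => //.
by apply: le_trans (prob_or_le e01 _ _) _; apply: lerD.
Qed.

End displaced_regime.
End random_graph.

(** * The Poisson limit *)

Section poisson_limit.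
Variable R : realType.
Implicit Types (g : nat -> R) (mu : R).
Local Open Scope classical_set_scope.

Section nat_probability.
Variable P : probability nat R.
Variable g : nat -> R.
Hypothesis g_bounded : bounded_fun g.

Lemma integrable_bounded_nat (A : set nat) : P.-integrable A (EFin \o g).
Proof.
apply: measurable_bounded_integrable => //.
  by rewrite (le_lt_trans (probability_le1 _ _)) ?ltry.
have [M [Mreal gM]] := g_bounded.
by exists M; split => // x Mx k _; exact: gM.
Qed.

Lemma Rintegral_nat_split J : \int[P]_k g k =
  \sum_(j < J) fine (P [set (j : nat)]) * g j + \int[P]_(k in [set k | (J <= k)%N]) g k.
Proof.
elim: J => [|J IH].
  rewrite big_ord0 add0r; congr (Rintegral _ _ _).
  by apply/seteqP; split.
rewrite IH [in RHS]big_ord_recr /= -addrA; congr (_ + _).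
have -> : [set k | (J <= k)%N] = [set J] `|` [set k | (J < k)%N].
  apply/seteqP; split=> k /=; first by rewrite leq_eqVlt => /orP[/eqP <-|]; [left|right].
  by case=> [->//|]; exact: ltnW.
rewrite Rintegral_setU//; first last.
- by apply/disj_setPS => k [/= ->]; rewrite ltnn.
- exact: integrable_bounded_nat.
congr (_ + _); rewrite (@eq_Rintegral _ _ _ _ _ (cst (g J))).
  by rewrite Rintegral_cst// mulrC.
by move=> k /set_mem /= ->.
Qed.

Lemma Rintegral_nat_truncate J M : (forall j, (J <= j)%N -> `|g j| <= M) -> 0 <= M ->
  `|\int[P]_k g k - \sum_(j < J) fine (P [set (j : nat)]) * g j| <= M.
Proof.
move=> gM M0; rewrite (Rintegral_nat_split J) addrC addKr.
apply: le_trans (le_normr_Rintegral _ (integrable_bounded_nat _)) _ => //.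
apply: (@le_trans _ _ (\int[P]_(k in [set k | (J <= k)%N]) (cst M) k)).
  apply: le_Rintegral => //; first exact/integrable_norm/integrable_bounded_nat.
  exact: finite_measure_integrable_cst.
rewrite Rintegral_cst// ler_piMr//.
by rewrite -lee_fin fineK ?fin_num_measure// probability_le1.
Qed.

End nat_probability.

Section binomial_asymptotics.
Variables (mu : R) (q : nat -> R) (m : nat -> nat).
Hypothesis q_cvg0 : q x @[x --> \oo] --> (0 : R).
Hypothesis mq_cvg : (m x)%:R * q x @[x --> \oo] --> mu.

Lemma cvg_subn_mul i : (m x - i)%:R * q x @[x --> \oo] --> mu.
Proof.
rewrite -[mu]subr0; have -> : (fun x => (m x - i)%:R * q x) =
    (fun x => (m x)%:R * q x - (minn i (m x))%:R * q x).
  by apply/funext => x; rewrite -mulrBl -natrB ?geq_minr//; congr (_%:R * _); lia.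
apply: cvgB => //; apply/norm_cvg0P.
apply: (@squeeze_cvgr _ _ _ _ (fun=> 0) (fun x => i%:R * `|q x|)).
- apply: nearW => x; rewrite normr_ge0 normrM ler_wpM2r// ger0_norm// ler_nat.
  exact: geq_minl.
- exact: cvg_cst.
- rewrite -(mulr0 i%:R); apply: cvgM; first exact: cvg_cst.
  exact/norm_cvg0P.
Qed.

(* [expR (- m q / (1 - q)) <= (1 - q) ^ m <= expR (- m q)]. *)
Lemma cvg_expr_1B : (1 - q x) ^+ m x @[x --> \oo] --> expR (- mu).
Proof.
have q1_cvg : 1 - q x @[x --> \oo] --> (1 : R).
  by rewrite -[X in _ --> X](subr0 1); apply: cvgB => //; exact: cvg_cst.
apply: (@squeeze_cvgr _ _ _ _ (fun x => expR (- ((m x)%:R * q x / (1 - q x))))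
  (fun x => expR (- ((m x)%:R * q x)))).
- near=> x; have q1 : 0 < 1 - q x.
    by rewrite subr_gt0; near: x; exact: cvgr_lt q_cvg0 _ ltr01.
  rewrite -mulrN -mulrA -mulrN !expRM_natl !lerXn2r ?nnegrE ?expR_ge0 ?expR_ge1Dx ?(ltW q1)//.
  rewrite mulrN expRN -[leRHS]invrK lef_pV2 ?posrE ?invr_gt0 ?expR_gt0//.
  apply: le_trans (expR_ge1Dx _); rewrite le_eqVlt; apply/orP; left.
  by apply/eqP; field; rewrite gt_eqF.
- have lower : - ((m x)%:R * q x / (1 - q x)) @[x --> \oo] --> - mu.
    apply: cvgN; rewrite -[X in _ --> X]divr1; apply: cvgM => //.
    by apply: cvgV => //; exact: oner_neq0.
  exact: (cvg_comp _ _ lower (@continuous_expR R (- mu))).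
- exact: (cvg_comp _ _ (cvgN mq_cvg) (@continuous_expR R (- mu))).
Unshelve. all: by end_near. Qed.

End binomial_asymptotics.

Lemma natr_bin (n j : nat) : 'C(n, j)%:R = (\prod_(i < j) (n - i)%:R) / j`!%:R :> R.
Proof.
have f0 : j`!%:R != 0 :> R by rewrite pnatr_eq0 -lt0n fact_gt0.
by apply: (mulIf f0); rewrite divfK// -natrM bin_ffact ffact_prod natr_prod.
Qed.

Lemma cvg_binomial_pmf mu (q : nat -> R) (m : nat -> nat) j : 0 < mu ->
  q x @[x --> \oo] --> (0 : R) -> (m x)%:R * q x @[x --> \oo] --> mu ->
  binomial_pmf (m x) (q x) j @[x --> \oo] --> poisson_pmf mu j.
Proof.
move=> mu0 q0 mq; rewrite /poisson_pmf mu0.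
have -> : (fun x => binomial_pmf (m x) (q x) j) =
    (fun x => (\prod_(i < j) ((m x - i)%:R * q x)) * j`!%:R^-1 * (1 - q x) ^+ (m x - j)).
  apply/funext => x; rewrite /binomial_pmf /unstable.onem -mulr_natl natr_bin.
  by rewrite big_split /= prodr_const card_ord mulrA [_ / _ * _]mulrAC.
apply: cvgM; last exact: cvg_expr_1B (cvg_subn_mul q0 mq j).
apply: cvgM; last exact: cvg_cst.
rewrite -[X in mu ^+ X](card_ord j) -prodr_const.
by apply: cvg_big => [|i _]; [exact: mul_continuous|exact: cvg_subn_mul].
Qed.

Lemma poisson_prob_set1 mu j : 0 < mu -> fine (poisson_prob mu 0 [set j]) = poisson_pmf mu j.
Proof. by move=> mu0; rewrite /poisson_prob mu0 esum_set1// lee_fin poisson_pmf_ge0. Qed.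

Lemma cvg_binomial_expect_poisson mu (q : nat -> R) (m : nat -> nat) g : 0 < mu ->
  (\forall x \near \oo, 0 <= q x) -> q x @[x --> \oo] --> (0 : R) ->
  (m x)%:R * q x @[x --> \oo] --> mu -> g j @[j --> \oo] --> (0 : R) ->
  binomial_expect (q x) (m x) g @[x --> \oo] --> \int[poisson_prob mu 0]_k g k.
Proof.
move=> mu0 q_ge0 q0 mq g0; apply/cvgrPdist_le => e e0.
have e3 : 0 < e / 3 by rewrite divr_gt0.
have [J _ gJ] : \forall j \near \oo, `|g j| <= e / 3 by move/cvgr0Pnorm_le: g0; exact.
have g_bounded : bounded_fun g by apply: cvg_seq_bounded; apply/cvg_ex; exists 0.
have poisson_trunc := Rintegral_nat_truncate (poisson_prob mu 0) g_bounded gJ (ltW e3).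
have sum_cvg : \sum_(j < J) binomial_pmf (m x) (q x) j * g j @[x --> \oo] -->
    \sum_(j < J) fine (poisson_prob mu 0 [set (j : nat)]) * g j.
  apply: cvg_big => [|j _]; first exact: add_continuous.
  by rewrite poisson_prob_set1//; apply: cvgM; [exact: cvg_binomial_pmf|exact: cvg_cst].
near=> x.
have q01 : 0 <= q x <= 1.
  by apply/andP; split; near: x; [exact: q_ge0|exact: cvgr_le q0 _ ltr01].
have binomial_trunc := binomial_expect_truncate q01 (m x) gJ (ltW e3).
have sum_close : `|\sum_(j < J) fine (poisson_prob mu 0 [set (j : nat)]) * g j -
    \sum_(j < J) binomial_pmf (m x) (q x) j * g j| <= e / 3.
  by near: x; move/cvgrPdist_le: sum_cvg; exact.
move: poisson_trunc binomial_trunc sum_close; rewrite [in X in _ -> X -> _]distrC.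
set s := \sum_(j < J) fine _ * _; set s' := \sum_(j < J) _ * _.
move: (Rintegral _ _ _) (binomial_expect _ _ _) => y z trunc trunc' close.
have -> : y - z = (y - s) + ((s - s') + (s' - z)) by ring.
apply: le_trans (ler_normD _ _) _; have -> : e = e / 3 + (e / 3 + e / 3) by field.
by apply: lerD => //; apply: le_trans (ler_normD _ _) _; exact: lerD.
Unshelve. all: by end_near. Qed.

Section f_overlap.
Variable lambda : R.
Hypothesis lambda01 : 0 < lambda < 1.
Local Notation mu := (ln lambda^-1).

Lemma ln_inv_gt0 : 0 < mu.
Proof. by case/andP: lambda01 => l0 l1; rewrite ln_gt0// invf_gt1. Qed.

Lemma cvg_invr_nat : j%:R^-1 @[j --> \oo] --> (0 : R).
Proof.
apply/gtr0_cvgV0; last exact: cvgr_idn.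
by exists 1%N => // j /=; rewrite ltr0n.
Qed.

Lemma poisson_prob_gt0 :
  fine (poisson_prob mu 0 [set k : nat | (0 < k)%N]) = 1 - lambda.
Proof.
have mu0 := ln_inv_gt0; have -> : [set k : nat | (0 < k)%N] = ~` [set 0%N].
  by apply/seteqP; split=> k /=; rewrite lt0n => /eqP.
rewrite probability_setC// fineB ?fin_num_measure// poisson_prob_set1//.
rewrite /poisson_pmf mu0 expr0 fact0 invr1 !mul1r.
by case/andP: lambda01 => l0 _; rewrite lnV ?posrE// opprK lnK.
Qed.

Lemma f_overlapE : f_overlap lambda = \int[poisson_prob mu 0]_k k%:R^-1.
Proof.
have inv_bounded : bounded_fun (fun k => k%:R^-1 : R).
  by apply: cvg_seq_bounded; apply/cvg_ex; exists 0; exact: cvg_invr_nat.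
rewrite /f_overlap /cond_expectation poisson_prob_gt0 mulrC divfK; last first.
  by case/andP: lambda01 => _ l1; rewrite subr_eq0 gt_eqF.
by rewrite (Rintegral_nat_split _ inv_bounded 1) big_ord1 invr0 mulr0 add0r.
Qed.

Lemma f_overlap01 : 0 <= f_overlap lambda <= 1.
Proof.
rewrite f_overlapE; apply/andP; split.
  by apply: Rintegral_ge0 => k _; rewrite invr_ge0.
have inv_bounded : bounded_fun (fun k => k%:R^-1 : R).
  by apply: cvg_seq_bounded; apply/cvg_ex; exists 0; exact: cvg_invr_nat.
have := Rintegral_nat_truncate (poisson_prob mu 0) inv_bounded (J := 0) (M := 1).
rewrite big_ord0 subr0 => trunc; apply: le_trans (ler_norm _) (trunc _ ler01) => j _.
by rewrite ger0_norm ?invr_ge0// invr_nat_le1.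
Qed.

End f_overlap.
End poisson_limit.

(** * Asymptotics *)

Section limits.
Variable R : realType.
Implicit Types u v : nat -> R.
Local Open Scope classical_set_scope.

Lemma near_succ (P : nat -> Prop) : (\forall n \near \oo, P n) ->
  \forall m \near \oo, P m.+1.
Proof. by move=> [N _ NP]; exists N => // m /= Nm; apply: NP; exact: leqW. Qed.

Lemma cvg0D u v : u n @[n --> \oo] --> (0 : R) -> v n @[n --> \oo] --> (0 : R) ->
  u n + v n @[n --> \oo] --> (0 : R).
Proof. by move=> u0 v0; rewrite -[X in _ --> X](addr0 0); exact: cvgD. Qed.

Lemma cvg0Z (k : R) u : u n @[n --> \oo] --> (0 : R) ->
  k * u n @[n --> \oo] --> (0 : R).
Proof. by move=> u0; rewrite -[X in _ --> X](mulr0 k); apply: cvgM => //; exact: cvg_cst. Qed.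

Lemma cvg0Z_div (k : R) u v : u n / v n @[n --> \oo] --> (0 : R) ->
  k * u n / v n @[n --> \oo] --> (0 : R).
Proof. by move=> uv0; under eq_fun do rewrite -mulrA; exact: cvg0Z. Qed.

Lemma squeeze_cvg0 u v : (\forall n \near \oo, 0 <= u n <= v n) ->
  v n @[n --> \oo] --> (0 : R) -> u n @[n --> \oo] --> (0 : R).
Proof. by move=> uv; apply: (squeeze_cvgr uv); exact: cvg_cst. Qed.

Lemma cvg0_of_le_add u : (\forall n \near \oo, 0 <= u n) ->
  (forall e, 0 < e -> exists2 v, v n @[n --> \oo] --> (0 : R) &
     \forall n \near \oo, u n <= e + v n) ->
  u n @[n --> \oo] --> (0 : R).
Proof.
move=> u_ge0 u_le; apply/cvgrPdist_le => e e0.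
have e2 : 0 < e / 2 by rewrite divr_gt0.
have [v v0 uv] := u_le _ e2.
have v_le : \forall n \near \oo, v n <= e / 2 by exact: cvgr_le v0 _ e2.
apply: filterS3 u_ge0 uv v_le => n un0 unv vn.
by rewrite sub0r normrN ger0_norm// (splitr e) (le_trans unv)// lerD2l.
Qed.

Lemma cvg_ln_pinfty : ln x @[x --> +oo] --> (+oo : set_system R).
Proof.
apply/cvgryPge => A; apply: filterS (nbhs_pinfty_ge (num_real (expR A))) => x Ax.
by rewrite -(expRK A) ler_ln ?posrE ?expR_gt0// (lt_le_trans (expR_gt0 A)).
Qed.

Lemma cvg_lnn : ln n%:R @[n --> \oo] --> (+oo : set_system R).
Proof. exact: cvg_comp cvgr_idn cvg_ln_pinfty. Qed.

Lemma cvg_lnlnn : ln (ln n%:R) @[n --> \oo] --> (+oo : set_system R).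
Proof. exact: cvg_comp cvg_lnn cvg_ln_pinfty. Qed.

Lemma cvg0_le_lnlnn (K : R) u :
  (\forall n \near \oo, 0 <= u n <= K / ln (ln n%:R)) -> u n @[n --> \oo] --> (0 : R).
Proof.
move=> uK; apply: squeeze_cvg0 uK _; apply: cvg0Z; apply/gtr0_cvgV0; last exact: cvg_lnlnn.
by move/cvgryPgt : cvg_lnlnn; exact.
Qed.

Lemma ln_le_linear (x d : R) : 0 < x -> 0 < d -> ln x <= d * x - ln d.
Proof.
move=> x0 d0; rewrite lerBrDl -lnM ?posrE// -[leRHS]expRK ler_ln ?posrE ?expR_gt0 ?mulr_gt0//.
exact: ge_id_expR.
Qed.

End limits.

Section limit_inferior.
Variable R : realType.
Implicit Types u : (\bar R)^nat.
Local Open Scope classical_set_scope.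
Local Open Scope ereal_scope.

Lemma near_gt_limn_einf u x : x < limn_einf u -> \forall n \near \oo, x < u n.
Proof.
rewrite limn_einf_lim (cvg_lim _ (@cvg_einfs_sup _ u))// => /ereal_sup_gt[_ [N _ <-] xN].
by exists N => // n /= Nn; apply: lt_le_trans xN _; apply: ereal_inf_lbound; exists n.
Qed.

Lemma near_lt_limn_esup u x : limn_esup u < x -> \forall n \near \oo, u n < x.
Proof.
rewrite -lteN2 -limn_einfN => /near_gt_limn_einf; apply: filterS => n /=.
by rewrite lteN2.
Qed.

Lemma near_bounds_of_limn_einf_esup (f : R^nat) :
  0 < limn_einf (fun n => (f n)%:E) -> limn_esup (fun n => (f n)%:E) < +oo ->
  exists c C : R, (0 < c)%R /\ \forall n \near \oo, (c <= f n <= C)%R.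
Proof.
move=> inf0 supy.
have [c c0 c_inf] : exists2 c : R, (0 < c)%R & c%:E < limn_einf (fun n => (f n)%:E).
  case: (limn_einf _) inf0 => [l|_|//]; last by exists 1%R; rewrite ?ltry.
  by rewrite lte_fin => l0; exists (l / 2)%R; rewrite ?lte_fin; lra.
have [C C_sup] : exists C : R, limn_esup (fun n => (f n)%:E) < C%:E.
  case: (limn_esup _) supy => [l _|//|_]; last by exists 0%R; rewrite ltNyr.
  by exists (l + 1)%R; rewrite lte_fin ltrDl.
exists c, C; split => //.
apply: filterS2 (near_gt_limn_einf c_inf) (near_lt_limn_esup C_sup) => n.
by rewrite !lte_fin => /ltW -> /ltW.
Qed.

End limit_inferior.

Section asymptotics.
Variables (R : realType) (alpha : nat -> R) (beta c C : R).
Hypothesis c0 : 0 < c.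
Hypothesis beta0 : 0 < beta.
Local Open Scope classical_set_scope.
Hypothesis near_alpha : \forall n \near \oo, c <= alpha n <= C.

Local Notation L n := (ln n%:R : R).
Local Notation LL n := (ln (ln n%:R) : R).
Local Notation q := (q_ alpha).
Local Notation a n := (n%:R * q_ alpha n : R).
Local Notation w n := (LL n ^+ 2).

(* The last depth at which the layers are negligible in front of n, one less
   than the paper's d_n^*. *)
Definition depth n : nat := `|dstar alpha n|%N.-1.
Local Notation D n := (depth n).
Local Notation theta n := (a n ^+ (D n).+1 / n%:R).

Record large_index (n : nat) : Prop := LargeIndex {
  large_index_gt0 : (0 < n)%N;
  large_index_expR_lnln : expR (LL n) = L n;
  large_index_lnln : 4 <= LL n;
  large_index_ln : LL n ^+ 4 / 24 <= L n;
  large_index_sqr : (L n / 2) ^+ 2 <= n%:R;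
  large_index_degree : c * L n <= a n <= C * L n }.

Lemma near_large_index : \forall n \near \oo, large_index n.
Proof.
have near_lnln : \forall n \near \oo, 4 <= LL n by move/cvgryPge : (@cvg_lnlnn R); exact.
have near_ln : \forall n \near \oo, 1 <= L n by move/cvgryPge : (@cvg_lnn R); exact.
apply: filterS3 (filterI near_alpha (nbhs_infty_gt 0)) near_lnln near_ln.
move=> n [/andP[ca aC] n0] LL4 L1.
have nR : 0 < n%:R :> R by rewrite ltr0n.
have L0 : 0 < L n by exact: lt_le_trans L1.
have expLL : expR (LL n) = L n by rewrite lnK.
have expL : expR (L n) = n%:R by rewrite lnK ?posrE.
have aE : a n = alpha n * L n by rewrite /q_ mulrC divfK// gt_eqF.
split => //; last by rewrite aE !ler_pM2r// ca.
- have LL0 : 0 <= LL n by apply: le_trans LL4.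
  by have := expR_ge1Dxn 3 LL0; rewrite expLL; apply: le_trans; rewrite lerDr.
- have := expR_ge1Dxn 1 (ltW L0); rewrite expL; apply: le_trans.
  by rewrite (_ : 2`!%:R = 2)//; have := sqr_ge0 (L n); lra.
Qed.

Section large_index_bounds.
Variable n : nat.
Hypothesis large : large_index n.

Lemma lnln_gt0 : 0 < LL n.
Proof. by apply: lt_le_trans (large_index_lnln large). Qed.

Lemma lnln_le_ln : LL n <= L n.
Proof. by rewrite -[leRHS](large_index_expR_lnln large); exact: ge_id_expR. Qed.

Lemma lnn_gt0 : 0 < L n.
Proof. by rewrite -(large_index_expR_lnln large) expR_gt0. Qed.

Lemma mean_degree_gt0 : 0 < a n.
Proof.
by have /andP[ca _] := large_index_degree large; apply: lt_le_trans ca; rewrite mulr_gt0// lnn_gt0.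
Qed.

Lemma lnln_cube_le : LL n ^+ 3 <= 24 / LL n * L n.
Proof.
have LL0 := lnln_gt0; rewrite -ler_pdivrMl ?divr_gt0//.
apply: le_trans (large_index_ln large); rewrite le_eqVlt; apply/orP; left; apply/eqP.
by field; rewrite gt_eqF.
Qed.

Lemma lnln_sqr_le_cube : LL n ^+ 2 <= LL n ^+ 3.
Proof. by rewrite ler_weXn2l//; apply: le_trans (large_index_lnln large); rewrite ler1n. Qed.

Lemma ln_half_le_sqrt : L n / 2 <= Num.sqrt n%:R.
Proof.
rewrite -(@ger0_norm _ (L n / 2)) ?divr_ge0 ?(ltW lnn_gt0)// -sqrtr_sqr.
exact/ler_wsqrtr/large_index_sqr.
Qed.

End large_index_bounds.

Lemma alpha_upper_gt0 : 0 < C.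
Proof.
by case: near_alpha => N _ /(_ N (leqnn N))/andP[cN NC]; apply: lt_le_trans (le_trans cN NC).
Qed.

Lemma near_depth : \forall n \near \oo,
  [/\ a n ^+ D n <= n%:R / w n, n%:R / w n <= a n ^+ (D n).+1 &
      theta n = ln (lambda_ alpha n)^-1].
Proof.
have near_ln : \forall n \near \oo, 2 / c <= L n by move/cvgryPge : (@cvg_lnn R); exact.
apply: filterS2 near_large_index near_ln => n large Lc.
have LL4 := large_index_lnln large; have /andP[ca _] := large_index_degree large.
have a1 : 1 < a n.
  apply: lt_le_trans ca; apply: (@lt_le_trans _ _ 2); first by rewrite ltr1n.
  by rewrite mulrC -ler_pdivrMr.
have L1 : 1 < L n by apply: lt_le_trans (le_trans LL4 (lnln_le_ln large)); rewrite ltr1n.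
have w0 : 0 < w n by rewrite exprn_gt0// lnln_gt0.
have nw : 1 < n%:R / w n.
  rewrite ltr_pdivlMr// mul1r; apply: lt_le_trans (large_index_sqr large).
  rewrite ltrXn2r ?nnegrE ?divr_ge0 ?(ltW (lnln_gt0 _)) ?(ltW (lnn_gt0 _))//.
  have : 64 <= LL n ^+ 3.
    rewrite (_ : 64 = 4 ^+ 3 :> R); last by ring.
    by rewrite lerXn2r ?nnegrE// (le_trans _ LL4).
  have := large_index_ln large; rewrite (exprS _ 3); move: LL4; nra.
have [] := @dstarP R alpha n L1 a1.
rewrite /depth ln_lambda_; case: (dstar alpha n) => [[|k]|k].
- by rewrite expr0z leNgt nw.
- move=> reach minimal; split => //=; rewrite leNgt; apply/negP => /ltW reach_k.
  by have := minimal k reach_k; rewrite lez_nat ltnn.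
move=> + _; rewrite leNgt => /negP[]; apply: le_lt_trans nw.
by rewrite NegzE -exprnN invf_le1 ?exprn_gt0 ?exprn_ege1 ?ltW// (lt_trans _ a1).
Qed.

Lemma cvg_layer_density : a n ^+ D n / n%:R @[n --> \oo] --> (0 : R).
Proof.
apply: (@cvg0_le_lnlnn _ 1); apply: filterS2 near_large_index near_depth => n large [aD _ _].
have a0 := mean_degree_gt0 large; have LL0 := lnln_gt0 large.
have n0 : 0 < n%:R :> R by rewrite ltr0n (large_index_gt0 large).
rewrite divr_ge0 ?exprn_ge0 ?(ltW a0)//= ler_pdivrMr//; apply: le_trans aD _.
rewrite mulrC ler_pM2r// mul1r lef_pV2 ?posrE ?exprn_gt0// expr2 ler_peMr ?ltW//.
by apply: lt_le_trans (large_index_lnln large); rewrite ltr1n.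
Qed.

Lemma cvg_w_div_degree : w n / a n @[n --> \oo] --> (0 : R).
Proof.
apply: (@cvg0_le_lnlnn _ (24 / c)); apply: filterS near_large_index => n large.
have a0 := mean_degree_gt0 large; have LL0 := lnln_gt0 large.
have /andP[ca _] := large_index_degree large.
rewrite divr_ge0 ?sqr_ge0 ?(ltW a0)//= ler_pdivrMr//.
apply: le_trans (lnln_sqr_le_cube large) (le_trans (lnln_cube_le large) _).
rewrite (_ : 24 / LL n * L n = 24 / c / LL n * (c * L n)); last by field; rewrite !gt_eqF.
by rewrite ler_pM2l// !divr_gt0.
Qed.

Lemma cvg_inv_sqrt_degree : (Num.sqrt (a n))^-1 @[n --> \oo] --> (0 : R).
Proof.
have s0 : 0 < Num.sqrt (c / 24) by rewrite sqrtr_gt0 divr_gt0.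
apply: (@cvg0_le_lnlnn _ (Num.sqrt (c / 24))^-1); apply: filterS near_large_index => n large.
have a0 := mean_degree_gt0 large; have LL0 := lnln_gt0 large.
have /andP[ca _] := large_index_degree large.
rewrite invr_ge0 sqrtr_ge0 -invfM lef_pV2 ?posrE ?mulr_gt0 ?sqrtr_gt0 ?divr_gt0//=.
rewrite -{1}(ger0_norm (ltW LL0)) -sqrtr_sqr -sqrtrM ?divr_ge0 ?(ltW c0)//.
apply: ler_wsqrtr; apply: le_trans ca; rewrite -mulrA ler_pM2l// ler_pdivrMl//.
apply: le_trans (lnln_sqr_le_cube large) (le_trans (lnln_cube_le large) _).
rewrite ler_pM2r ?lnn_gt0// ler_pdivrMr// ler_peMr//.
by apply: le_trans (large_index_lnln large); rewrite ler1n.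
Qed.

Lemma cvg_w_div_sqrt : w n / Num.sqrt n%:R @[n --> \oo] --> (0 : R).
Proof.
apply: (@cvg0_le_lnlnn _ 48); apply: filterS near_large_index => n large.
have LL0 := lnln_gt0 large; have sn := ln_half_le_sqrt large.
have sn0 : 0 < Num.sqrt n%:R :> R by apply: lt_le_trans sn; rewrite divr_gt0 ?lnn_gt0.
rewrite divr_ge0 ?sqr_ge0 ?sqrtr_ge0//= ler_pdivrMr//.
apply: le_trans (lnln_sqr_le_cube large) (le_trans (lnln_cube_le large) _).
rewrite (_ : 24 / LL n * L n = 48 / LL n * (L n / 2)); last by field; rewrite gt_eqF.
by rewrite ler_pM2l// divr_gt0.
Qed.

Lemma cvg_inv_sqrt : (Num.sqrt n%:R)^-1 @[n --> \oo] --> (0 : R).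
Proof.
apply: squeeze_cvg0 cvg_w_div_sqrt; apply: filterS near_large_index => n large.
rewrite invr_ge0 sqrtr_ge0 -[X in X <= _]mul1r ler_wpM2r ?invr_ge0 ?sqrtr_ge0//=.
by rewrite exprn_ege1//; apply: le_trans (large_index_lnln large); rewrite ler1n.
Qed.

Lemma cvg_q : q n @[n --> \oo] --> (0 : R).
Proof.
apply: (@cvg0_le_lnlnn _ (4 * C)); apply: filterS near_large_index => n large.
have L0 := lnn_gt0 large; have LL0 := lnln_gt0 large; have C0 := alpha_upper_gt0.
have a0 := mean_degree_gt0 large; have /andP[_ aC] := large_index_degree large.
have n0 : 0 < n%:R :> R by rewrite ltr0n (large_index_gt0 large).
apply/andP; split; first by rewrite -(pmulr_rge0 _ n0) ltW.
rewrite -(ler_pM2l n0); apply: le_trans aC _; rewrite [C * _]mulrC.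
have -> : n%:R * (4 * C / LL n) = n%:R / LL n * 4 * C by ring.
rewrite ler_pM2r// mulrAC ler_pdivlMr//.
apply: (@le_trans _ _ (L n * L n)); first by rewrite ler_pM2l// lnln_le_ln.
by have := large_index_sqr large; rewrite expr2; lra.
Qed.

Lemma cvg_layer_dev : layer_dev n%:R (a n) (D n) @[n --> \oo] --> (0 : R).
Proof.
apply: cvg0D; first exact: cvg0Z cvg_inv_sqrt_degree.
exact: cvg0Z_div cvg_layer_density.
Qed.

Lemma cvg_small_layer_err :
  small_layer_err n%:R (a n) (w n) (D n) @[n --> \oo] --> (0 : R).
Proof.
apply: cvg0D; last exact: cvg0Z_div cvg_w_div_sqrt.
apply: cvg0D; first exact: cvg0Z cvg_layer_dev.
exact: cvg0Z_div cvg_layer_density.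
Qed.

Lemma cvg_far_err : far_err n%:R (a n) (w n) (D n) @[n --> \oo] --> (0 : R).
Proof. by apply: cvg0D cvg_small_layer_err; exact: cvg0Z_div cvg_w_div_degree. Qed.

Lemma near_sparse_regime : \forall n \near \oo, sparse_regime n%:R (q n) (w n) (D n).
Proof.
have near_ln : \forall n \near \oo, 4 / c <= L n by move/cvgryPge : (@cvg_lnn R); exact.
have near_q : \forall n \near \oo, q n <= 1 by exact: cvgr_le cvg_q _ ltr01.
apply: filterS2 (filterI near_large_index near_depth) (filterI near_q near_ln).
move=> n [large [_ aD _]] [q1 Lc]; have /andP[ca _] := large_index_degree large.
split => //.
- rewrite q1 andbT -(pmulr_rge0 _ (_ : 0 < n%:R)) ?ltr0n ?(large_index_gt0 large)//.
  exact/ltW/mean_degree_gt0.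
- by apply: le_trans ca; rewrite mulrC -ler_pdivrMr.
- by rewrite exprn_ege1//; apply: le_trans (large_index_lnln large); rewrite ler1n.
Qed.

Lemma cvg_layer_ratio (lambda : R) : 0 < lambda ->
  lambda_ alpha n @[n --> \oo] --> lambda -> theta n @[n --> \oo] --> ln lambda^-1.
Proof.
move=> l0 lambda_cvg; rewrite lnV ?posrE//.
have /cvgN := cvg_comp _ _ lambda_cvg (continuous_ln l0); apply: cvg_trans.
apply: near_eq_cvg; apply: filterS near_depth => n [_ _ ->] /=.
by rewrite lnV// posrE expR_gt0.
Qed.

Lemma cvg_inv_layer_ratio : lambda_ alpha n @[n --> \oo] --> (0 : R) ->
  n%:R / a n ^+ (D n).+1 @[n --> \oo] --> (0 : R).
Proof.
move=> lambda_cvg; apply/cvgrPdist_le => e e0.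
have near_lambda : \forall n \near \oo, lambda_ alpha n <= expR (- e^-1).
  by apply: cvgr_le lambda_cvg _ _; rewrite expR_gt0.
apply: filterS3 near_depth near_large_index near_lambda => n [_ _ theta_ln] large lambda_le.
have ie0 : 0 < e^-1 by rewrite invr_gt0.
have e_theta : e^-1 <= theta n.
  by rewrite theta_ln lnV ?posrE ?expR_gt0// lerNr -[leRHS]expRK ler_ln ?posrE ?expR_gt0.
rewrite sub0r normrN -invf_div ger0_norm ?invr_ge0 ?(le_trans _ e_theta) ?(ltW ie0)//.
by rewrite -[leRHS]invrK lef_pV2 ?posrE// (lt_le_trans ie0).
Qed.

Lemma overlap_tailE (limit eps : R) (m : nat) :
  sparse_regime m.+1%:R (q m.+1) (w m.+1) (D m.+1) ->
  overlap_tail alpha beta limit eps m =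
  @replica_prob 'I_m.+1 R (q m.+1) (beta * LL m.+1) ord0
    (fun _ T T' => eps < `|overlap R ord0 T T' - limit|).
Proof. by case/regime_q01/andP => _ /min_idPl q1; rewrite /overlap_tail q1. Qed.

Lemma overlap_cvg_of_tail_le (limit : R) :
  (forall eps e : R, 0 < eps <= 1 -> 0 < e ->
     exists2 v, v n @[n --> \oo] --> (0 : R) &
       \forall m \near \oo, overlap_tail alpha beta limit eps m <= e + v m.+1) ->
  overlap_cvg_in_prob alpha beta limit.
Proof.
move=> tail_le eps eps0; apply: cvg0_of_le_add => [|e e0].
  apply: filterS (near_succ near_sparse_regime) => m reg.
  by rewrite overlap_tailE// replica_prob_ge0// (regime_q01 reg).
have eps01 : 0 < Num.min eps 1 <= 1 by rewrite lt_min eps0 ltr01 ge_min lexx orbT.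
have [v v0 tail_v] := tail_le _ _ eps01 e0.
exists (fun m => v m.+1); first by rewrite (cvg_shiftS v).
apply: filterS2 (near_succ near_sparse_regime) tail_v => m reg; apply: le_trans.
rewrite !overlap_tailE//; apply: (le_replica_prob _ _ (regime_q01 reg)) => G T T'.
by apply: le_lt_trans; rewrite ge_min lexx.
Qed.

Lemma near_degree_damping_le : \forall n \near \oo,
  expR (- (beta * LL n)) * a n <= C * expR ((1 - beta) * LL n).
Proof.
apply: filterS near_large_index => n large; have /andP[_ aC] := large_index_degree large.
apply: (@le_trans _ _ (expR (- (beta * LL n)) * (C * L n))).
  by rewrite ler_wpM2l ?expR_ge0.
rewrite mulrCA ler_pM2l ?alpha_upper_gt0// -[X in _ * X](large_index_expR_lnln large) -expRD.
by rewrite ler_expR mulrBl mul1r addrC.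
Qed.

(* Relative error of [limit * n] as an estimate of the sum of the inverse parent
   counts, when a layer of s vertices stands for the layer at the depth D n. *)
Definition parent_dev_err (limit : R) (s n : nat) : R :=
  (Num.sqrt n%:R)^-1 + 4 * a n ^+ D n / n%:R +
  q n * (a n ^+ D n * layer_dev n%:R (a n) (D n) + `|a n ^+ D n - s%:R|) +
  `|binomial_expect (q n) s (fun j => j%:R^-1) - limit| + far_err n%:R (a n) (w n) (D n).

Definition inv_parent_err (n : nat) : R :=
  12 * n%:R / a n ^+ (D n).+1 + 2 * layer_dev n%:R (a n) (D n) +
  2 * a n ^+ D n / n%:R + far_err n%:R (a n) (w n) (D n).

Section tail_bounds.
Variable m : nat.
Local Notation n := m.+1.
Hypothesis reg : sparse_regime n%:R (q n) (w n) (D n).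
Hypothesis large : large_index n.
Local Notation EG := (expect (@edge_prob R 'I_m.+1 (q n))).
Local Notation b := (beta * LL n).

Let reg' : sparse_regime #|'I_m.+1|%:R (q n) (w n) (D n). Proof. by rewrite card_ord. Qed.
Let b0 : 0 <= b. Proof. by rewrite mulr_ge0 ?(ltW beta0)// ltW// lnln_gt0. Qed.

Lemma overlap_tail_bfs_err_le (limit eps dev_err cost_err : R) :
  0 <= limit <= 1 -> 0 < eps <= 1 ->
  EG (fun G => `|inv_parent_sum R ord0 G - limit * n%:R|) <= n%:R * dev_err ->
  EG (fun G => detour_cost ord0 G b) <= n%:R * cost_err ->
  overlap_tail alpha beta limit eps m <=
  64 / eps ^+ 2 * (dev_err + 2 * n%:R^-1 + far_err n%:R (a n) (w n) (D n) + cost_err).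
Proof.
move=> limit01 eps01 dev_le cost_le; rewrite overlap_tailE//.
have := replica_prob_bfs_le b0 reg' limit01 eps01; rewrite card_ord; exact.
Qed.

Lemma expect_sum_degree_ord : EG (fun G => \sum_v (degree G v)%:R) <= n%:R * (a n).
Proof. by have := expect_sum_degree 'I_m.+1 (regime_q01 reg); rewrite card_ord. Qed.

Lemma overlap_tail_damped_le (limit eps : R) (s : nat) : 0 <= limit <= 1 -> 0 < eps <= 1 ->
  overlap_tail alpha beta limit eps m <= 64 / eps ^+ 2 *
    (parent_dev_err limit s n + 2 * n%:R^-1 + far_err n%:R (a n) (w n) (D n) +
     18 * (expR (- b) * a n)).
Proof.
move=> limit01 eps01; apply: overlap_tail_bfs_err_le => //.
  by have := expect_inv_parent_sum_dev ord0 reg' limit s; rewrite card_ord.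
apply: le_trans (le_expect (edge_prob01 (regime_q01 reg))
  (fun G => detour_cost_le_degree ord0 G b)) _.
rewrite expectZ -mulrA [leRHS]mulrCA ler_pM2l// [leRHS]mulrCA ler_pM2l ?expR_gt0//.
exact: expect_sum_degree_ord.
Qed.

Lemma overlap_tail_many_parents_le (eps K : R) : 0 < eps <= 1 -> 0 < K ->
  overlap_tail alpha beta 0 eps m <= 64 / eps ^+ 2 *
    (inv_parent_err n + 2 * n%:R^-1 + far_err n%:R (a n) (w n) (D n) +
     6 * (expR (- b) * a n / K + K * inv_parent_err n)).
Proof.
move=> eps01 K0; have e01 := @edge_prob01 R 'I_n _ (regime_q01 reg).
have parents_le : EG (fun G => inv_parent_sum R ord0 G) <= n%:R * inv_parent_err n.
  by have := expect_inv_parent_sum_le ord0 reg'; rewrite card_ord.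
apply: overlap_tail_bfs_err_le; rewrite ?lexx ?ler01//.
  apply: le_trans parents_le; apply: (le_expect e01) => G.
  by rewrite mul0r subr0 ger0_norm// inv_parent_sum_ge0.
apply: le_trans (le_expect e01 (fun G => detour_cost_le_amgm ord0 G b K0)) _.
rewrite expectZ mulrCA ler_pM2l// expectD !expectZ mulrDr; apply: lerD.
  rewrite [leRHS](_ : _ = expR (- b) / K * (n%:R * a n)); last by ring.
  by rewrite ler_pM2l ?divr_gt0 ?expR_gt0// expect_sum_degree_ord.
by rewrite mulrCA ler_pM2l.
Qed.

End tail_bounds.

Section poisson_parents.
Variable lambda : R.
Hypothesis lambda01 : 0 < lambda < 1.
Hypothesis lambda_cvg : lambda_ alpha n @[n --> \oo] --> lambda.
Local Notation mu := (ln lambda^-1).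

Definition layer_size n : nat := Num.truncn (a n ^+ D n).

Let theta_cvg : theta n @[n --> \oo] --> mu.
Proof. by case/andP: lambda01 => l0 _; exact: cvg_layer_ratio. Qed.

Lemma layer_mul_q n : (0 < n)%N -> a n ^+ D n * q n = theta n.
Proof.
move=> n0; rewrite exprS; move: (a n ^+ D n) => z.
by rewrite [RHS]mulrAC [n%:R * _]mulrC mulfK ?pnatr_eq0 -?lt0n// mulrC.
Qed.

Lemma near_layer_size : \forall n \near \oo,
  [/\ 0 <= q n, a n ^+ D n * q n = theta n &
      (layer_size n)%:R <= a n ^+ D n <= (layer_size n)%:R + 1].
Proof.
apply: filterS2 near_sparse_regime (nbhs_infty_gt 0) => n reg n0.
have aD : 0 <= a n ^+ D n by rewrite exprn_ge0// (le_trans _ (regime_degree reg)).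
have /andP[lower upper] := Num.Theory.truncn_itv aD.
by split; [case/andP: (regime_q01 reg)|exact: layer_mul_q|rewrite lower natr1 ltW].
Qed.

Lemma cvg_layer_size_mul_q : (layer_size n)%:R * q n @[n --> \oo] --> mu.
Proof.
apply: (@squeeze_cvgr _ _ _ _ (fun n => theta n - q n) (fun n => theta n)) => //.
  apply: filterS near_layer_size => n [q0 <- /andP[lower upper]].
  rewrite (ler_wpM2r q0 lower) andbT lerBlDr -[X in _ <= _ + X]mul1r -mulrDl.
  exact: ler_wpM2r.
by rewrite -[X in _ --> X]subr0; apply: cvgB => //; exact: cvg_q.
Qed.

Lemma cvg_mean_inv_parents :
  `|binomial_expect (q n) (layer_size n) (fun j => j%:R^-1) - f_overlap lambda|
    @[n --> \oo] --> (0 : R).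
Proof.
apply/norm_cvg0P; apply/subr_cvg0; rewrite f_overlapE//.
apply: cvg_binomial_expect_poisson; last exact: cvg_invr_nat.
- exact: ln_inv_gt0.
- by apply: filterS near_layer_size => n [].
- exact: cvg_q.
- exact: cvg_layer_size_mul_q.
Qed.

Lemma cvg_mean_layer_fluctuation :
  q n * (a n ^+ D n * layer_dev n%:R (a n) (D n) + `|a n ^+ D n - (layer_size n)%:R|)
    @[n --> \oo] --> (0 : R).
Proof.
apply: (@squeeze_cvg0 _ _ (fun n => theta n * layer_dev n%:R (a n) (D n) + q n)).
  apply: filterS2 near_layer_size near_sparse_regime => n [q0 <- /andP[lower upper]] reg.
  have a0 : 0 <= a n by rewrite (le_trans _ (regime_degree reg)).
  have dev0 : 0 <= layer_dev n%:R (a n) (D n).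
    by rewrite addr_ge0// divr_ge0 ?sqrtr_ge0// mulr_ge0// exprn_ge0.
  apply/andP; split; first by rewrite mulr_ge0// addr_ge0// mulr_ge0// exprn_ge0.
  rewrite mulrDr; apply: lerD; first by rewrite mulrCA mulrA.
  by rewrite ler_piMr// ger0_norm ?subr_ge0// lerBlDl.
apply: cvg0D cvg_q; rewrite -(mulr0 mu); exact: cvgM theta_cvg cvg_layer_dev.
Qed.

Lemma cvg_parent_dev_err :
  parent_dev_err (f_overlap lambda) (layer_size n) n @[n --> \oo] --> (0 : R).
Proof.
apply: cvg0D cvg_far_err; apply: cvg0D cvg_mean_inv_parents.
apply: cvg0D cvg_mean_layer_fluctuation; apply: cvg0D cvg_inv_sqrt _.
exact: cvg0Z_div cvg_layer_density.
Qed.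

Lemma overlap_cvg_poisson : 1 < beta -> overlap_cvg_in_prob alpha beta (f_overlap lambda).
Proof.
move=> beta1; apply: overlap_cvg_of_tail_le => eps e eps01 e0.
have damping_cvg : expR (- (beta * LL n)) * a n @[n --> \oo] --> (0 : R).
  have gap0 : 0 < beta - 1 by rewrite subr_gt0.
  apply: (@cvg0_le_lnlnn _ (C / (beta - 1))).
  apply: filterS2 near_large_index near_degree_damping_le => n large damping_le.
  rewrite mulr_ge0 ?expR_ge0 ?(ltW (mean_degree_gt0 large))//=; apply: le_trans damping_le _.
  rewrite -mulrA ler_pM2l ?alpha_upper_gt0// -invfM.
  by rewrite -opprB mulNr expRN_le_inv// mulr_gt0// lnln_gt0.
exists (fun n => 64 / eps ^+ 2 * (parent_dev_err (f_overlap lambda) (layer_size n) n +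
    2 * n%:R^-1 + far_err n%:R (a n) (w n) (D n) + 18 * (expR (- (beta * LL n)) * a n))).
  apply: cvg0Z; apply: cvg0D; last exact: cvg0Z.
  apply: cvg0D cvg_far_err; apply: cvg0D cvg_parent_dev_err _.
  exact: cvg0Z (@cvg_invr_nat R).
apply: filterS2 (near_succ near_sparse_regime) (near_succ near_large_index) => m reg large.
apply: ler_wpDl (ltW e0) _; exact: overlap_tail_damped_le (f_overlap01 lambda01) eps01.
Qed.

End poisson_parents.

Lemma overlap_cvg_many_parents : 1 <= beta ->
  lambda_ alpha n @[n --> \oo] --> (0 : R) -> overlap_cvg_in_prob alpha beta 0.
Proof.
move=> beta1 lambda_cvg; apply: overlap_cvg_of_tail_le => eps e eps01 e0.
have eps0 : 0 < 64 / eps ^+ 2 by case/andP: eps01 => eps0 _; rewrite divr_gt0// exprn_gt0.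
have C0 := alpha_upper_gt0; pose K := 6 * C * (64 / eps ^+ 2) / e.
have K0 : 0 < K by rewrite /K divr_gt0// mulr_gt0// mulr_gt0.
have parents_cvg : inv_parent_err n @[n --> \oo] --> (0 : R).
  apply: cvg0D cvg_far_err; apply: cvg0D; last exact: cvg0Z_div cvg_layer_density.
  apply: cvg0D; last exact: cvg0Z cvg_layer_dev.
  exact: cvg0Z_div (cvg_inv_layer_ratio lambda_cvg).
exists (fun n => 64 / eps ^+ 2 *
    (inv_parent_err n + 2 * n%:R^-1 + far_err n%:R (a n) (w n) (D n) +
     6 * (K * inv_parent_err n))).
  apply: cvg0Z; apply: cvg0D; last by apply: cvg0Z; exact: cvg0Z.
  by apply: cvg0D cvg_far_err; apply: cvg0D parents_cvg _; exact: cvg0Z (@cvg_invr_nat R).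
apply: filterS3 (near_succ near_sparse_regime) (near_succ near_large_index)
  (near_succ near_degree_damping_le) => m reg large damping_le.
apply: le_trans (overlap_tail_many_parents_le reg large eps01 K0) _.
have damping_C : expR (- (beta * LL m.+1)) * a m.+1 <= C.
  apply: le_trans damping_le _; rewrite ler_piMr ?(ltW C0)// expR_le1.
  by rewrite mulr_le0_ge0 ?subr_le0// ltW// lnln_gt0.
have eE : e = 64 / eps ^+ 2 * (6 * (C / K)).
  by rewrite /K; move: (64 / _) eps0 => k k0; field; rewrite !gt_eqF.
rewrite [X in _ <= X + _]eE -mulrDr ler_pM2l// (mulrDr 6) addrCA lerD2r.
by rewrite ler_pM2l// ler_pM2r ?invr_gt0.
Qed.

Lemma near_expR_lnln_le_degree (x : R) : x < 1 ->
  \forall n \near \oo, expR (x * LL n) <= a n.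
Proof.
move=> x1; have x10 : 0 < 1 - x by rewrite subr_gt0.
have near_lnln : \forall n \near \oo, - ln c / (1 - x) <= LL n.
  by move/cvgryPge : (@cvg_lnlnn R); exact.
apply: filterS2 near_large_index near_lnln => n large; rewrite ler_pdivrMr// => lnc_le.
have /andP[ca _] := large_index_degree large; apply: le_trans ca.
rewrite -[X in _ <= _ * X](large_index_expR_lnln large) -{1}(@lnK _ c) ?posrE//.
by rewrite -expRD ler_expR; lra.
Qed.

Section displaced_targets.
Variables gap eps : R.
Hypothesis gap0 : 0 < gap.
Hypothesis eps01 : 0 < eps <= 1.

Let eps0 : 0 < eps. Proof. by case/andP: eps01. Qed.
Let gap_eps0 : 0 < gap * eps. Proof. by rewrite mulr_gt0. Qed.

(* Small enough for the loss [4 eta ln (8 expR t a^2)] in the displaced rate to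
   be absorbed by its gain [t eps / 2], where t = gap log log n. *)
Definition target_ratio : R := gap * eps / 96.
Local Notation eta := target_ratio.

Definition target_size n : nat := Num.truncn (eta * n%:R).

Lemma target_ratio_gt0 : 0 < eta.
Proof. by rewrite divr_gt0. Qed.

Lemma near_target_size : \forall n \near \oo,
  eta * n%:R / 2 <= (target_size n)%:R <= eta * n%:R.
Proof.
have eta0 := target_ratio_gt0; apply: filterS (nbhs_infty_ger (2 / eta)) => n.
rewrite ler_pdivrMr// => n2; have en0 : 0 <= eta * n%:R by rewrite mulr_ge0// ltW.
have := Num.Theory.truncn_itv en0; rewrite -/(target_size n) -natr1 => /andP[-> upper].
by rewrite andbT; lra.
Qed.

Definition overflow_prob (m : nat) : R :=
  prob (@edge_prob R 'I_m.+1 (q m.+1)) (fun G => ~~ cheap_or_small_layer ord0 (q m.+1)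
    (beta * LL m.+1) (D m.+1) (target_size m.+1) (gap * LL m.+1) G).

Lemma overflow_prob_le :
  gap + beta < 1 \/ lambda_ alpha n @[n --> \oo] --> (1 : R) ->
  exists2 v, v n @[n --> \oo] --> (0 : R) & \forall m \near \oo, overflow_prob m <= v m.+1.
Proof.
case=> [gap_beta|lambda_cvg].
  exists (fun=> 0); first exact: cvg_cst.
  apply: filterS (near_succ (near_expR_lnln_le_degree gap_beta)) => m cheap.
  by rewrite /overflow_prob prob_cheap_displacement// card_ord -expRD -mulrDl.
exists (fun n => 2 / eta * theta n).
  by apply: cvg0Z; have := cvg_layer_ratio ltr01 lambda_cvg; rewrite invr1 ln1.
apply: filterS2 (near_succ near_sparse_regime) (near_succ near_target_size).
move=> m reg /andP[size_ge _]; have eta0 := target_ratio_gt0.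
have size0 : 0 < (target_size m.+1)%:R :> R.
  by apply: lt_le_trans size_ge; rewrite divr_gt0// mulr_gt0// ltr0n.
have reg' : sparse_regime #|'I_m.+1|%:R (q m.+1) (w m.+1) (D m.+1) by rewrite card_ord.
have := prob_large_layer_le ord0 (beta * LL m.+1) (gap * LL m.+1) reg' (x := target_size m.+1).
rewrite -(ltr0n R) card_ord => /(_ size0)/le_trans; apply.
rewrite (_ : 2 / eta * theta m.+1 = a m.+1 ^+ (D m.+1).+1 / (eta * m.+1%:R / 2)); last first.
  by move: (a m.+1 ^+ _) => z; field; rewrite !gt_eqF// ltr0n.
rewrite ler_wpM2l ?exprn_ge0 ?(le_trans _ (regime_degree reg))//.
by rewrite lef_pV2 ?posrE// divr_gt0// mulr_gt0// ltr0n.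
Qed.

Section displacement_gain.
Variable K : R.
Hypothesis gap_le_half : gap <= 2^-1.

Lemma target_ratio_le : eta <= 4^-1.
Proof.
have : gap * eps <= 2^-1 * 1 by apply: ler_pM; rewrite ?(ltW gap0) ?(ltW eps0)//; case/andP: eps01.
by rewrite /eta; lra.
Qed.

Definition target_min_size n : R := eta * n%:R / (16 * w n).

Lemma target_min_size_gt0 n : large_index n -> 0 < target_min_size n.
Proof.
move=> large; have n0 := large_index_gt0 large.
by rewrite divr_gt0 ?mulr_gt0 ?target_ratio_gt0 ?lnln_gt0 ?ltr0n.
Qed.

Definition displaced_rate_cst : R :=
  ln (8 * (32 / eta) ^+ 2) - 4 * ln (gap * eps / 32) + 4 * eta * (ln 8 + 2 * ln C) + 2 * K.

Lemma displaced_rate_le n : large_index n ->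
  displaced_rate n%:R (a n) eps (gap * LL n) (target_min_size n) eta K <=
  displaced_rate_cst - gap * eps / 4 * LL n.
Proof.
move=> large; have eta0 := target_ratio_gt0; have LL0 := lnln_gt0 large.
have L0 := lnn_gt0 large; have a0 := mean_degree_gt0 large; have C0 := alpha_upper_gt0.
have gap1 : gap <= 1 by rewrite (le_trans gap_le_half)// invf_le1// ler1n.
have n0 : 0 < n%:R :> R by rewrite ltr0n (large_index_gt0 large).
have target_ln : ln (8 * (2 * n%:R / target_min_size n) ^+ 2) =
    ln (8 * (32 / eta) ^+ 2) + 4 * ln (LL n).
  rewrite (_ : 8 * _ ^+ 2 = 8 * (32 / eta) ^+ 2 * LL n ^+ 4); last first.
    by rewrite /target_min_size; field; rewrite !gt_eqF.
  have cst0 : 0 < 8 * (32 / eta) ^+ 2 by rewrite mulr_gt0// exprn_gt0// divr_gt0.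
  rewrite lnM ?posrE ?exprn_gt0//.
  by congr (_ + _); rewrite lnXn// -[LHS]mulr_natl.
have lnln_le : ln (LL n) <= gap * eps / 32 * LL n - ln (gap * eps / 32).
  by apply: ln_le_linear => //; rewrite divr_gt0.
have degree_ln : ln (a n) <= ln C + LL n.
  rewrite -lnM ?posrE// ler_ln ?posrE ?(mulr_gt0 C0 L0)//.
  by case/andP: (large_index_degree large).
have loss_ln : ln (8 * expR (gap * LL n) * a n ^+ 2) = ln 8 + gap * LL n + 2 * ln (a n).
  move: (a n) a0 => d d0.
  rewrite lnM ?posrE ?mulr_gt0 ?expR_gt0 ?exprn_gt0// lnM ?posrE ?expR_gt0// expRK lnXn//.
  by congr (_ + _); rewrite -[LHS]mulr_natl.
have loss_le : 4 * eta * (ln 8 + gap * LL n + 2 * ln (a n)) <=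
    4 * eta * (ln 8 + 2 * ln C) + gap * eps / 8 * LL n.
  have gap_lnln : gap * LL n <= LL n by rewrite ler_piMl ?(ltW LL0).
  rewrite (_ : gap * eps / 8 * LL n = 4 * eta * (3 * LL n)); last by rewrite /eta; field.
  by rewrite -mulrDr ler_pM2l ?mulr_gt0//; lra.
rewrite /displaced_rate /displaced_rate_cst target_ln loss_ln.
move: lnln_le loss_le; move: (4 * eta * _) (4 * eta * _) (ln (LL n)) => loss loss' lnLL; lra.
Qed.

Lemma near_displaced_rate : \forall n \near \oo,
  displaced_rate n%:R (a n) eps (gap * LL n) (target_min_size n) eta K <= -1.
Proof.
have near_lnln : \forall n \near \oo, (displaced_rate_cst + 1) / (gap * eps / 4) <= LL n.
  by move/cvgryPge : (@cvg_lnlnn R); exact.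
apply: filterS2 near_large_index near_lnln => n large; rewrite ler_pdivrMr ?divr_gt0// => cst_le.
by apply: le_trans (displaced_rate_le large) _; lra.
Qed.

Lemma overlap_tail_displaced_targets_le (m : nat) (overflow : R) : 0 < K ->
  sparse_regime m.+1%:R (q m.+1) (w m.+1) (D m.+1) -> large_index m.+1 ->
  expR (gap * LL m.+1) <= a m.+1 ->
  eta * m.+1%:R / 2 <= (target_size m.+1)%:R <= eta * m.+1%:R ->
  displaced_rate m.+1%:R (a m.+1) eps (gap * LL m.+1) (target_min_size m.+1) eta K <= -1 ->
  overflow_prob m <= overflow ->
  overlap_tail alpha beta 0 eps m <= K^-1 +
  (eta^-1 * (2 * a m.+1 ^+ D m.+1 / m.+1%:R + 64 / eta * (w m.+1 / a m.+1) +
     small_layer_err m.+1%:R (a m.+1) (w m.+1) (D m.+1)) +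
   small_layer_err m.+1%:R (a m.+1) (w m.+1) (D m.+1) + overflow + m.+1%:R^-1).
Proof.
move=> K0 reg large gain_le /andP[size_ge size_le] rate_le overflow_le.
have eta0 := target_ratio_gt0; have LL0 := lnln_gt0 large.
have w0 : 0 < w m.+1 by rewrite exprn_gt0.
have n0 : 0 < m.+1%:R :> R by rewrite ltr0n.
have q0 : 0 < q m.+1 by rewrite -(pmulr_rgt0 _ n0) mean_degree_gt0.
have min_le_size : target_min_size m.+1 <= (target_size m.+1)%:R.
  apply: le_trans size_ge; rewrite ler_pM2l ?mulr_gt0// lef_pV2 ?posrE ?mulr_gt0//.
  by have := regime_w reg; lra.
have min_le : target_min_size m.+1 <= m.+1%:R / (16 * w m.+1).
  have nw0 : 0 <= m.+1%:R / (16 * w m.+1) by rewrite divr_ge0// ltW// mulr_gt0.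
  by rewrite /target_min_size -mulrA ler_piMl//; have := target_ratio_le; lra.
have reg' : sparse_regime #|'I_m.+1|%:R (q m.+1) (w m.+1) (D m.+1) by rewrite card_ord.
have b0 : 0 <= beta * LL m.+1 by rewrite mulr_ge0 ?(ltW beta0) ?(ltW LL0).
have t0 : 0 <= gap * LL m.+1 by rewrite mulr_ge0 ?(ltW gap0) ?(ltW LL0).
have := @replica_prob_displaced_le _ _ ord0 _ _ _ (target_size m.+1) _ eps _
  (target_min_size m.+1) eta K b0 reg' eps0 t0.
rewrite card_ord overlap_tailE// => /(_ gain_le (target_min_size_gt0 large) min_le_size min_le
  eta0 target_ratio_le size_le K0 _ overflow_le)/le_trans; apply.
have exp_le : expR (m.+1%:R * displaced_rate m.+1%:R (a m.+1) eps (gap * LL m.+1)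
    (target_min_size m.+1) eta K) <= m.+1%:R^-1.
  apply: le_trans (expRN_le_inv n0); rewrite ler_expR -[leRHS]mulrN1.
  by rewrite ler_pM2l.
have -> : 4 / (target_min_size m.+1 * q m.+1) = 64 / eta * (w m.+1 / a m.+1).
  by rewrite /target_min_size; field; rewrite !gt_eqF.
by rewrite [eta^-1 * _]mulrC [leRHS]addrA [K^-1 + _]addrC lerD2l.
Qed.

End displacement_gain.
End displaced_targets.

Lemma overlap_cvg_displaced :
  beta < 1 \/ lambda_ alpha n @[n --> \oo] --> (1 : R) -> overlap_cvg_in_prob alpha beta 0.
Proof.
move=> damping_or_lambda.
have [gap [gap0 gap2 gap_beta]] : exists gap : R, [/\ 0 < gap, gap <= 2^-1 &
    gap + beta < 1 \/ lambda_ alpha n @[n --> \oo] --> (1 : R)].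
  case: damping_or_lambda => [beta1|lambda_cvg]; last by exists 2^-1; split => //; right.
  by exists ((1 - beta) / 2); split; [lra|have := beta0; lra|left; lra].
apply: overlap_cvg_of_tail_le => eps e eps01 e0.
have K0 : 0 < e^-1 by rewrite invr_gt0.
have [overflow overflow_cvg overflow_le] := overflow_prob_le gap0 eps01 gap_beta.
have gap1 : gap < 1 by lra.
exists (fun n => (target_ratio gap eps)^-1 * (2 * a n ^+ D n / n%:R +
    64 / target_ratio gap eps * (w n / a n) + small_layer_err n%:R (a n) (w n) (D n)) +
  small_layer_err n%:R (a n) (w n) (D n) + overflow n + n%:R^-1).
  apply: cvg0D; last exact: cvg_invr_nat.
  apply: cvg0D overflow_cvg; apply: cvg0D cvg_small_layer_err; apply: cvg0Z.
  apply: cvg0D cvg_small_layer_err; apply: cvg0D; first exact: cvg0Z_div cvg_layer_density.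
  exact: cvg0Z cvg_w_div_degree.
apply: filterS3 (filterI (near_succ near_sparse_regime) (near_succ near_large_index))
  (filterI (near_succ (near_expR_lnln_le_degree gap1))
     (near_succ (near_displaced_rate gap0 eps01 e^-1 gap2)))
  (filterI (near_succ (near_target_size gap0 eps01)) overflow_le).
move=> m [reg large] [gain_le rate_le] [size_itv overflow_m]; rewrite -[X in X + _]invrK.
exact: overlap_tail_displaced_targets_le.
Qed.

End asymptotics.

Local Open Scope classical_set_scope.

Theorem theorem1p13 (R : realType) (alpha : nat -> R) (beta lambda : R)
  (alpha_gt0 : forall n : nat, (0 < n)%N -> 0 < alpha n)
  (alpha_liminf : (0 < limn_einf (fun n : nat => (alpha n)%:E))%E)
  (alpha_limsup : (limn_esup (fun n : nat => (alpha n)%:E) < +oo)%E)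
  (beta_gt0 : 0 < beta)
  (lambda01 : 0 <= lambda <= 1)
  (lambda_cvg : lambda_ alpha n @[n --> \oo] --> lambda) :
  (lambda = 0 \/ lambda = 1 \/ beta < 1 ->
     overlap_cvg_in_prob alpha beta 0) /\
  (0 < lambda < 1 -> 1 < beta ->
     overlap_cvg_in_prob alpha beta (f_overlap lambda)).
Proof.
have [c [C [c0 near_alpha]]] := near_bounds_of_limn_einf_esup alpha_liminf alpha_limsup.
split; last first.
  by move=> lambda_in beta1; exact: (overlap_cvg_poisson c0 beta_gt0 near_alpha lambda_in).
have [beta1 _|beta1] := ltP beta 1.
  by apply: (overlap_cvg_displaced c0 beta_gt0 near_alpha); left.
case=> [lambda0|[lambda1|//]].
- by apply: (overlap_cvg_many_parents c0 beta_gt0 near_alpha beta1); rewrite -lambda0.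
- by apply: (overlap_cvg_displaced c0 beta_gt0 near_alpha); right; rewrite -lambda1.
Qed.
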